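(* Suppose Assumptions 1, 2 and 3 hold. Let $k\ge1$ be an integer and suppose that $E(\int_0^T\mu_s^{2k}\,ds)<\infty$ and $E(\int_0^T\sigma_s^{2k}\,ds)<\infty$, and that there exists $p\in(2,3]$ such that $M_{U,2kp}=E(|U|^{2kp})<\infty$. If $\xi=\xi_n=o(n^{-p/\{2(p-1)\}})$, then, as $n\to\infty$, $$n^{1/2}\{\hat M_{U,2}(\xi)-M_{U,2},\ldots,\hat M_{U,2k}(\xi)-M_{U,2k}\}^{\mathsf T}\xrightarrow{d}Q=(Q_1,\ldots,Q_k)^{\mathsf T},$$ where $$Q_1=a_1W_1,\qquad Q_l=a_lW_l-\sum_{j=1}^{l-1}C_{2l}^{2j}M_{U,2l-2j}Q_j\quad(2\le l\le k),$$ and where the constants $a_1,\dots,a_k$ and the Gaussian vector $W=(W_1,\dots,W_k)^{\mathsf T}\sim N(0,\Sigma_k)$ are those defined in the context.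
   Context: Setting. $T>0$ is fixed. For each $n$ there is a deterministic grid $\mathcal G=\{t_0,\dots,t_n\}$ with $0=t_0<t_1<\dots<t_n=T$ (depending on $n$), $\Delta t_j=t_j-t_{j-1}$, and $\max_{1\le j\le n}\Delta t_j\to0$ as $n\to\infty$. The data are $Y_{t_j}=X_{t_j}+U_{t_j}$, $j=0,\dots,n$. The process $(X_t)_{t\in[0,T]}$ satisfies $dX_t=\mu_t\,dt+\sigma_t\,dB_t$, where $\mu_t$ is a locally bounded, progressively measurable process, $\sigma_t$ is a positive, locally bounded It\^o semimartingale, and $B_t$ is a standard Brownian motion. Assumption 1: the errors $U_{t_0},\dots,U_{t_n}$ are independent and identically distributed with unknown density $f_U$, and are independent of the process $(X_t)_{t\in[0,T]}$. Assumption 2: as $n\to\infty$, $\min_{1\le j\le n}\Delta t_j/\max_{1\le j\le n}\Delta t_j$ is uniformly bounded away from zero and infinity. Assumption 3: the characteristic function $f_U^{\mathrm{Ft}}(s)=\int e^{isx}f_U(x)\,dx$ is real-valued and does not vanish at any point of the real line. Moments. $U$ denotes a generic random variable with density $f_U$, and $\tilde U$ a generic random variable distributed as the difference of two independent copies of $U$; $M_{U,q}$ and $M_{\tilde U,q}$ denote their $q$th moments. Binomial coefficients are written $C_{2k}^{2j}=(2k)!/\{(2j)!(2k-2j)!\}$. Moment estimators. For $\xi>0$ let $S_j=\{t_\ell\in\mathcal G:|t_\ell-t_j|\le\xi,\ \ell\ne j\}$ for $j=0,\dots,n$, let $N_j$ be the number of points of $S_j$, and $N(\xi)=\sum_{j=0}^nN_j$.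 It is understood throughout that $\xi=\xi_n$ is such that $\max_{1\le j\le n}N_j\asymp\min_{1\le j\le n}N_j\asymp n\xi$, where $a_n\asymp b_n$ means $c_1\le a_n/b_n\le c_2$ for all $n\ge1$ for some positive constants $c_1,c_2$. For integers $k\ge1$ put $$\hat M_{\tilde U,2k}(\xi)=\frac1{N(\xi)}\sum_{j=0}^n\sum_{t_\ell\in S_j}(Y_{t_\ell}-Y_{t_j})^{2k}.$$ Define recursively $\hat M_{U,2}(\xi)=\hat M_{\tilde U,2}(\xi)/2$ and, for $k>1$, $$\hat M_{U,2k}(\xi)=\frac12\Big\{\hat M_{\tilde U,2k}(\xi)-\sum_{j=1}^{k-1}C_{2k}^{2j}\hat M_{U,2j}(\xi)\hat M_{U,2k-2j}(\xi)\Big\}.$$ Limit quantities. For $l=1,\dots,k$ let $$V_{2l}(\xi)=\mathrm{var}\Big[\{N(\xi)\}^{-1/2}\sum_{j=0}^n\sum_{t_\ell\in S_j}\{(U_{t_\ell}-U_{t_j})^{2l}-M_{\tilde U,2l}\}\Big],\qquad a_l=\frac12\lim_{n\to\infty}\{nV_{2l}(\xi)/N(\xi)\}^{1/2}.$$ $\Sigma_k$ is the $k\times k$ matrix whose $(l_1,l_2)$th element is $$e_{l_1l_2}=\lim_{n\to\infty}E\Big(\Big[\sum_{j=0}^n\sum_{t_\ell\in S_j}\frac{(U_{t_\ell}-U_{t_j})^{2l_1}-M_{\tilde U,2l_1}}{\{N(\xi)V_{2l_1}(\xi)\}^{1/2}}\Big]\Big[\sum_{j=0}^n\sum_{t_\ell\in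 S_j}\frac{(U_{t_\ell}-U_{t_j})^{2l_2}-M_{\tilde U,2l_2}}{\{N(\xi)V_{2l_2}(\xi)\}^{1/2}}\Big]\Big),$$ and $W=(W_1,\dots,W_k)^{\mathsf T}$ is a random vector with the $N(0,\Sigma_k)$ distribution. The limits defining $a_l$ and $e_{l_1l_2}$ are taken to exist. *)

(* Defs.v *)
From mathcomp Require Export all_boot all_order all_algebra.
From mathcomp Require Export complex.
From mathcomp Require Export all_classical all_reals all_analysis.
From mathcomp Require Export measurable_realfun.

Set Implicit Arguments.
Unset Strict Implicit.
Unset Printing Implicit Defensive.

Export Order.TTheory GRing.Theory Num.Theory.
Export numFieldNormedType.Exports.

Open Scope classical_set_scope.
Open Scope ring_scope.

Section Probability.
Context {d : measure_display} {Omega : measurableType d} {R : realType}.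
Variable P : probability Omega R.

Definition measurable_wrt (G : set (set Omega)) (f : Omega -> R) :=
  forall A : set R, measurable A -> G (f @^-1` A).

Definition independent_sigma (G H : set (set Omega)) :=
  forall A B, G A -> H B -> P (A `&` B) = (P A * P B)%E.

Definition sigma_of (I : Type) (D : set I) (X : I -> Omega -> R) :
    set (set Omega) :=
  <<s [set E | exists i A, [/\ D i, measurable A & E = X i @^-1` A]] >>.

(* The factors may be taken equal to the whole line, so that the product rule
   over all indices contains the one over every subfamily. *)
Definition independent_variables (m : nat) (X : 'I_m -> Omega -> R) :=
  forall A : 'I_m -> set R, (forall i, measurable (A i)) ->
    P (\bigcap_i (X i @^-1` A i)) = (\prod_(i < m) P (X i @^-1` A i))%E.

Definition has_density (f : R -> R) (X : Omega -> R) :=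
  forall A : set R, measurable A ->
    P (X @^-1` A) = (\int[lebesgue_measure]_(x in A) (f x)%:E)%E.

Definition cvg_in_probability (X : nat -> Omega -> \bar R) :=
  forall eps : R, 0 < eps ->
    P [set w | (eps%:E < `|X n w|)%E] @[n --> \oo] --> 0%E.

(* N(0, v), including the degenerate case, for which normal_prob has a junk
   value. *)
Definition centered_normal (v : R) (A : set R) : \bar R :=
  if v == 0 then \d_(0 : R) A else normal_prob 0 (Num.sqrt v) A.

Definition gaussian_vector (k : nat) (Sigma : 'M[R]_k) (W : Omega -> 'rV[R]_k) :=
  (forall i, measurable_fun setT (fun w => W w 0 i)) /\
  forall (u : 'rV[R]_k) (A : set R), measurable A ->
    P [set w | A ((u *m (W w)^T) 0 0)]
      = centered_normal ((u *m Sigma *m u^T) 0 0) A.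

End Probability.

Definition cvg_in_distribution {R : realType}
    {d d' : measure_display} {Omega : measurableType d}
    {Omega' : measurableType d'} (P : probability Omega R)
    (P' : probability Omega' R) (k : nat)
    (Z : nat -> Omega -> 'rV[R]_k) (Q : Omega' -> 'rV[R]_k) :=
  forall g : 'rV[R]_k -> R, continuous g ->
    (exists C : R, forall x, `|g x| <= C) ->
    ('E_P[fun w => g (Z n w)])%E @[n --> \oo] --> ('E_P'[fun w => g (Q w)])%E.

Section Processes.
Context {d : measure_display} {Omega : measurableType d} {R : realType}.
Variables (P : probability Omega R) (T : R) (F : R -> set (set Omega)).
Implicit Types (H M X : R -> Omega -> R) (tau : Omega -> \bar R).

Definition filtration :=
  (forall t, 0 <= t <= T -> sigma_algebra setT (F t) /\ F t `<=` measurable) /\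
  (forall s t, 0 <= s -> s <= t -> t <= T -> F s `<=` F t).

Definition adapted H := forall t, 0 <= t <= T -> measurable_wrt (F t) (H t).

Definition progressive H :=
  forall t, 0 <= t <= T -> forall A : set R, measurable A ->
    <<s [set E | exists (C : set R) (D : set Omega),
           [/\ measurable C, F t D & E = C `*` D]] >>
      [set sw | 0 <= sw.1 <= t /\ A (H sw.1 sw.2)].

Definition continuous_path (h : R -> R) := {within `[0, T], continuous h}.

Definition cadlag_path (h : R -> R) :=
  (forall t, 0 <= t < T -> h x @[x --> t^'+] --> h t) /\
  (forall t, 0 < t <= T -> cvg (h x @[x --> t^'-])).

Definition brownian B :=
  [/\ adapted B,
      {ae P, forall w, B 0 w = 0 /\ continuous_path (B ^~ w)} &
      forall s t, 0 <= s -> s < t -> t <= T ->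
        (forall A : set R, measurable A ->
           P [set w | A (B t w - B s w)] = centered_normal (t - s) A) /\
        independent_sigma P (F s)
          (sigma_of setT (fun _ : unit => fun w => B t w - B s w))].

Definition stopping_time tau :=
  (forall w, (0 <= tau w)%E) /\
  forall t, 0 <= t <= T -> F t [set w | (tau w <= t%:E)%E].

(* On the compact horizon, tau_m increasing to infinity means that almost
   surely tau_m exceeds T for some m. *)
Definition localizing (tau : nat -> Omega -> \bar R) :=
  [/\ forall m, stopping_time (tau m),
      forall m w, (tau m w <= tau m.+1 w)%E &
      {ae P, forall w, exists m, (T%:E < tau m w)%E}].

(* H stopped at tau_m is bounded on the event (0 < tau_m), so that an unbounded
   F_0-measurable initial value is allowed. *)
Definition locally_bounded H :=
  exists tau : nat -> Omega -> \bar R, localizing tau /\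
    forall m, exists K : R, forall t w, 0 <= t <= T ->
      (0 < tau m w)%E -> (t%:E <= tau m w)%E -> `|H t w| <= K.

Definition martingale M :=
  [/\ adapted M,
      forall t, 0 <= t <= T -> P.-integrable setT (EFin \o M t) &
      forall s t, 0 <= s -> s <= t -> t <= T -> forall A, F s A ->
        (\int[P]_(w in A) (M t w)%:E = \int[P]_(w in A) (M s w)%:E)%E].

Definition stopped M tau : R -> Omega -> R :=
  fun t w => M (fine (mine t%:E (tau w))) w.

Definition local_martingale M :=
  [/\ adapted M, {ae P, forall w, cadlag_path (M ^~ w)} &
      exists tau : nat -> Omega -> \bar R, localizing tau /\
        forall m, martingale (fun t w => stopped M (tau m) t w - M 0 w)].

Definition continuous_local_martingale M :=
  local_martingale M /\ {ae P, forall w, continuous_path (M ^~ w)}.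

Definition purely_discontinuous M :=
  [/\ local_martingale M, forall w, M 0 w = 0 &
      forall N, continuous_local_martingale N ->
        local_martingale (fun t w => M t w * N t w)].

Record simple_process := SimpleProcess {
  simple_size : nat ;
  simple_time : nat -> R ;
  simple_coef : nat -> Omega -> R }.

Definition simple_wf (S : simple_process) :=
  [/\ 0 <= simple_time S 0, simple_time S (simple_size S) <= T,
      forall i, (i < simple_size S)%N -> simple_time S i <= simple_time S i.+1 &
      forall i, (i < simple_size S)%N ->
        measurable_wrt (F (simple_time S i)) (simple_coef S i) /\
        exists K : R, forall w, `|simple_coef S i w| <= K].

Definition simple_value (S : simple_process) (s : R) (w : Omega) : R :=
  \sum_(i < simple_size S)
    simple_coef S i w * \1_(`]simple_time S i, simple_time S i.+1]) s.

Definition simple_integral (S : simple_process) B (t : R) (w : Omega) : R :=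
  \sum_(i < simple_size S) simple_coef S i w *
    (B (Num.min t (simple_time S i.+1)) w - B (Num.min t (simple_time S i)) w).

(* I is (a version of) the stochastic integral process of H against B. *)
Definition ito_integral H B (I : R -> Omega -> R) :=
  [/\ adapted I, {ae P, forall w, continuous_path (I ^~ w)} &
      exists S : nat -> simple_process,
      [/\ forall m, simple_wf (S m),
          cvg_in_probability P (fun m w =>
            \int[lebesgue_measure]_(s in `[0%R, T])
               ((simple_value (S m) s w - H s w) ^+ 2)%:E)%E &
          forall t, 0 <= t <= T ->
            cvg_in_probability P (fun m w =>
              (simple_integral (S m) B t w - I t w)%:E)]].

(* dX = mu dt + sigma dB *)
Definition ito_process mu sigma B X :=
  adapted X /\ exists I, ito_integral sigma B I /\
    {ae P, forall w, forall t, 0 <= t <= T ->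
       X t w = X 0 w + \int[lebesgue_measure]_(s in `[0, t]) mu s w + I t w}.

Definition predictable_sets : set (set (R * Omega)) :=
  <<s `[0, T] `*` setT,
     [set [set 0] `*` A | A in F 0] `|`
     [set E | exists s t A, [/\ 0 <= s, s < t, t <= T, F s A
                             & E = `]s, t] `*` A]] >>.

Definition predictable d' (U : measurableType d') (H : R -> Omega -> U) :=
  forall A : set U, measurable A ->
    predictable_sets ((`[0, T] `*` setT) `&` [set sw | A (H sw.1 sw.2)]).

(* W is measurable for the product of the predictable sigma-algebra and the
   Borel sigma-algebra. *)
Definition predictable_field (W : R -> Omega -> R -> \bar R) :=
  forall A : set (\bar R), measurable A ->
    <<s (`[0, T] `*` setT) `*` setT,
       [set E | exists (C : set (R * Omega)) (D : set R),
          [/\ predictable_sets C, measurable D & E = C `*` D]] >>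
    (((`[0, T] `*` setT) `*` setT) `&`
      [set swx | A (W swx.1.1 swx.1.2 swx.2)]).

Definition jump X (s : R) (w : Omega) : R := X s w - lim (X x w @[x --> s^'-]).

Definition jump_times X (w : Omega) : set R :=
  [set s | 0 < s <= T /\ jump X s w != 0].

(* finitely many terms, as the paths of X are cadlag *)
Definition big_jumps X (t : R) (w : Omega) : R :=
  \sum_(s \in `]0, t]) (if 1 < `|jump X s w| then jump X s w else 0).

(* A semimartingale whose characteristics (B, C, nu), for the truncation
   function x 1(|x| <= 1), are absolutely continuous in time:
     B = \int b dt,  C = \int c dt,  nu(dt, dx) = K_t(dx) dt.
   Here X - X_0 - big_jumps X - B is the local martingale part of the special
   semimartingale obtained by removing the big jumps, C is the quadratic
   variation of its continuous part Mc, and nu is the compensator of the jump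
   measure of X. *)
Definition ito_semimartingale X :=
  [/\ adapted X, forall w, cadlag_path (X ^~ w) &
  exists (b c : R -> Omega -> R)
         (K : R -> Omega -> {measure set R -> \bar R})
         (Mc Md : R -> Omega -> R),
  [/\ [/\ predictable b, predictable c,
          forall A : set R, measurable A -> predictable (fun s w => K s w A),
          forall s w, 0 <= s <= T -> 0 <= c s w &
          forall s w, 0 <= s <= T ->
            (\int[K s w]_x (Num.min (x ^+ 2) 1)%:E < +oo)%E],
      {ae P, forall w,
         (\int[lebesgue_measure]_(s in `[0%R, T]) `|b s w|%:E < +oo)%E /\
         (\int[lebesgue_measure]_(s in `[0%R, T]) (c s w)%:E < +oo)%E},
      [/\ continuous_local_martingale Mc, forall w, Mc 0 w = 0,
          purely_discontinuous Md &
          {ae P, forall w, forall t, 0 <= t <= T ->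
             X t w = X 0 w + big_jumps X t w
                     + \int[lebesgue_measure]_(s in `[0, t]) b s w
                     + Mc t w + Md t w}],
      local_martingale (fun t w =>
        Mc t w ^+ 2 - \int[lebesgue_measure]_(s in `[0, t]) c s w) &
      forall W, predictable_field W -> (forall s w x, (0 <= W s w x)%E) ->
        (\int[P]_w (\esum_(s in jump_times X w) W s w (jump X s w))%R
         = \int[P]_w \int[lebesgue_measure]_(s in `[0%R, T])
             \int[K s w]_x W s w x)%E]].

End Processes.

Section StrongRecursion.
Context {R : realType}.

(* strong_rec step l = step l (strong_rec step), where step l only looks at
   arguments smaller than l *)
Fixpoint strong_rec_fuel (step : nat -> (nat -> R) -> R) (fuel l : nat) : R :=
  if fuel is f.+1 then step l (strong_rec_fuel step f) else 0.

Definition strong_rec (step : nat -> (nat -> R) -> R) (l : nat) : R :=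
  strong_rec_fuel step l.+1 l.

Lemma strong_recE (step : nat -> (nat -> R) -> R) :
  (forall l u v, (forall j, (j < l)%N -> u j = v j) -> step l u = step l v) ->
  forall l, strong_rec step l = step l (strong_rec step).
Proof.
move=> stepP.
have fuelE : forall f g l, (l < f)%N -> (l < g)%N ->
    strong_rec_fuel step f l = strong_rec_fuel step g l.
  elim=> [//|f IHf] [//|g] l lf lg /=; apply: stepP => j jl.
  by apply: IHf; exact: leq_trans jl _.
by move=> l; apply: stepP => j jl; exact: fuelE.
Qed.

End StrongRecursion.

Section Estimators.
Context {R : realType}.

Definition asymp (a b : nat -> R) :=
  exists c1 c2 : R, [/\ 0 < c1, 0 < c2 &
    forall n, (0 < n)%N -> c1 <= a n / b n <= c2].

Definition moment (f : R -> R) (q : nat) : R :=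
  \int[lebesgue_measure]_x (x ^+ q * f x).

(* q-th moment of the difference of two independent variables with density f *)
Definition diff_moment (f : R -> R) (q : nat) : R :=
  fine (\int[lebesgue_measure \x lebesgue_measure]_z
          ((z.1 - z.2) ^+ q * (f z.1 * f z.2))%:E)%E.

Definition charfun (f : R -> R) (s : R) : R[i] :=
  Complex (\int[lebesgue_measure]_x (cos (s * x) * f x))
          (\int[lebesgue_measure]_x (sin (s * x) * f x)).

Definition step_size (t : nat -> R) (j : nat) : R := t j - t j.-1.

Definition max_step (n : nat) (t : nat -> R) : R :=
  \big[Num.max/step_size t n]_(1 <= j < n.+1) step_size t j.

Definition min_step (n : nat) (t : nat -> R) : R :=
  \big[Num.min/step_size t n]_(1 <= j < n.+1) step_size t j.

Definition nbr (n : nat) (t : nat -> R) (xi : R) (j : 'I_n.+1) :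
    {set 'I_n.+1} :=
  [set l : 'I_n.+1 | (l != j) && (`|t l - t j| <= xi)]%SET.

Definition nbr_total (n : nat) (t : nat -> R) (xi : R) : nat :=
  (\sum_(j < n.+1) #|nbr t xi j|)%N.

(* extrema over 1 <= j <= n *)
Definition nbr_max (n : nat) (t : nat -> R) (xi : R) : nat :=
  (\max_(j < n.+1 | (0 < j)%N) #|nbr t xi j|)%N.

Definition nbr_min (n : nat) (t : nat -> R) (xi : R) : nat :=
  (\big[minn/#|nbr t xi (@ord_max n)|]_(j < n.+1 | (0 < j)%N) #|nbr t xi j|)%N.

Definition nbr_sum (n : nat) (t : nat -> R) (xi : R)
    (h : R -> R) (y : nat -> R) : R :=
  \sum_(j < n.+1) \sum_(l in nbr t xi j) h (y l - y j).

(* In moment estimators and in the limit, index l stands for the moment of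
   order 2l. *)
Definition diff_moment_hat (n : nat) (t : nat -> R) (xi : R) (y : nat -> R)
    (l : nat) : R :=
  (nbr_total n t xi)%:R^-1 * nbr_sum n t xi (fun x => x ^+ (2 * l)) y.

Definition moment_hat (n : nat) (t : nat -> R) (xi : R) (y : nat -> R) :
    nat -> R :=
  strong_rec (fun l M =>
    2^-1 * (diff_moment_hat n t xi y l
            - \sum_(1 <= j < l) 'C(2 * l, 2 * j)%:R * M j * M (l - j)%N)).

Lemma moment_hatE n t xi y l : moment_hat n t xi y l =
  2^-1 * (diff_moment_hat n t xi y l
          - \sum_(1 <= j < l) 'C(2 * l, 2 * j)%:R * moment_hat n t xi y j
              * moment_hat n t xi y (l - j)%N).
Proof.
rewrite {1}/moment_hat strong_recE// => {}l u v uv; congr (_ * (_ - _)).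
apply: eq_big_nat => j /andP[j1 jl]; rewrite !uv//.
by rewrite ltn_subrL j1/=; exact: leq_ltn_trans jl.
Qed.

Definition limit_vector (a W m : nat -> R) : nat -> R :=
  strong_rec (fun l Q =>
    a l * W l
    - \sum_(1 <= j < l) 'C(2 * l, 2 * j)%:R * m (2 * l - 2 * j)%N * Q j).

Lemma limit_vectorE a W m l : limit_vector a W m l =
  a l * W l
  - \sum_(1 <= j < l) 'C(2 * l, 2 * j)%:R * m (2 * l - 2 * j)%N
      * limit_vector a W m j.
Proof.
rewrite {1}/limit_vector strong_recE// => {}l u v uv; congr (_ - _).
by apply: eq_big_nat => j /andP[_ jl]; rewrite uv.
Qed.

End Estimators.

Section LimitQuantities.
Context {d : measure_display} {Omega : measurableType d} {R : realType}.
Variables (P : probability Omega R) (f : R -> R)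
  (t : nat -> nat -> R) (xi : nat -> R) (U : nat -> nat -> Omega -> R).

Definition centered_sum (n l : nat) (w : Omega) : R :=
  nbr_sum n (t n) (xi n) (fun x => x ^+ (2 * l) - diff_moment f (2 * l))
    (fun j => U n j w).

Definition Vnum (n l : nat) : R :=
  fine ('V_P[fun w => ((Num.sqrt (nbr_total n (t n) (xi n))%:R)^-1
                       * centered_sum n l w)%R])%E.

Definition a_seq (l n : nat) : R :=
  Num.sqrt (n%:R * Vnum n l / (nbr_total n (t n) (xi n))%:R).

Definition a_lim (l : nat) : R := 2^-1 * lim (a_seq l n @[n --> \oo]).

Definition standardized_sum (n l : nat) (w : Omega) : R :=
  centered_sum n l w / Num.sqrt ((nbr_total n (t n) (xi n))%:R * Vnum n l).

Definition e_seq (l1 l2 n : nat) : R :=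
  fine ('E_P[fun w => (standardized_sum n l1 w * standardized_sum n l2 w)%R])%E.

Definition e_lim (l1 l2 : nat) : R := lim (e_seq l1 l2 n @[n --> \oo]).

Definition Sigma_mat (k : nat) : 'M[R]_k := \matrix_(i, j) e_lim i.+1 j.+1.

End LimitQuantities.

(* Main.v *)
Require Import Defs.
From mathcomp Require Import ring lra zify.

(* The statistic is a quadratic form over the pairs of grid points which are at most
   xi apart. Its signal part is negligible: by the Ito isometry on truncated simple
   processes the sum of the squared increments of X over close pairs is of order
   N xi, which takes care of the second-order term of the expansion of
   (u + x)^(2l), while the linear term has conditional mean zero because the odd
   moments of the errors vanish and the errors are independent of X.

   What is left is a sum of functions of pairs of independent errors. After
   truncation of the kernel, its dependency graph has degree O(n xi), and
   E cos(s S + theta) satisfies y' = - s v y up to an error of order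
   (number of pairs) * degree^2 * (size of a term)^3, which tends to zero. The
   convergence of E cos(u . Z_n + theta) for all u and theta, together with tightness,
   gives convergence in distribution, as continuous bounded functions are approximated
   on cubes by trigonometric polynomials with the same global bound.

   Finally, the recursion for the estimators is linearized: the products of two
   deviations are of order 1/n. *)

Set Implicit Arguments.
Unset Strict Implicit.
Unset Printing Implicit Defensive.

(** * Expectation, independence and measurability *)

(** The coefficients [mu] and [sigma] are only locally bounded and the stochastic integral is only a
    limit in probability, so the increments of [X] need not have moments. Every estimate of the
    signal holds off an event of small probability, and the increments are switched off there before
    an expectation is taken, by a rule that depends on [X] alone and so keeps them independent of
    the errors.

    Write [kappa] for the largest neighbourhood and [N] for the number of ordered close pairs. Then
    [kappa * n <= C * N] and [kappa <= C * n * xi]. The squared increments of the martingale part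
    sum to order [kappa ^ 2], hence at most to order [N * xi]; the factor [sqrt n / N] in front
    leaves [sqrt n * xi], which tends to zero. For the errors a term has size [sqrt n / N], and the
    error of the Gaussian approximation is of order [(kappa * n / N) ^ 2 / sqrt n].

    The condition [p > 2] provides moments of order [4 k] of the errors, the order at which the
    kernels of degree [2 k] become square integrable. No third moment of a kernel is at hand, which
    is why the kernel is truncated at a fixed level before [n] grows. *)

Section RealExpectation.
Context {d : measure_display} {T : measurableType d} {R : realType}.
Variable P : probability T R.
Implicit Types X Y Z : T -> R.

Lemma measurable_sum_cond (I : Type) (r : seq I) (Q : pred I) (X : I -> T -> R) :
  (forall i, Q i -> measurable_fun setT (X i)) ->
  measurable_fun setT (fun w => \sum_(i <- r | Q i) X i w).
Proof.
move=> mX; elim: r => [|i r IHr].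
  by under eq_fun do rewrite big_nil; exact: measurable_cst.
under eq_fun do rewrite big_cons.
by case: (boolP (Q i)) => // Qi; apply: measurable_funD => //; exact: mX.
Qed.

(** The real integral is the finite part of an extended one and carries no information for a
    non-integrable function; [L1] is the side condition under which it is linear and monotone. *)
Definition L1 X := P.-integrable setT (EFin \o X).

Lemma L1_measurable X : L1 X -> measurable_fun setT X.
Proof. by move=> /integrableP[/measurable_EFinP]. Qed.

Lemma L1_cst (c : R) : L1 (fun=> c).
Proof. exact: finite_measure_integrable_cst. Qed.

Lemma L1D X Y : L1 X -> L1 Y -> L1 (fun w => X w + Y w).
Proof. by move=> iX iY; exact: (integrableD measurableT iX iY). Qed.

Lemma L1Zl c X : L1 X -> L1 (fun w => c * X w).
Proof. by move=> iX; exact: (integrableZl measurableT c iX). Qed.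

Lemma L1N X : L1 X -> L1 (fun w => - X w).
Proof.
move=> /(L1Zl (-1)); apply: eq_integrable => // w _ /=.
by rewrite mulN1r.
Qed.

Lemma L1B X Y : L1 X -> L1 Y -> L1 (fun w => X w - Y w).
Proof. by move=> iX /L1N; exact: L1D. Qed.

Lemma L1_sum (I : Type) (s : seq I) (Q : pred I) (X : I -> T -> R) :
  (forall i, Q i -> L1 (X i)) -> L1 (fun w => \sum_(i <- s | Q i) X i w).
Proof.
move=> iX; have := integrable_sum measurableT s iX.
apply: eq_integrable => // w _; rewrite /= -sumEFin //.
Qed.

Lemma L1_le X Y : measurable_fun setT X -> L1 Y ->
  (forall w, `|X w| <= Y w) -> L1 X.
Proof.
move=> mX iY XY; apply: (le_integrable measurableT _ _ iY).
  exact/measurable_EFinP.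
by move=> w _ /=; rewrite lee_fin (le_trans (XY w))// ler_norm.
Qed.

Lemma L1_bounded X (c : R) : measurable_fun setT X ->
  (forall w, `|X w| <= c) -> L1 X.
Proof. by move=> mX; apply: L1_le => //; exact: L1_cst. Qed.

Lemma L1_norm X : L1 X -> L1 (fun w => `|X w|).
Proof. by move=> iX; exact: (integrable_abse iX). Qed.

Lemma L1M_bounded X Y (c : R) : measurable_fun setT X ->
  (forall w, `|X w| <= c) -> L1 Y -> L1 (fun w => X w * Y w).
Proof.
move=> mX Xc iY; have iY' := L1Zl c (L1_norm iY).
apply: L1_le iY' _; first exact: measurable_funM mX (L1_measurable iY).
by move=> w; rewrite normrM ler_wpM2r.
Qed.

Lemma ExD X Y : L1 X -> L1 Y ->
  \int[P]_w (X w + Y w) = \int[P]_w X w + \int[P]_w Y w.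
Proof. exact: RintegralD. Qed.

Lemma ExB X Y : L1 X -> L1 Y ->
  \int[P]_w (X w - Y w) = \int[P]_w X w - \int[P]_w Y w.
Proof. exact: RintegralB. Qed.

Lemma ExZl c X : L1 X -> \int[P]_w (c * X w) = c * \int[P]_w X w.
Proof. exact: RintegralZl. Qed.

Lemma Ex_cst c : \int[P]_w c = c.
Proof. by rewrite Rintegral_cst// [X in fine X]probability_setT mulr1. Qed.

Lemma Ex_sum (I : Type) (s : seq I) (Q : pred I) (X : I -> T -> R) :
  (forall i, Q i -> L1 (X i)) ->
  \int[P]_w (\sum_(i <- s | Q i) X i w) = \sum_(i <- s | Q i) \int[P]_w X i w.
Proof.
move=> iX; elim: s => [|i s IHs].
  by under eq_Rintegral do rewrite big_nil; rewrite Ex_cst big_nil.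
rewrite big_cons; under eq_Rintegral do rewrite big_cons.
case: ifP => // Qi; rewrite ExD ?IHs//; [exact: iX|exact: L1_sum].
Qed.

Lemma Ex_le X Y : L1 X -> L1 Y -> (forall w, X w <= Y w) ->
  \int[P]_w X w <= \int[P]_w Y w.
Proof. by move=> iX iY XY; exact: le_Rintegral. Qed.

Lemma Ex_ge0 X : (forall w, 0 <= X w) -> 0 <= \int[P]_w X w.
Proof. by move=> X0; exact: Rintegral_ge0. Qed.

Lemma Ex_norm X : L1 X -> `|\int[P]_w X w| <= \int[P]_w `|X w|.
Proof. exact: le_normr_Rintegral. Qed.

Lemma Ex_norm_le X Y : L1 X -> L1 Y -> (forall w, `|X w| <= Y w) ->
  `|\int[P]_w X w| <= \int[P]_w Y w.
Proof.
move=> iX iY XY; apply: (le_trans (Ex_norm iX)).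
by apply: Ex_le => //; exact: L1_norm.
Qed.

Lemma Ex_norm_bound X (c : R) : L1 X -> (forall w, `|X w| <= c) ->
  `|\int[P]_w X w| <= c.
Proof. by move=> iX Xc; rewrite -[leRHS]Ex_cst Ex_norm_le//; exact: L1_cst. Qed.

Lemma Ex_EFin X : L1 X -> (\int[P]_w (X w)%:E)%E = (\int[P]_w X w)%:E.
Proof. by move=> iX; rewrite /Rintegral fineK//; exact: integrable_fin_num. Qed.

(** Measurability is a separate component, since integrability of the square does not imply it. *)
Definition L2 X := measurable_fun setT X /\ L1 (fun w => X w ^+ 2).

Lemma L2_bounded X (c : R) : measurable_fun setT X ->
  (forall w, `|X w| <= c) -> L2 X.
Proof.
move=> mX Xc; split => //; apply: (@L1_bounded _ (c ^+ 2)).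
  exact: measurable_funX.
by move=> w; rewrite normrX lerXn2r ?nnegrE// (le_trans _ (Xc w)).
Qed.

Lemma normM_le_half (x y : R) : `|x * y| <= 2^-1 * (x ^+ 2 + y ^+ 2).
Proof.
rewrite normrM -(real_normK (num_real x)) -(real_normK (num_real y)).
by have := sqr_ge0 (`|x| - `|y|); lra.
Qed.

Lemma L2M X Y : L2 X -> L2 Y -> L1 (fun w => X w * Y w).
Proof.
move=> [mX iX] [mY iY]; apply: (L1_le _ (L1Zl 2^-1 (L1D iX iY))).
  exact: measurable_funM.
by move=> w; exact: normM_le_half.
Qed.

Lemma L2_cst c : L2 (fun=> c).
Proof. by split; [exact: measurable_cst|exact: L1_cst]. Qed.

Lemma L2_L1 X : L2 X -> L1 X.
Proof.
move=> iX; have := L2M iX (L2_cst 1).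
by congr L1; apply/funext => w; rewrite mulr1.
Qed.

Lemma L2Zl c X : L2 X -> L2 (fun w => c * X w).
Proof.
move=> [mX iX]; split; first exact: measurable_funM.
rewrite (_ : (fun w => _) = fun w => c ^+ 2 * X w ^+ 2); first exact: L1Zl.
by apply/funext => w; rewrite exprMn.
Qed.

Lemma L2D X Y : L2 X -> L2 Y -> L2 (fun w => X w + Y w).
Proof.
move=> LX LY; have iXY := L2M LX LY; case: LX LY => [mX iX] [mY iY].
split; first exact: measurable_funD.
rewrite (_ : (fun w => _) = fun w => (X w ^+ 2 + Y w ^+ 2) + 2 * (X w * Y w)).
  by apply: L1D; [exact: L1D|exact: L1Zl].
by apply/funext => w; ring.
Qed.

Lemma L2N X : L2 X -> L2 (fun w => - X w).
Proof.
by move=> /(L2Zl (-1)); congr L2; apply/funext => w; rewrite mulN1r.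
Qed.

Lemma L2B X Y : L2 X -> L2 Y -> L2 (fun w => X w - Y w).
Proof. by move=> LX /L2N; exact: L2D. Qed.

Lemma L2_sum (I : Type) (s : seq I) (Q : pred I) (X : I -> T -> R) :
  (forall i, Q i -> L2 (X i)) -> L2 (fun w => \sum_(i <- s | Q i) X i w).
Proof.
move=> LX; elim: s => [|i s IHs].
  by under eq_fun do rewrite big_nil; exact: L2_cst.
under eq_fun do rewrite big_cons.
by case: (boolP (Q i)) => // Qi; apply: L2D => //; exact: LX.
Qed.

Lemma L2_le X Y : measurable_fun setT X -> L2 Y -> (forall w, `|X w| <= `|Y w|) -> L2 X.
Proof.
move=> mX [mY iY] XY; split => //; apply: (L1_le _ iY).
  exact: measurable_funX.
move=> w; rewrite -(real_normK (num_real (Y w))) normrX lerXn2r ?nnegrE//.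
Qed.

Lemma L2M_bounded X Y (c : R) : measurable_fun setT X ->
  (forall w, `|X w| <= c) -> L2 Y -> L2 (fun w => X w * Y w).
Proof.
move=> mX Xc LY; apply: (@L2_le _ (fun w => c * Y w)).
- by apply: measurable_funM => //; case: LY.
- exact: L2Zl.
- move=> w; rewrite !normrM ler_wpM2r// (le_trans (Xc w))// ler_norm//.
Qed.

Lemma Ex_normM_le X Y : L2 X -> L2 Y ->
  `|\int[P]_w (X w * Y w)| <=
  2^-1 * (\int[P]_w (X w ^+ 2) + \int[P]_w (Y w ^+ 2)).
Proof.
move=> LX LY; have [[mX iX] [mY iY]] := (LX, LY).
rewrite -ExD// -ExZl; last exact: L1D.
apply: Ex_norm_le; [exact: L2M|by apply: L1Zl; exact: L1D|].
by move=> w; exact: normM_le_half.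
Qed.

(** The variance of [|X|] is nonnegative. This passes from a small second moment to a small mean
    distance. *)
Lemma Ex_norm_sqrt X : L2 X ->
  \int[P]_w `|X w| <= Num.sqrt (\int[P]_w (X w ^+ 2)).
Proof.
move=> LX; have iX := L1_norm (L2_L1 LX); have [mX i2] := LX.
set a := \int[P]_w `|X w|.
have a0 : 0 <= a by apply: Ex_ge0.
rewrite -(@ger0_norm _ a)// -sqrtr_sqr ler_wsqrtr//.
have : 0 <= \int[P]_w ((`|X w| - a) ^+ 2) by apply: Ex_ge0 => w; exact: sqr_ge0.
rewrite (_ : \int[P]_w _ = \int[P]_w (X w ^+ 2) - a ^+ 2); first by rewrite subr_ge0.
transitivity (\int[P]_w ((X w ^+ 2 + a ^+ 2) - 2 * a * `|X w|)).
  apply: eq_Rintegral => w _.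
  by rewrite -(real_normK (num_real (X w))); ring.
rewrite ExB; [|by apply: L1D => //; exact: L1_cst|exact: L1Zl].
rewrite ExD//; last exact: L1_cst.
by rewrite Ex_cst ExZl// -/a; ring.
Qed.

Lemma markov_ge X (a : R) : 0 < a -> L1 X -> (forall w, 0 <= X w) ->
  (P [set w | (a <= X w)%R] <= (\int[P]_w X w / a)%:E)%E.
Proof.
move=> a0 iX X0; have mA : measurable [set w | a <= X w].
  rewrite -[X in measurable X]setTI.
  by apply: measurable_fun_ler => //; exact: L1_measurable.
have -> : P [set w | a <= X w] = (\int[P]_w (\1_[set w | a <= X w] w))%:E.
  rewrite -Ex_EFin; first by rewrite integral_indic// setIT.
  exact: integrable_indic.
rewrite lee_fin ler_pdivlMr// mulrC -ExZl; last exact: integrable_indic.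
apply: Ex_le => //; first by apply: L1Zl; exact: integrable_indic.
move=> w; rewrite indicE; case: (boolP (w \in _)) => [|_]; rewrite ?mulr0//.
by rewrite inE /= mulr1.
Qed.

End RealExpectation.

Section Independence.
Context {d : measure_display} {T : measurableType d} {R : realType}.
Variable P : probability T R.
Implicit Types (G H : set (set T)) (X Y Z : T -> R).

(** Independence makes the two measures agree on rectangles, and rectangles determine a product
    measure. *)
Lemma independent_distribution G H Y Z
    (mY : measurable_fun setT Y) (mZ : measurable_fun setT Z) :
  independent_sigma P G H -> measurable_wrt G Y -> measurable_wrt H Z ->
  forall A : set (R * R), measurable A ->
  (pushforward P Y \x pushforward P Z)%E A =
  P ((fun w => (Y w, Z w)) @^-1` A).
Proof.
move=> GH GY HZ.
pose f : {mfun T >-> R} := mfun_Sub (mem_set mY).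
pose g : {mfun T >-> R} := mfun_Sub (mem_set mZ).
have mfg : measurable_fun setT (fun w => (Y w, Z w)) by exact: measurable_fun_pair.
pose fg : {mfun T >-> (R * R)%type} := mfun_Sub (mem_set mfg).
apply: (@product_measure_unique _ _ _ _ _ (distribution P f) (distribution P g)
  (distribution P fg)) => A B mA mB.
exact: (GH _ _ (GY _ mA) (HZ _ mB)).
Qed.


(** Transport to the plane, where the joint law is the product of the two laws: Tonelli gives the
    integrability of the product, then Fubini its value. *)
Lemma Ex_indep G H Y Z : independent_sigma P G H ->
  measurable_wrt G Y -> measurable_wrt H Z -> L1 P Y -> L1 P Z ->
  L1 P (fun w => Y w * Z w) /\
  \int[P]_w (Y w * Z w) = \int[P]_w Y w * \int[P]_w Z w.
Proof.
move=> GH GY HZ iY iZ.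
have mY := L1_measurable iY; have mZ := L1_measurable iZ.
pose f : {mfun T >-> R} := mfun_Sub (mem_set mY).
pose g : {mfun T >-> R} := mfun_Sub (mem_set mZ).
have mfg : measurable_fun setT (fun w => (Y w, Z w)) by exact: measurable_fun_pair.
pose fg : {mfun T >-> (R * R)%type} := mfun_Sub (mem_set mfg).
pose mu := distribution P f; pose nu := distribution P g.
have mM : measurable_fun [set: R * R] (fun z : R * R => (z.1 * z.2)%:E).
  by apply/measurable_EFinP; apply: measurable_funM.
have iR (X : T -> R) (mX : measurable_fun setT X) :
    L1 P X -> (distribution P (mfun_Sub (mem_set mX))).-integrable setT
      (fun x : R => x%:E).
  by move=> iX; apply: integrable_pushforward => //; exact: EFin_measurable.
have imu := iR _ mY iY; have inu := iR _ mZ iZ.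
have prodE (phi : R * R -> \bar R) :
    (\int[distribution P fg]_z phi z = \int[mu \x nu]_z phi z)%E.
  apply: eq_measure_integral => A mA _.
  by apply/esym; exact: (independent_distribution mY mZ GH GY HZ mA).
have iM : (mu \x nu)%E.-integrable setT (fun z : R * R => (z.1 * z.2)%:E).
  apply/integrable12ltyP => //.
  under eq_integral => x _.
    rewrite (_ : (fun y => _) = fun y => (`|x|%:E * `|y%:E|)%E); last first.
      by apply/funext => y /=; rewrite normrM EFinM.
    rewrite ge0_integralZl//; last exact: measurableT_comp.
    over.
  rewrite ge0_integralZr//; last 2 first.
  - by apply: measurableT_comp => //; exact: measurableT_comp.
  - exact: integral_ge0.
  have /integrableP[_ h1] := imu; have /integrableP[_ h2] := inu.
  rewrite lte_mul_pinfty//; first exact: integral_ge0.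
  by rewrite ge0_fin_numE//; exact: integral_ge0.
have iYZ : L1 P (fun w => Y w * Z w).
  apply/integrableP; split; first by apply/measurable_EFinP; exact: measurable_funM.
  have /integrableP[_] := iM; rewrite -prodE ge0_integral_pushforward//.
  exact: measurableT_comp.
split => //; apply: EFin_inj; rewrite EFinM -!Ex_EFin//.
transitivity (\int[mu \x nu]_z (z.1 * z.2)%:E)%E.
  by rewrite -prodE integral_pushforward.
rewrite -integral12_prod_meas1//.
transitivity (\int[mu]_x (x%:E * \int[nu]_y y%:E))%E.
  apply: eq_integral => x _.
  by rewrite /fubini_F; under eq_integral do rewrite EFinM; rewrite integralZl.
have hY : (\int[mu]_x x%:E = \int[P]_w (Y w)%:E)%E by rewrite integral_pushforward.
have hZ : (\int[nu]_x x%:E = \int[P]_w (Z w)%:E)%E by rewrite integral_pushforward.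
have Zfin := integrable_fin_num measurableT inu.
by rewrite -hY -hZ -[in LHS](fineK Zfin) integralZr// fineK.
Qed.

(* The two families only need to be stable by intersection: Dynkin's lemma is
   applied to each factor in turn. *)
Lemma independent_generated G H :
  G `<=` measurable -> H `<=` measurable -> setI_closed G -> setI_closed H ->
  independent_sigma P G H -> independent_sigma P <<s G >> <<s H >>.
Proof.
move=> Gm Hm GI HI GH.
have main (K L : set (set T)) : K `<=` measurable -> L `<=` measurable ->
    setI_closed L -> independent_sigma P K L -> independent_sigma P K <<s L >>.
  move=> Km Lm LI KL A B KA.
  have mA : measurable A by exact: Km.
  pose C := [set B | measurable B /\ P (A `&` B) = (P A * P B)%E].
  suff : <<d L >> `<=` C.
    by rewrite setI_closed_g_dynkin_g_sigma_algebra// => /[apply] -[].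
  apply: smallest_sub => [|D LD]; last first.
    by split; [exact: Lm|exact: KL].
  split.
  - by split; [exact: measurableT|rewrite setIT probability_setT mule1].
  - move=> D [mD AD]; split; first exact: measurableC.
    have finP E : measurable E -> P E \is a fin_num by exact: fin_num_measure.
    rewrite -setDE measureD//; last by rewrite -ge0_fin_numE// finP.
    transitivity (P A - P A * P D)%E; first by congr (_ - _)%E.
    rewrite probability_setC// muleBr ?mule1//.
    exact: finP.
  - move=> F tF CF; split.
      by apply: bigcup_measurable => n _; have [] := CF n.
    rewrite setI_bigcupr.
    have mF n : measurable (F n) by have [] := CF n.
    have tAF : trivIset setT (fun n => A `&` F n) by exact: trivIset_setIl.
    rewrite measure_bigcup//; last by move=> n _; exact: measurableI.
    rewrite measure_bigcup//.
    have finA : P A \is a fin_num by exact: fin_num_measure.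
    rewrite -(fineK finA) -nneseriesZl//; apply: eq_eseriesr => n _.
    by rewrite fineK//; have [] := CF n.
have sub K : K `<=` measurable -> <<s K >> `<=` (measurable : set (set T)).
  by move=> Km; apply: smallest_sub => //; exact: sigma_algebra_measurable.
have GsH : independent_sigma P G <<s H >> by exact: main.
move=> A B GA HB; rewrite setIC muleC.
apply: (main <<s H >> G) => //; first exact: sub.
by move=> D E HD GE; rewrite setIC muleC; exact: GsH.
Qed.

Lemma independent_sigma_sub G H G' H' : G' `<=` G -> H' `<=` H ->
  independent_sigma P G H -> independent_sigma P G' H'.
Proof. by move=> GG' HH' GH A B /GG' GA /HH'; exact: GH. Qed.

Section DisjointBlocks.
Variables (m : nat) (X : 'I_m -> T -> R).
Hypothesis mX : forall i, measurable_fun setT (X i).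

(** Boxes that constrain only the coordinates in [D]. They are stable by intersection, generate at
    least [sigma_of D X], and are the sets to which [independent_variables] applies directly. *)
Let cylinder (D : set 'I_m) : set (set T) :=
  [set E | exists C : 'I_m -> set R, [/\ forall i, measurable (C i),
     forall i, ~ D i -> C i = setT & E = \bigcap_i (X i @^-1` C i)]].

Let mcyl (C : 'I_m -> set R) : (forall i, measurable (C i)) ->
  measurable (\bigcap_i (X i @^-1` C i)).
Proof.
move=> mC; apply: fin_bigcap_measurable => [|i _]; first exact: finite_finset.
by rewrite -[X in measurable X]setTI; exact: mX.
Qed.

Let sigma_of_cylinder D : sigma_of D X `<=` <<s cylinder D >>.
Proof.
apply: smallest_sub; first exact: smallest_sigma_algebra.
move=> _ [i [A [Di mA ->]]]; apply: sub_sigma_algebra.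
exists (fun j => if j == i then A else setT); split.
- by move=> j; case: eqP.
- by move=> j; case: eqP => // -> /(_ Di).
- apply/seteqP; split => [w XA j _|w /(_ i Logic.I)] /=; last by rewrite eqxx.
  by case: eqP => [->|].
Qed.

(** For two cylinders the product over all indices splits factor by factor, because each index is
    constrained on at most one side; Dynkin's lemma does the rest. *)
Lemma independent_disjoint (D E : set 'I_m) : independent_variables P X ->
  (forall i, D i -> ~ E i) -> independent_sigma P (sigma_of D X) (sigma_of E X).
Proof.
move=> indX DE; apply: (independent_sigma_sub
  (@sigma_of_cylinder D) (@sigma_of_cylinder E)).
have cylI F : setI_closed (cylinder F).
  move=> _ _ [C1 [m1 F1 ->]] [C2 [m2 F2 ->]].
  exists (fun i => C1 i `&` C2 i); split.
  - by move=> i; exact: measurableI.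
  - by move=> i Fi; rewrite F1// F2// setIT.
  - by rewrite -bigcapI; apply: eq_bigcapr => i _; rewrite preimage_setI.
have cylm F : cylinder F `<=` measurable.
  by move=> _ [C [mC _ ->]]; exact: mcyl.
apply: independent_generated => // _ _ [C1 [m1 F1 ->]] [C2 [m2 F2 ->]].
have -> : \bigcap_i (X i @^-1` C1 i) `&` \bigcap_i (X i @^-1` C2 i) =
    \bigcap_i (X i @^-1` (C1 i `&` C2 i)).
  by rewrite -bigcapI; apply: eq_bigcapr => i _; rewrite preimage_setI.
rewrite !indX//; last by move=> i; exact: measurableI.
rewrite -big_split/=; apply: eq_bigr => i _.
have [Di|nDi] := pselect (D i).
  by rewrite (F2 i) ?setIT ?preimage_setT ?probability_setT ?mule1//; exact: DE.
by rewrite (F1 i)// setTI preimage_setT probability_setT mul1e.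
Qed.

End DisjointBlocks.

End Independence.

Section MeasurableWrt.
Context {d : measure_display} {T : measurableType d} {R : realType}.
Implicit Types (G : set (set T)) (f g : T -> R).

(** Measurability for a sub-sigma-algebra becomes ordinary measurability from another measurable
    type, so that the usual closure lemmas transfer. *)
Lemma measurable_wrtP G f : sigma_algebra setT G ->
  measurable_wrt G f <-> measurable_fun setT (f : g_sigma_algebraType G -> R).
Proof.
move=> sG; split => [Gf _ A mA|mf A mA].
  by rewrite setTI; apply: sub_sigma_algebra; exact: Gf.
have := mf measurableT A mA; rewrite setTI.
by rewrite /measurable/= sigma_algebra_id.
Qed.

Lemma sigma_of_sigma_algebra (I : Type) (D : set I) (X : I -> T -> R) :
  sigma_algebra setT (sigma_of D X).
Proof. exact: smallest_sigma_algebra. Qed.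

Lemma sigma_of_measurable (I : Type) (D : set I) (X : I -> T -> R) i : D i ->
  measurable_wrt (sigma_of D X) (X i).
Proof.
by move=> Di A mA; apply: sub_sigma_algebra; exists i, A; split.
Qed.

Lemma sigma_ofS (I : Type) (D E : set I) (X : I -> T -> R) :
  D `<=` E -> sigma_of D X `<=` sigma_of E X.
Proof.
move=> DE; apply: smallest_sub; first exact: smallest_sigma_algebra.
by move=> _ [i [A [Di mA ->]]]; apply: sigma_of_measurable => //; exact: DE.
Qed.

Lemma measurable_wrt_fun G f : G `<=` measurable -> measurable_wrt G f ->
  measurable_fun setT f.
Proof. by move=> Gm Gf _ A mA; rewrite setTI; apply: Gm; exact: Gf. Qed.

Lemma measurable_wrtS G H f : G `<=` H -> measurable_wrt G f -> measurable_wrt H f.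
Proof. by move=> GH Gf A mA; apply: GH; exact: Gf. Qed.

Lemma sigma_of_subset (I : Type) (D : set I) (X : I -> T -> R) :
  (forall i, D i -> measurable_fun setT (X i)) -> sigma_of D X `<=` measurable.
Proof.
move=> mX; apply: smallest_sub; first exact: sigma_algebra_measurable.
by move=> _ [i [A [Di mA ->]]]; rewrite -[X in measurable X]setTI; exact: mX.
Qed.

Variable G : set (set T).
Hypothesis sG : sigma_algebra setT G.

Lemma measurable_wrtD f g : measurable_wrt G f -> measurable_wrt G g ->
  measurable_wrt G (fun w => f w + g w).
Proof.
by rewrite !measurable_wrtP// => mf mg; exact: measurable_funD.
Qed.

Lemma measurable_wrtB f g : measurable_wrt G f -> measurable_wrt G g ->
  measurable_wrt G (fun w => f w - g w).
Proof.
by rewrite !measurable_wrtP// => mf mg; exact: measurable_funB.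
Qed.

Lemma measurable_wrtM f g : measurable_wrt G f -> measurable_wrt G g ->
  measurable_wrt G (fun w => f w * g w).
Proof.
by rewrite !measurable_wrtP// => mf mg; exact: measurable_funM.
Qed.

Lemma measurable_wrt_cst (c : R) : measurable_wrt G (fun=> c).
Proof. by rewrite measurable_wrtP//; exact: measurable_cst. Qed.

Lemma measurable_wrt_comp (h : R -> R) f : measurable_fun setT h ->
  measurable_wrt G f -> measurable_wrt G (fun w => h (f w)).
Proof. by rewrite !measurable_wrtP// => mh mf; exact: measurableT_comp. Qed.

Lemma measurable_wrt_comp2 (h : R * R -> R) f g : measurable_fun setT h ->
  measurable_wrt G f -> measurable_wrt G g ->
  measurable_wrt G (fun w => h (f w, g w)).
Proof.
rewrite !measurable_wrtP// => mh mf mg.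
by apply: measurableT_comp => //; exact: measurable_fun_pair.
Qed.

Lemma measurable_wrt_sum (I : Type) (s : seq I) (Q : pred I) (F : I -> T -> R) :
  (forall i, Q i -> measurable_wrt G (F i)) ->
  measurable_wrt G (fun w => \sum_(i <- s | Q i) F i w).
Proof.
move=> mF; elim: s => [|i s IHs].
  by under eq_fun do rewrite big_nil; exact: measurable_wrt_cst.
under eq_fun do rewrite big_cons.
by case: (boolP (Q i)) => // Qi; apply: measurable_wrtD => //; exact: mF.
Qed.

Lemma measurable_wrt_indic A : G A -> measurable_wrt G (\1_A : T -> R).
Proof.
move=> GA; rewrite measurable_wrtP//.
apply: (@measurable_indic _ (g_sigma_algebraType G)).
exact: sub_sigma_algebra.
Qed.

Lemma measurable_wrt_ler f g : measurable_wrt G f -> measurable_wrt G g ->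
  G [set w | f w <= g w].
Proof.
rewrite !measurable_wrtP// => mf mg.
have := measurable_fun_ler mf mg; move=> /(_ measurableT [set true] I).
by rewrite setTI /measurable/= sigma_algebra_id.
Qed.

End MeasurableWrt.

(** * Densities and characteristic functions *)

Section Density.
Context {R : realType}.
Local Notation mu := (@lebesgue_measure R).

(** The measure [nu] is dominated by Lebesgue measure, and [p] agrees almost everywhere with its
    Radon-Nikodym derivative, for which the change of variables is available. *)
Lemma ge0_integral_density (nu : probability (measurableTypeR R) R)
    (p : R -> R) (h : R -> \bar R) :
  measurable_fun setT p -> (forall x, 0 <= p x) ->
  (forall A, measurable A -> nu A = \int[mu]_(x in A) (p x)%:E)%E ->
  measurable_fun setT h -> (forall x, 0 <= h x)%E ->
  (\int[nu]_x h x = \int[mu]_x (h x * (p x)%:E))%E.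
Proof.
move=> mp p0 nuE mh h0.
have dom : nu `<< mu.
  apply/null_content_dominatesP => A mA A0.
  rewrite [LHS]nuE//; apply: null_set_integral => //.
  by apply: measurable_funTS; exact/measurable_EFinP.
rewrite -(Radon_Nikodym_SigmaFinite.change_of_variables dom)//.
have irn := Radon_Nikodym_SigmaFinite.f_integrable dom.
have mrn := measurable_int _ irn.
apply: ge0_ae_eq_integral => //.
- exact: emeasurable_funM.
- by apply: emeasurable_funM => //; exact/measurable_EFinP.
- by move=> x _; rewrite mule_ge0//; exact: Radon_Nikodym_SigmaFinite.f_ge0.
- by move=> x _; rewrite mule_ge0// lee_fin.
- apply: ae_eqe_mul2l; apply: integral_ae_eq => //; first exact/measurable_EFinP.
  move=> E _ mE; rewrite -nuE//.
  by rewrite -(Radon_Nikodym_SigmaFinite.f_integral dom).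
Qed.

Context {d : measure_display} {T : measurableType d}.
Variables (P : probability T R) (X : T -> R) (p : R -> R).
Hypotheses (mX : measurable_fun setT X) (mp : measurable_fun setT p)
  (p0 : forall x, 0 <= p x) (Xp : has_density P p X).

Lemma ge0_Ex_density (h : R -> R) : measurable_fun setT h ->
  (forall x, 0 <= h x) ->
  (\int[P]_w (h (X w))%:E = \int[mu]_x (h x * p x)%:E)%E.
Proof.
(* The law of [X] has to live on the same copy of the real line as Lebesgue measure. *)
move=> mh h0; have mX' : @measurable_fun _ _ T (measurableTypeR R) setT X by exact: mX.
pose f : {mfun T >-> measurableTypeR R} :=
  @mfun_Sub _ _ T (measurableTypeR R) X (mem_set mX').
transitivity (\int[distribution P f]_x (h x)%:E)%E.
  rewrite ge0_integral_pushforward//; last by move=> x _; rewrite lee_fin.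
  exact/measurable_EFinP.
rewrite (@ge0_integral_density _ p)//; first exact/measurable_EFinP.
Qed.

Lemma L1_density (h : R -> R) : measurable_fun setT h ->
  mu.-integrable setT (fun x => (h x * p x)%:E) -> L1 P (fun w => h (X w)).
Proof.
move=> mh /integrableP[_ ih]; apply/integrableP; split.
  by apply/measurable_EFinP; exact: measurableT_comp.
have mnh : measurable_fun setT (fun x => `|h x|) by exact: measurableT_comp.
rewrite (ge0_Ex_density mnh)//.
apply: le_lt_trans ih; apply: ge0_le_integral => //.
- by move=> x _; rewrite lee_fin mulr_ge0.
- exact/measurable_EFinP/measurable_funM.
- by apply: measurableT_comp => //; apply/measurable_EFinP/measurable_funM.
- by move=> x _; rewrite /= lee_fin normrM (ger0_norm (p0 x)).
Qed.

Lemma integrable_density (h : R -> R) : measurable_fun setT h ->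
  L1 P (fun w => h (X w)) -> mu.-integrable setT (fun x => (h x * p x)%:E).
Proof.
move=> mh /integrableP[_ ih]; apply/integrableP; split.
  by apply/measurable_EFinP; exact: measurable_funM.
have mnh : measurable_fun setT (fun x => `|h x|) by exact: measurableT_comp.
rewrite (ge0_Ex_density mnh)// in ih.
apply: le_lt_trans ih; apply: ge0_le_integral => //.
- by apply: measurableT_comp => //; apply/measurable_EFinP/measurable_funM.
- exact/measurable_EFinP/measurable_funM.
- by move=> x _; rewrite /= lee_fin normrM (ger0_norm (p0 x)).
Qed.

Lemma Ex_density (h : R -> R) : measurable_fun setT h ->
  mu.-integrable setT (fun x => (h x * p x)%:E) ->
  \int[P]_w h (X w) = \int[mu]_x (h x * p x).
Proof.
move=> mh ih; have iX := L1_density mh ih.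
have mpos := measurable_funrpos mh; have mneg := measurable_funrneg mh.
have ipos : mu.-integrable setT (fun x => (h^\+ x * p x)%:E).
  apply: (le_integrable measurableT _ _ ih).
    by apply/measurable_EFinP/measurable_funM.
  move=> x _ /=; rewrite lee_fin !normrM ler_wpM2r//.
  rewrite (ger0_norm (funrpos_ge0 _ _)) /funrpos ge_max normr_ge0 andbT.
  exact: ler_norm.
have ineg : mu.-integrable setT (fun x => (h^\- x * p x)%:E).
  apply: (le_integrable measurableT _ _ ih).
    by apply/measurable_EFinP/measurable_funM.
  move=> x _ /=; rewrite lee_fin !normrM ler_wpM2r//.
  rewrite (ger0_norm (funrneg_ge0 _ _)) /funrneg ge_max normr_ge0 andbT.
  by rewrite -normrN; exact: ler_norm.
transitivity (\int[P]_w (h^\+ (X w) - h^\- (X w))).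
  by apply: eq_Rintegral => w _; rewrite -[in LHS](funrposBneg h).
rewrite ExB//; [|exact: L1_density..].
rewrite /Rintegral (ge0_Ex_density mpos (funrpos_ge0 _)) (ge0_Ex_density mneg (funrneg_ge0 _)).
rewrite -!/(Rintegral _ _ _) -RintegralB//.
by apply: eq_Rintegral => x _; rewrite -mulrBl -[in RHS](funrposBneg h).
Qed.

End Density.

Section TrigInequalities.
Context {R : realType}.
Implicit Types x y h : R.

Lemma sinB_le x y : `|sin x - sin y| <= `|x - y|.
Proof.
wlog xy : x y / y <= x.
  move=> hw; have [/hw//|/ltW /hw] := leP y x.
  by rewrite distrC (distrC y).
have [c _ ->] := @MVT_segment R sin cos y x xy (fun z _ => is_derive_sin z)
  (continuous_subspaceT (@continuous_sin R)).
by rewrite normrM ler_piMl// cos_max.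
Qed.

Lemma cosB_le x y : `|cos x - cos y| <= `|x - y|.
Proof.
by rewrite -!sinDpihalf (le_trans (sinB_le _ _))// opprD addrACA subrr addr0.
Qed.

(** The mean value theorem followed by the Lipschitz bound of the cosine; this costs the factor 1/2
    of Taylor's formula, which does not matter below. *)
Lemma sin_taylor1 x h : `|sin (x + h) - sin x - h * cos x| <= h ^+ 2.
Proof.
have main (a b : R) : a <= b ->
    exists2 c, c \in `[a, b]%R & sin b - sin a = cos c * (b - a).
  move=> ab; exact: (@MVT_segment R sin cos a b ab (fun z _ => is_derive_sin z)
    (continuous_subspaceT (@continuous_sin R))).
have [c cx ->] : exists2 c, `|c - x| <= `|h| &
    sin (x + h) - sin x = cos c * h.
  have [h0|/ltW h0] := leP 0 h.
    have [|c] := main x (x + h); first by rewrite lerDl.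
    rewrite in_itv/= => /andP[c1 c2] ->; exists c; last by congr (_ * _); ring.
    by rewrite !ger0_norm ?subr_ge0//; lra.
  have [|c] := main (x + h) x; first by rewrite gerDl.
  rewrite in_itv/= => /andP[c1 c2] E; exists c; last first.
    by rewrite -opprB E; ring.
  by rewrite !ler0_norm ?subr_le0//; lra.
rewrite mulrC -mulrBr normrM -(real_normK (num_real h)) expr2 ler_wpM2l//.
exact: le_trans (cosB_le _ _) cx.
Qed.

Lemma cos_taylor1 x h : `|cos (x + h) - cos x + h * sin x| <= h ^+ 2.
Proof.
have := sin_taylor1 (x + pi / 2) h.
have -> : x + pi / 2 + h = x + h + pi / 2 by ring.
by rewrite !sinDpihalf cosDpihalf mulrN opprK.
Qed.

End TrigInequalities.

(** * The differential equation of a Gaussian characteristic function *)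

Section Decay.
Context {R : realType}.

(** A global quadratic remainder is the form of differentiability that survives integration: the
    pointwise bound [cos_taylor1] can be integrated as it is. *)
Lemma is_derive_quadratic (phi : R -> R) (s l C : R) :
  (forall h, `|phi (s + h) - phi s - h * l| <= C * h ^+ 2) ->
  is_derive s 1 phi l.
Proof.
move=> H; have C0 : 0 <= C.
  have := H 1; rewrite expr1n mulr1; exact: le_trans.
suff cv : h^-1 *: (phi (h *: (1 : R) + s) - phi s) @[h --> (0 : R)^'] --> l.
  split; last exact: cvg_lim.
  by apply/cvg_ex; exists l.
apply/cvgrPdist_le => /= e e0.
near=> h.
have h0 : h != 0 by near: h; exact: nbhs_dnbhs_neq.
have -> : l - h^-1 *: (phi (h *: 1 + s) - phi s) =
    - (h^-1 * (phi (s + h) - phi s - h * l)).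
  rewrite [h *: 1]mulr1 (addrC h) /GRing.scale/=; field.
  exact: h0.
rewrite normrN normrM normfV.
rewrite ler_pdivrMl ?normr_gt0//; apply: (le_trans (H h)).
rewrite -(real_normK (num_real h)) expr2 mulrCA ler_wpM2l//.
have : `|h| <= e / (C + 1).
  near: h; apply: nbhs_dnbhs; exists (e / (C + 1)) => /=; first by rewrite divr_gt0// ltr_wpDl.
  by move=> h /=; rewrite sub0r normrN => /ltW.
move=> hh; apply: (@le_trans _ _ (C * (e / (C + 1)))); first by rewrite ler_wpM2l.
rewrite mulrCA; apply: ler_piMr; first exact: ltW.
by rewrite ler_pdivrMr ?mul1r ?lerDl// ltr_wpDl.
Unshelve. all: by end_near. Qed.

(* A perturbed Gaussian equation: the integrating factor is [exp(v s^2 / 2)] *)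
Lemma gaussian_ode (y dy : R -> R) (v delta : R) : 0 <= v -> 0 <= delta ->
  (forall s : R, is_derive s 1 y (dy s)) ->
  (forall s, 0 <= s <= 1 -> `|dy s + s * v * y s| <= delta) ->
  `|y 1 - expR (- (v / 2)) * y 0| <= delta.
Proof.
move=> v0 d0 Dy Hy.
pose z s := y s * expR (v / 2 * s ^+ 2).
have Dz (s : R) : is_derive s 1 z ((dy s + s * v * y s) * expR (v / 2 * s ^+ 2)).
  have D1 : is_derive s 1 (fun s : R => v / 2 * s ^+ 2) (v * s).
    apply: is_derive_eq; rewrite /GRing.scale/=.
    by field.
  have D2 := @is_derive1_comp R expR (fun s : R => v / 2 * s ^+ 2) s _ _ (is_derive_expR _) D1.
  rewrite /z; apply: is_derive_eq; rewrite /GRing.scale/=; ring.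
have [|c] := @MVT_segment R z _ 0 1 ler01 (fun s _ => Dz s).
  apply: derivable_within_continuous => s _; exact: ex_derive.
rewrite in_itv/= => c01; have /andP[c0 c1] := c01; rewrite subr0 mulr1.
rewrite {1 2}/z expr0n/= mulr0 expR0 mulr1 expr1n mulr1 => E.
(* After division by the integrating factor at 1 the exponent is [v (c^2 - 1) / 2], which is at most
   0 because [c <= 1]. *)
have -> : y 1 - expR (- (v / 2)) * y 0 =
    (dy c + c * v * y c) * expR (v / 2 * c ^+ 2 - v / 2).
  have e0 := expR_gt0 (v / 2).
  rewrite expRD mulrA -E expRN; field.
  by rewrite gt_eqF.
rewrite normrM -[leRHS]mulr1 ler_pM// ?Hy//.
rewrite ger0_norm ?expR_ge0// -expR0 ler_expR subr_le0 ler_piMr ?divr_ge0//.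
by rewrite expr_le1.
Qed.

Context {d : measure_display} {T : measurableType d}.
Variables (P : probability T R) (X : T -> R).

Lemma measurable_sin_comp (g : T -> R) : measurable_fun setT g ->
  measurable_fun setT (fun w => sin (g w)).
Proof.
move=> mg; apply: measurableT_comp => //.
exact: continuous_measurable_fun (@continuous_sin R).
Qed.

Lemma measurable_cos_comp (g : T -> R) : measurable_fun setT g ->
  measurable_fun setT (fun w => cos (g w)).
Proof.
move=> mg; apply: measurableT_comp => //.
exact: continuous_measurable_fun (@continuous_cos R).
Qed.

Lemma L1_cos (g : T -> R) : measurable_fun setT g -> L1 P (fun w => cos (g w)).
Proof.
move=> mg; apply: (@L1_bounded _ _ _ _ _ 1); first exact: measurable_cos_comp.
by move=> w; exact: cos_max.
Qed.

Lemma L1_sinM (g h : T -> R) : measurable_fun setT g -> L1 P h ->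
  L1 P (fun w => h w * sin (g w)).
Proof.
move=> mg ih; rewrite (_ : (fun w => _) = fun w => sin (g w) * h w); last first.
  by apply/funext => w; rewrite mulrC.
apply: (@L1M_bounded _ _ _ _ _ _ 1) => //; first exact: measurable_sin_comp.
by move=> w; exact: sin_max.
Qed.

Lemma L1_cosM (g h : T -> R) : measurable_fun setT g -> L1 P h ->
  L1 P (fun w => h w * cos (g w)).
Proof.
move=> mg ih; rewrite (_ : (fun w => _) = fun w => cos (g w) * h w); last first.
  by apply/funext => w; rewrite mulrC.
apply: (@L1M_bounded _ _ _ _ _ _ 1) => //; first exact: measurable_cos_comp.
by move=> w; exact: cos_max.
Qed.

Lemma is_derive_Ex_cos (theta s : R) : L2 P X ->
  is_derive s 1 (fun s => \int[P]_w cos (s * X w + theta))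
    (- \int[P]_w (X w * sin (s * X w + theta))).
Proof.
move=> LX; have [mX iX2] := LX; have iX := L2_L1 LX.
have mlin u : measurable_fun setT (fun w => u * X w + theta).
  by apply: measurable_funD => //; exact: measurable_funM.
apply: (@is_derive_quadratic _ _ _ (\int[P]_w (X w ^+ 2))) => h.
rewrite mulrN opprK -ExZl; last exact: L1_sinM.
have ih : L1 P (fun w => h * (X w * sin (s * X w + theta))).
  by apply: L1Zl; exact: L1_sinM.
rewrite -ExB; [|exact: L1_cos..]; rewrite -ExD//; last first.
  by apply: L1B; exact: L1_cos.
rewrite mulrC -ExZl//; apply: Ex_norm_le.
- by apply: L1D => //; apply: L1B; exact: L1_cos.
- exact: L1Zl.
- move=> w; have := cos_taylor1 (s * X w + theta) (h * X w).
  have -> : s * X w + theta + h * X w = (s + h) * X w + theta by ring.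
  by rewrite exprMn mulrA.
Qed.

(** Stein's method in the form used throughout: [s -> E cos(s X + theta)] has derivative
    [- E (X sin(s X + theta))], equals [cos theta] at 0, and by hypothesis nearly solves the
    Gaussian equation. The phase [theta] covers the real and the imaginary part of the
    characteristic function together. *)
Lemma Ex_cos_limit (theta v delta : R) : L2 P X -> 0 <= v -> 0 <= delta ->
  (forall s, 0 <= s <= 1 ->
    `|\int[P]_w (X w * sin (s * X w + theta))
      - s * v * \int[P]_w cos (s * X w + theta)| <= delta) ->
  `|\int[P]_w cos (X w + theta) - expR (- (v / 2)) * cos theta| <= delta.
Proof.
move=> LX v0 d0 H.
have := gaussian_ode v0 d0 (fun s => is_derive_Ex_cos theta s LX).
have -> : \int[P]_w cos (1 * X w + theta) = \int[P]_w cos (X w + theta).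
  by apply: eq_Rintegral => w _; rewrite mul1r.
have -> : \int[P]_w cos (0 * X w + theta) = cos theta.
  by under eq_Rintegral do rewrite mul0r add0r; rewrite Ex_cst.
by apply => s /H; rewrite distrC addrC.
Qed.

End Decay.

(** * The centered normal law *)

Section GaussianIntegrals.
Context {R : realType}.
Local Notation mu := (@lebesgue_measure R).

(** The fundamental theorem on the intervals with endpoints [- n.+1] and [n.+1], then dominated
    convergence; hence [F] has to vanish only along these points. *)
Lemma Rintegral_derive_eq0 (F f : R -> R) : continuous f ->
  (forall x : R, is_derive x 1 F (f x)) -> mu.-integrable setT (EFin \o f) ->
  F n.+1%:R @[n --> \oo] --> 0 -> F (- n.+1%:R) @[n --> \oo] --> 0 ->
  \int[mu]_x f x = 0.
Proof.
move=> cf DF intf F1 F2.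
pose A n := `[(- n.+1%:R : R), n.+1%:R]%classic.
pose f_ n x := (f x * \1_(A n) x)%:E.
have mfE : measurable_fun setT f by apply: continuous_measurable_fun.
have f_E n : (\int[mu]_x f_ n x = (F n.+1%:R - F (- n.+1%:R))%:E)%E.
  rewrite EFinB -(@continuous_FTC2 _ f F).
  - rewrite [RHS]integral_mkcond; apply: eq_integral => x _.
    by rewrite /f_ EFinM epatch_indic.
  - by rewrite gtrN// ltr0n.
  - exact: continuous_subspaceT.
  - split.
    + by move=> x _; exact: ex_derive.
    + apply: cvg_at_right_filter; apply: differentiable_continuous.
      by apply/derivable1_diffP; exact: ex_derive.
    + apply: cvg_at_left_filter; apply: differentiable_continuous.
      by apply/derivable1_diffP; exact: ex_derive.
  - by move=> x _; rewrite derive1E; exact: derive_val.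
have [|||||_ _ lim_f] := @dominated_convergence _ _ _ mu _ measurableT f_ (EFin \o f)
  (fun x => `|(f x)%:E|%E).
- move=> n; apply/measurable_EFinP/measurable_funM => //.
  by apply: measurable_indic; exact: measurable_itv.
- exact/measurable_EFinP.
- apply: aeW => x _; apply: cvg_near_cst.
  near=> n; rewrite /f_ indicE mem_set ?mulr1//.
  rewrite /A /= in_itv/= -ler_norml.
  have : (Num.truncn `|x| <= n)%N by near: n; exact: nbhs_infty_ge.
  move=> xn; apply: (le_trans (ltW (truncnS_gt _))).
  by rewrite ler_nat.
- exact: integrable_abse.
- apply: aeW => x n _; rewrite /f_ lee_fin normrM indicE.
  by case: (_ \in _); rewrite ?normr1 ?normr0 ?mulr1 ?mulr0.
have lim0 : (\int[mu]_x f_ n x)%E @[n --> \oo] --> 0%E.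
  under eq_fun do rewrite f_E.
  apply: cvg_EFin; first exact: nearW.
  by rewrite -[X in _ --> X]subr0; apply: cvgB.
by rewrite /Rintegral (cvg_unique (@ereal_hausdorff R) lim_f lim0).
Unshelve. all: by end_near. Qed.

(** The normal density without its constant; variance [v] corresponds to [b = 1 / (2 v)]. *)
Definition bell (b x : R) : R := expR (- (b * x ^+ 2)).

Lemma bell_gt0 b x : 0 < bell b x. Proof. exact: expR_gt0. Qed.

Lemma continuous_bell b : continuous (bell b).
Proof.
move=> x; apply: continuous_comp; last exact: continuous_expR.
apply: cvgN; apply: cvgM; first exact: cvg_cst.
exact: exprn_continuous.
Qed.

Lemma is_derive_bell b (x : R) : is_derive x 1 (bell b) (- (2 * b * x) * bell b x).
Proof.
have D1 : is_derive x 1 (fun x : R => - (b * x ^+ 2)) (- (2 * b * x)).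
  apply: is_derive_eq; rewrite /GRing.scale/=; ring.
rewrite [X in is_derive _ _ _ X]mulrC.
exact: (@is_derive1_comp R expR _ x _ _ (is_derive_expR _) D1).
Qed.

Lemma bell_sqrt b x : 0 < b -> let s := Num.sqrt (2 * b)^-1 in
  normal_pdf 0 s x = normal_peak s * bell b x.
Proof.
move=> b0 s; have s0 : s != 0 by rewrite gt_eqF// sqrtr_gt0 invr_gt0 mulr_gt0.
rewrite /normal_pdf (negbTE s0) /normal_fun /bell subr0; congr (_ * expR _).
rewrite sqr_sqrtr ?invr_ge0 ?mulr_ge0// ?ltW//.
by field; rewrite gt_eqF.
Qed.

Lemma integrable_bell b : 0 < b -> mu.-integrable setT (EFin \o bell b).
Proof.
move=> b0; set s := Num.sqrt (2 * b)^-1.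
have s0 : s != 0 by rewrite gt_eqF// sqrtr_gt0 invr_gt0 mulr_gt0.
have := integrableZl measurableT (normal_peak s)^-1 (integrable_normal_pdf 0 s).
apply: eq_integrable => // x _ /=.
rewrite /= bell_sqrt// -/s -EFinM mulKf//.
by rewrite gt_eqF// normal_peak_gt0.
Qed.

(** Half of the exponent absorbs the polynomial: with [y = b x^2 / 2], both [exp(- y)] and
    [y exp(- y)] are at most 1. *)
Lemma bell_sqr_le b x : 0 < b ->
  (1 + x ^+ 2) * bell b x <= (1 + 2 / b) * bell (b / 2) x.
Proof.
move=> b0; have -> : bell b x = bell (b / 2) x * bell (b / 2) x.
  by rewrite /bell -expRD; congr expR; field.
rewrite mulrA ler_wpM2r ?(ltW (bell_gt0 _ _))//.
set y := b / 2 * x ^+ 2; have y0 : 0 <= y by rewrite mulr_ge0 ?sqr_ge0// divr_ge0// ltW.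
have -> : x ^+ 2 = 2 / b * y by rewrite /y; field; rewrite gt_eqF.
rewrite /bell -/y mulrDl mul1r lerD//.
  by rewrite -expR0 ler_expR oppr_le0.
rewrite -[_ * y * _]mulrA ler_piMr//; first by rewrite divr_ge0// ltW.
rewrite expRN ler_pdivrMr ?expR_gt0// mul1r.
by apply: le_trans (expR_ge1Dx y); rewrite lerDr.
Qed.

Lemma bell_le b x : 0 < b -> bell b x <= (1 + b * x ^+ 2)^-1.
Proof.
move=> b0; have x0 : 0 <= b * x ^+ 2 by rewrite mulr_ge0 ?sqr_ge0// ltW.
rewrite /bell expRN lef_pV2 ?posrE ?expR_gt0 ?expR_ge1Dx//.
by rewrite ltr_wpDr.
Qed.

Lemma integrable_quadratic_bell b (h : R -> R) C : 0 < b ->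
  measurable_fun setT h -> (forall x, `|h x| <= C * (1 + x ^+ 2)) ->
  mu.-integrable setT (fun x => (h x * bell b x)%:E).
Proof.
move=> b0 mh hC; have b20 : 0 < b / 2 by rewrite divr_gt0.
have C0 : 0 <= C.
  by have := hC 0; rewrite expr0n/= addr0 mulr1; exact: le_trans.
have := integrableZl measurableT (C * (1 + 2 / b)) (integrable_bell b20).
apply: le_integrable => //.
  apply/measurable_EFinP/measurable_funM => //.
  by apply: continuous_measurable_fun; exact: continuous_bell.
move=> x _ /=; rewrite lee_fin normrM (gtr0_norm (bell_gt0 _ _)).
apply: le_trans (ler_norm _); rewrite -mulrA.
apply: le_trans (ler_wpM2l C0 (bell_sqr_le x b0)).
by rewrite mulrA ler_wpM2r// ltW// bell_gt0.
Qed.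

(** The integrand is the derivative of [phi * bell b], which decays like [1 / x^2] because [phi]
    grows at most quadratically. *)
Lemma bell_ibp b (phi dphi : R -> R) C : 0 < b -> continuous dphi ->
  (forall x : R, is_derive x 1 phi (dphi x)) ->
  (forall x, `|phi x| <= C * (1 + x ^+ 2)) ->
  (forall x, `|dphi x - 2 * b * x * phi x| <= C * (1 + x ^+ 2)) ->
  \int[mu]_x ((dphi x - 2 * b * x * phi x) * bell b x) = 0.
Proof.
move=> b0 cdphi Dphi phiC dphiC.
have cphi : continuous phi.
  move=> x; apply: differentiable_continuous; apply/derivable1_diffP.
  exact: ex_derive.
have C0 : 0 <= C.
  by have := phiC 0; rewrite expr0n/= addr0 mulr1; exact: le_trans.
have ch : continuous (fun x => dphi x - 2 * b * x * phi x).
  move=> x; apply: cvgB; first exact: cdphi.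
  by apply: cvgM; [apply: cvgM; [exact: cvg_cst|exact: cvg_id]|exact: cphi].
have bnd x : `|phi x * bell b x| <= C * (1 + 2 / b) / (1 + b / 2 * x ^+ 2).
  rewrite normrM (gtr0_norm (bell_gt0 _ _)).
  apply: (@le_trans _ _ (C * ((1 + x ^+ 2) * bell b x))).
    by rewrite mulrA ler_wpM2r// ltW// bell_gt0.
  have b20 : 0 < b / 2 by rewrite divr_gt0.
  rewrite -[leRHS]mulrA; apply: ler_wpM2l => //.
  apply: (le_trans (bell_sqr_le x b0)); apply: ler_wpM2l; last exact: bell_le.
  by rewrite addr_ge0// divr_ge0// ltW.
have cvg0 (u : nat -> R) : (forall n, n.+1%:R <= u n ^+ 2) ->
    (phi (u n) * bell b (u n)) @[n --> \oo] --> 0.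
  move=> un; apply: norm_cvg0.
  apply: (@squeeze_cvgr _ _ _ _ (cst 0) (fun n => C * (1 + 2 / b) / (b / 2) * n.+1%:R^-1)).
  - apply: nearW => n; rewrite normr_ge0/= (le_trans (bnd _))//.
    rewrite -[leRHS]mulrA -invfM ler_wpM2l//.
      by rewrite mulr_ge0// addr_ge0// divr_ge0// ltW.
    rewrite lef_pV2 ?posrE ?mulr_gt0 ?divr_gt0//; last first.
      by rewrite ltr_wpDr// mulr_ge0 ?sqr_ge0// divr_ge0// ltW.
    rewrite (le_trans (ler_wpM2l _ (un n)))//; last by rewrite lerDr.
    by rewrite divr_ge0// ltW.
  - exact: cvg_cst.
  - rewrite -[X in _ --> X](mulr0 (C * (1 + 2 / b) / (b / 2))).
    by apply: cvgM; [exact: cvg_cst|exact: cvg_harmonic].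
apply: (@Rintegral_derive_eq0 (fun x => phi x * bell b x)).
- move=> x; apply: cvgM; first exact: ch.
  exact: continuous_bell.
- move=> x; have Db := is_derive_bell b x; have Dp := Dphi x.
  by apply: is_derive_eq; rewrite /GRing.scale/=; ring.
- apply: (@integrable_quadratic_bell _ _ C) => //.
  exact: continuous_measurable_fun.
- apply: (cvg0 (fun n => n.+1%:R)) => n.
  by rewrite expr2 -natrM ler_nat leq_pmulr.
- apply: (cvg0 (fun n => - n.+1%:R)) => n.
  by rewrite sqrrN expr2 -natrM ler_nat leq_pmulr.
Qed.

End GaussianIntegrals.

Section CenteredNormal.
Context {R : realType} {d : measure_display} {T : measurableType d}.
Variables (P : probability T R) (X : T -> R) (v : R).
Hypotheses (mX : measurable_fun setT X) (v0 : 0 <= v).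
Hypothesis lawX : forall A : set R, measurable A ->
  P [set w | A (X w)] = centered_normal v A.
Local Notation mu := (@lebesgue_measure R).

Let b := (2 * v)^-1.
Let s := Num.sqrt v.

Let density : v != 0 -> has_density P (fun x => normal_peak s * bell b x) X.
Proof.
move=> vn0 A mA; rewrite [LHS]lawX// /centered_normal (negbTE vn0) /normal_prob.
have v_gt0 : 0 < v by rewrite lt0r vn0.
apply: eq_integral => x _; congr EFin.
have -> : Num.sqrt v = Num.sqrt (2 * b)^-1.
  by congr Num.sqrt; rewrite /b; field.
by rewrite bell_sqrt ?invr_gt0 ?mulr_gt0// /s; congr (normal_peak (Num.sqrt _) * _);
  rewrite /b; field.
Qed.

Let degenerate : v = 0 -> {ae P, forall w, X w = 0}.
Proof.
move=> vz; exists (X @^-1` (~` [set 0])); split.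
- by rewrite -[X in measurable X]setTI; apply: mX => //; exact: measurableC.
- rewrite (lawX (measurableC (measurable_set1 (0 : R)))).
  rewrite /centered_normal vz eqxx diracE.
  by rewrite memNset//= => /(_ erefl).
- by [].
Qed.

Let ms x : 0 < v -> 0 <= normal_peak s * bell b x.
Proof. by move=> _; rewrite mulr_ge0 ?normal_peak_ge0// ltW// bell_gt0. Qed.

Let mpdf : measurable_fun setT (fun x => normal_peak s * bell b x).
Proof.
apply: measurable_funM => //; apply: continuous_measurable_fun.
exact: continuous_bell.
Qed.

Let normalE (h : R -> R) C : v != 0 -> measurable_fun setT h ->
  (forall x, `|h x| <= C * (1 + x ^+ 2)) ->
  L1 P (fun w => h (X w)) /\
  \int[P]_w h (X w) = normal_peak s * \int[mu]_x (h x * bell b x).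
Proof.
move=> vn0 mh hC; have v_gt0 : 0 < v by rewrite lt0r vn0.
have b0 : 0 < b by rewrite invr_gt0 mulr_gt0.
have ih := integrable_quadratic_bell b0 mh hC.
have ih' : mu.-integrable setT (fun x => (h x * (normal_peak s * bell b x))%:E).
  have := integrableZl measurableT (normal_peak s) ih.
  by apply: eq_integrable => // x _; rewrite -EFinM mulrCA.
have p0 x := ms x v_gt0.
split; first exact: (L1_density mX mpdf p0 (density vn0)).
rewrite (Ex_density mX mpdf p0 (density vn0))// -RintegralZl//.
by apply: eq_Rintegral => x _; rewrite mulrCA.
Qed.

(** Stein's identity. The mean, the variance and the characteristic function of the normal law
    follow from it with [phi] constant, the identity and a sine. *)
Let normal_ibp (phi dphi : R -> R) C : v != 0 -> continuous dphi ->
  (forall x : R, is_derive x 1 phi (dphi x)) ->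
  (forall x, `|dphi x| <= C) -> (forall x, `|phi x| <= C + C * `|x|) ->
  L1 P (fun w => X w * phi (X w)) /\
  \int[P]_w (X w * phi (X w)) = v * \int[P]_w dphi (X w).
Proof.
move=> vn0 cd Dphi dC pC; have v_gt0 : 0 < v by rewrite lt0r vn0.
have b0 : 0 < b by rewrite invr_gt0 mulr_gt0.
have C0 : 0 <= C by apply: le_trans (dC 0).
have xle x : `|x| <= 1 + x ^+ 2 :> R.
  by rewrite -(real_normK (num_real x)); have := sqr_ge0 (`|x| - 1); have := sqr_ge0 `|x|; lra.
have x2le x : C * x ^+ 2 <= C * (1 + x ^+ 2) by rewrite ler_wpM2l// lerDr.
have x2le1 x : C <= C * (1 + x ^+ 2) by rewrite ler_peMr// lerDl sqr_ge0.
have xCle x : C * `|x| <= C * (1 + x ^+ 2) by rewrite ler_wpM2l.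
have phib x : `|phi x| <= 2 * C * (1 + x ^+ 2).
  by apply: (le_trans (pC x)); have := xCle x; have := x2le1 x; lra.
have xphib x : `|x * phi x| <= 2 * C * (1 + x ^+ 2).
  rewrite normrM; apply: (le_trans (ler_wpM2l _ (pC x))) => //.
  by have := xCle x; have := x2le x; rewrite -[x ^+ 2]real_normK ?num_real//; nra.
have dphib x : `|dphi x| <= C * (1 + x ^+ 2) by exact: le_trans (dC x) (x2le1 x).
have cphi : continuous phi.
  move=> x; apply: differentiable_continuous; apply/derivable1_diffP.
  exact: ex_derive.
have mphi := continuous_measurable_fun cphi.
have mdphi := continuous_measurable_fun cd.
have mxphi : measurable_fun setT (fun x : R => x * phi x) by exact: measurable_funM.
have [i1 E1] := normalE vn0 mxphi xphib.
have [i2 E2] := normalE vn0 mdphi dphib.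
split => //; rewrite E1 E2 mulrCA; congr (_ * _).
have ix := integrable_quadratic_bell b0 mxphi xphib.
have id := integrable_quadratic_bell b0 mdphi dphib.
have vb : v * (2 * b) = 1 by rewrite /b; field.
have b2 : 0 <= 2 * b by rewrite mulr_ge0// ltW.
have := @bell_ibp _ b phi dphi (2 * C + (2 * b) * (2 * C)) b0 cd Dphi.
rewrite (_ : \int[mu]_x _ = \int[mu]_x (dphi x * bell b x)
    - 2 * b * \int[mu]_x (x * phi x * bell b x)); last first.
  rewrite -RintegralZl// -RintegralB//; last first.
    have := integrableZl measurableT (2 * b) ix.
    by apply: eq_integrable => // x _; rewrite -EFinM.
  by apply: eq_Rintegral => x _; ring.
have h1 x : `|phi x| <= (2 * C + 2 * b * (2 * C)) * (1 + x ^+ 2).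
  apply: (le_trans (phib x)); rewrite ler_wpM2r ?addr_ge0 ?sqr_ge0//.
  by rewrite lerDl mulr_ge0// mulr_ge0.
have h2 x : `|dphi x - 2 * b * x * phi x| <=
    (2 * C + 2 * b * (2 * C)) * (1 + x ^+ 2).
  apply: (le_trans (ler_normB _ _)); rewrite [leRHS]mulrDl lerD//.
    apply: (le_trans (dphib x)); rewrite ler_wpM2r ?addr_ge0 ?sqr_ge0//.
    by rewrite ler_peMl// ler1n.
  by rewrite -mulrA normrM (ger0_norm b2) -[leRHS]mulrA ler_wpM2l.
move=> /(_ h1 h2) /eqP; rewrite subr_eq0 => /eqP ->.
by rewrite mulrA vb mul1r.
Qed.

Lemma centered_normal_L2 : L2 P X.
Proof.
have [vz|vn0] := eqVneq v 0; last first.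
  split => //; have [||i _] := @normalE (fun x => x ^+ 2) 1 vn0.
  - exact: exprn_measurable.
  - by move=> x; rewrite mul1r ger0_norm ?sqr_ge0// lerDr.
  - exact: i.
split => //; apply/integrableP; split.
  by apply/measurable_EFinP; exact: measurable_funX.
rewrite (ae_eq_integral (cst 0%E))//; first by rewrite integral0.
- by apply: measurableT_comp => //; apply/measurable_EFinP; exact: measurable_funX.
- apply: filterS (degenerate vz) => w X0 _ /=.
  by rewrite X0 expr0n/= normr0.
Qed.

Let Ex_degenerate (h : R -> R) : v = 0 -> measurable_fun setT h ->
  \int[P]_w h (X w) = h 0.
Proof.
move=> vz mh; rewrite -[RHS](Ex_cst P); congr fine.
apply: ae_eq_integral => //.
  by apply/measurable_EFinP; exact: measurableT_comp.
by apply: filterS (degenerate vz) => w X0 _ /=; rewrite X0.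
Qed.

Lemma centered_normal_mean : \int[P]_w X w = 0.
Proof.
have [vz|vn0] := eqVneq v 0; first exact: (Ex_degenerate vz (@measurable_id _ _ _)).
have [] := @normal_ibp (fun=> 1) (fun=> 0) 1 vn0.
- by move=> x; exact: cvg_cst.
- by move=> x; rewrite normr0.
- by move=> x; rewrite normr1 mul1r lerDl.
- move=> _; rewrite Ex_cst mulr0 => E; rewrite -[RHS]E.
  by apply: eq_Rintegral => w _; rewrite mulr1.
Qed.

Lemma centered_normal_variance : \int[P]_w (X w ^+ 2) = v.
Proof.
have [vz|vn0] := eqVneq v 0.
  by rewrite (Ex_degenerate vz (@exprn_measurable _ _ 2)) expr0n/= vz.
have [] := @normal_ibp id (fun=> 1) 1 vn0.
- by move=> x; exact: cvg_cst.
- by move=> x; rewrite normr1.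
- by move=> x; rewrite mul1r lerDr.
- move=> _; rewrite Ex_cst mulr1 => E; rewrite -[RHS]E.
  by apply: eq_Rintegral => w _; rewrite expr2.
Qed.

(** For a sine, Stein's identity says that the hypothesis of [Ex_cos_limit] holds with
    [delta = 0]. *)
Lemma centered_normal_cos theta :
  \int[P]_w cos (X w + theta) = expR (- (v / 2)) * cos theta.
Proof.
apply/eqP; rewrite -subr_eq0 -normr_le0.
apply: Ex_cos_limit => //; first exact: centered_normal_L2.
move=> u /andP[u0 u1]; have [vz|vn0] := eqVneq v 0.
  have mh : measurable_fun setT (fun x : R => x * sin (u * x + theta)).
    apply: measurable_funM => //; apply: measurable_sin_comp.
    by apply: measurable_funD => //; exact: measurable_funM.
  by rewrite (Ex_degenerate vz mh) vz mulr0 !mul0r subr0 normr0.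
have [] := @normal_ibp (fun x => sin (u * x + theta))
    (fun x => u * cos (u * x + theta)) 1 vn0.
- move=> x; apply: cvgM; first exact: cvg_cst.
  apply: continuous_comp; last exact: continuous_cos.
  by apply: cvgD; [apply: cvgM; [exact: cvg_cst|exact: cvg_id]|exact: cvg_cst].
- move=> x; have D1 : is_derive x 1 (fun x : R => u * x + theta) u.
    by apply: is_derive_eq; rewrite /GRing.scale/= mulr1 addr0.
  rewrite [X in is_derive _ _ _ X]mulrC.
  exact: (@is_derive1_comp R sin _ x _ _ (is_derive_sin _) D1).
- move=> x; rewrite normrM -[leRHS]mulr1 ler_pM//; last exact: cos_max.
  by rewrite ger0_norm.
- by move=> x; rewrite (le_trans (sin_max _))// lerDl mul1r.
- move=> _ ->; rewrite ExZl; last first.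
    by apply: L1_cos; apply: measurable_funD => //; exact: measurable_funM.
  by rewrite mulrCA mulrA subrr normr0.
Qed.

End CenteredNormal.

(** * A central limit theorem under local dependence *)

Lemma sum_cst_le {R : numDomainType} (E : finType) (Q : pred E) (k : nat) (c : R) :
  0 <= c -> (#|Q| <= k)%N -> \sum_(g | Q g) c <= k%:R * c.
Proof.
move=> c0 Qk; rewrite (_ : \sum_(g | Q g) c = \sum_(g in Q) c); last exact: eq_bigl.
by rewrite sumr_const -[leLHS]mulr_natl ler_wpM2r// ler_nat.
Qed.

Section LocalDependence.
Context {R : realType} {d : measure_display} {T : measurableType d}.
Variables (P : probability T R) (E : finType) (zeta : E -> T -> R)
  (nb : rel E) (D : nat) (m : R).
Hypotheses (m0 : 0 <= m) (mz : forall e, measurable_fun setT (zeta e))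
  (zm : forall e w, `|zeta e w| <= m)
  (nbD : forall e, (#|[pred g | nb e g]| <= D)%N).

Let S w := \sum_e zeta e w.
Let A e w := \sum_(g | nb e g) zeta g w.
Let B e e' w := \sum_(g | nb e g || nb e' g) zeta g w.

(** The terms outside [K] vanish identically. The final bound counts [K] and not [E], which matters
    when [E] consists of all pairs and [K] of the close ones only. *)
Variable K : pred E.
Hypotheses (zK : forall e w, ~~ K e -> zeta e w = 0)
  (nbK : forall e g, nb e g -> K e).

(** Local dependence enters through three identities: removing the neighbours of [e] leaves a sum
    that is independent of the centered [zeta e], removing those of [e] and [e'] leaves one
    independent of their product, and non-neighbours are uncorrelated. *)
Hypothesis indep1 : forall e s theta,
  \int[P]_w (zeta e w * sin (s * (S w - A e w) + theta)) = 0.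
Hypothesis indep2 : forall e e' s theta, nb e e' ->
  \int[P]_w (zeta e w * zeta e' w * cos (s * (S w - B e e' w) + theta)) =
  \int[P]_w (zeta e w * zeta e' w) *
    \int[P]_w cos (s * (S w - B e e' w) + theta).
Hypothesis uncorrelated : forall e e', ~~ nb e e' ->
  \int[P]_w (zeta e w * zeta e' w) = 0.

Let sum_le (Q : pred E) (k : nat) w : (#|Q| <= k)%N ->
  `|\sum_(g | Q g) zeta g w| <= k%:R * m.
Proof.
move=> Qk; apply: (le_trans (ler_norm_sum _ _ _)).
apply: (@le_trans _ _ (\sum_(g | Q g) m)); first by apply: ler_sum => g _.
exact: sum_cst_le.
Qed.

Let A_le e w : `|A e w| <= D%:R * m.
Proof. exact: sum_le (nbD e). Qed.

Let B_le e e' w : `|B e e' w| <= 2 * D%:R * m.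
Proof.
rewrite -natrM; apply: sum_le; rewrite mul2n -addnn.
apply: leq_trans (leq_add (nbD e) (nbD e')).
by rewrite -cardUI (leq_trans _ (leq_addr _ _))//; apply: subset_leq_card; apply/fintype.subsetP => g.
Qed.

Let mS : measurable_fun setT S. Proof. exact: measurable_sum. Qed.
Let mA e : measurable_fun setT (A e). Proof. by apply: measurable_sum_cond. Qed.
Let mB e e' : measurable_fun setT (B e e').
Proof. by apply: measurable_sum_cond. Qed.

Let mlin s theta (X : T -> R) : measurable_fun setT X ->
  measurable_fun setT (fun w => s * X w + theta).
Proof. by move=> mX; apply: measurable_funD => //; exact: measurable_funM. Qed.

Let Lz e : L1 P (zeta e). Proof. exact: L1_bounded (zm e). Qed.

Let zz_le e e' w : `|zeta e w * zeta e' w| <= m ^+ 2.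
Proof. by rewrite normrM expr2 ler_pM. Qed.

Let mzz e e' : measurable_fun setT (fun w => zeta e w * zeta e' w).
Proof. exact: measurable_funM. Qed.

Let Lzz e e' : L1 P (fun w => zeta e w * zeta e' w).
Proof. exact: (L1_bounded P (mzz e e') (zz_le e e')). Qed.

Let cov e e' := \int[P]_w (zeta e w * zeta e' w).

Let ES2 : \int[P]_w (S w ^+ 2) = \sum_e \sum_(e' | nb e e') cov e e'.
Proof.
transitivity (\int[P]_w (\sum_e \sum_e' zeta e w * zeta e' w)).
  by apply: eq_Rintegral => w _; rewrite expr2 big_distrlr.
rewrite Ex_sum; last by move=> e _; apply: L1_sum.
apply: eq_bigr => e _; rewrite Ex_sum// [LHS](bigID (nb e))/=.
by rewrite [X in _ + X]big1 ?addr0// => e' ne; exact: uncorrelated.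
Qed.

(** Replacing [S] by [S - B e e'] moves the cosine by at most [2 D m], after which [indep2] factors
    the expectation. The replacement is made twice, in the product and in the covariance term, each
    time against a factor [m^2]. *)
Let second_order s theta e e' : 0 <= s <= 1 -> nb e e' ->
  `|\int[P]_w (zeta e w * zeta e' w * cos (s * S w + theta))
    - cov e e' * \int[P]_w cos (s * S w + theta)| <= 4 * D%:R * m ^+ 3.
Proof.
move=> /andP[s0 s1] ee'.
set c := fun w => cos (s * S w + theta).
set c' := fun w => cos (s * (S w - B e e' w) + theta).
have mc : measurable_fun setT c by apply/measurable_cos_comp/mlin.
have mc' : measurable_fun setT c'.
  by apply/measurable_cos_comp/mlin; exact: measurable_funB.
have Lc : L1 P c by apply/L1_cos/mlin.
have Lc' : L1 P c' by apply/L1_cos/mlin; exact: measurable_funB.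
have cc' w : `|c w - c' w| <= 2 * D%:R * m.
  apply: (le_trans (cosB_le _ _)).
  rewrite (_ : _ - _ = s * B e e' w); last by ring.
  rewrite normrM ger0_norm// -[leRHS]mul1r ler_pM//.
have c1 w : `|c w| <= 1 by exact: cos_max.
have c1' w : `|c' w| <= 1 by exact: cos_max.
have Lzc : L1 P (fun w => zeta e w * zeta e' w * c w).
  by apply: L1M_bounded Lc => //; exact: zz_le.
have Lzc' : L1 P (fun w => zeta e w * zeta e' w * c' w).
  by apply: L1M_bounded Lc' => //; exact: zz_le.
rewrite (_ : _ - _ = \int[P]_w (zeta e w * zeta e' w * c w - zeta e w * zeta e' w * c' w)
    - cov e e' * \int[P]_w (c w - c' w)); last first.
  by rewrite !ExB// /c' indep2// -/c' -/(cov e e'); ring.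
have D0 : 0 <= 2 * D%:R * m by rewrite mulr_ge0// mulr_ge0.
apply: (le_trans (ler_normB _ _)).
have -> : 4 * D%:R * m ^+ 3 = m ^+ 2 * (2 * D%:R * m) + m ^+ 2 * (2 * D%:R * m).
  by ring.
apply: lerD.
  apply: Ex_norm_bound; first exact: L1B.
  by move=> w; rewrite -mulrBr normrM ler_pM.
rewrite normrM ler_pM//; first by apply: Ex_norm_bound.
by apply: Ex_norm_bound => //; exact: L1B.
Qed.

(** The 5 is 1 + 4: the Taylor remainder of the sine costs [m (D m)^2], and each of the at most [D]
    neighbours costs [4 D m^3] by [second_order]. *)
Let first_order s theta e : 0 <= s <= 1 ->
  `|\int[P]_w (zeta e w * sin (s * S w + theta))
    - s * (\sum_(e' | nb e e') cov e e') * \int[P]_w cos (s * S w + theta)|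
  <= 5 * D%:R ^+ 2 * m ^+ 3.
Proof.
move=> s01; have /andP[s0 s1] := s01.
set y := fun w => s * S w + theta.
have my : measurable_fun setT y by exact: mlin.
set x := fun w => s * (S w - A e w) + theta.
have mx : measurable_fun setT x by apply/mlin/measurable_funB.
have Dm0 : 0 <= D%:R * m by rewrite mulr_ge0.
have ms : measurable_fun setT (fun w => sin (y w)) by exact: measurable_sin_comp.
have mc : measurable_fun setT (fun w => cos (y w)) by exact: measurable_cos_comp.
have LzA : L1 P (fun w => zeta e w * (s * A e w * cos (y w))).
  apply: (@L1_bounded _ _ _ _ _ (m * (1 * (D%:R * m) * 1))).
    by apply: measurable_funM => //; apply: measurable_funM => //; exact: measurable_funM.
  move=> w; rewrite normrM ler_pM// normrM ler_pM//; last exact: cos_max.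
  by rewrite normrM ler_pM// ger0_norm.
have Lsy : L1 P (fun w => zeta e w * sin (y w)) by exact: L1_sinM.
have Lsx : L1 P (fun w => zeta e w * sin (x w)) by exact: L1_sinM.
have E1 : `|\int[P]_w (zeta e w * sin (y w))
    - \int[P]_w (zeta e w * (s * A e w * cos (y w)))| <= D%:R ^+ 2 * m ^+ 3.
  rewrite -[X in X - _]subr0 -(indep1 e s theta) -!ExB//; last exact: L1B.
  apply: Ex_norm_bound; first by apply: L1B => //; exact: L1B.
  move=> w; have := sin_taylor1 (y w) (- (s * A e w)).
  have -> : y w + - (s * A e w) = x w by rewrite /y /x; ring.
  rewrite mulNr opprK -normrN => H.
  rewrite -/(x w) -!mulrBr normrM.
  have -> : D%:R ^+ 2 * m ^+ 3 = m * (D%:R * m) ^+ 2 by ring.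
  rewrite ler_pM//.
  have -> : sin (y w) - sin (x w) - s * A e w * cos (y w) =
     - (sin (x w) - sin (y w) + s * A e w * cos (y w)) by ring.
  apply: (le_trans H); rewrite sqrrN -[leLHS]real_normK ?num_real//.
  by rewrite lerXn2r ?nnegrE// normrM -[leRHS]mul1r ler_pM// ger0_norm.
have E2 : \int[P]_w (zeta e w * (s * A e w * cos (y w))) =
    s * \sum_(e' | nb e e') \int[P]_w (zeta e w * zeta e' w * cos (y w)).
  have L2 e' : L1 P (fun w => zeta e w * zeta e' w * cos (y w)).
    by apply: L1_cosM.
  rewrite -Ex_sum// -ExZl; last exact: L1_sum.
  apply: eq_Rintegral => w _; rewrite /A !mulr_sumr.
  by rewrite mulr_suml mulr_sumr; apply: eq_bigr => e' _; ring.
have -> : 5 * D%:R ^+ 2 * m ^+ 3 =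
    D%:R ^+ 2 * m ^+ 3 + 4 * D%:R ^+ 2 * m ^+ 3 by ring.
rewrite -[X in `|X|](subrKA (\int[P]_w (zeta e w * (s * A e w * cos (y w))))).
apply: (le_trans (ler_normD _ _)); apply: lerD => //.
rewrite E2 -mulrA -mulrBr normrM ger0_norm// mulr_suml -sumrB.
apply: (@le_trans _ _ (1 * (D%:R * (4 * D%:R * m ^+ 3)))); last first.
  by rewrite mul1r le_eqVlt; apply/orP; left; apply/eqP; ring.
apply: ler_pM => //.
apply: (le_trans (ler_norm_sum _ _ _)).
apply: (@le_trans _ _ (\sum_(e' | nb e e') (4 * D%:R * m ^+ 3))).
  by apply: ler_sum => e' ee'; exact: second_order.
apply: sum_cst_le; last exact: nbD.
by rewrite mulr_ge0 ?exprn_ge0// mulr_ge0.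
Qed.

(* [s |-> E cos(s S + theta)] solves [y' = - s E(S^2) y] up to a small error: expand
   the sine around [s (S - A e)] and the cosine around [s (S - B e e')]. *)
Lemma local_dependence_cos theta :
  `|\int[P]_w cos (S w + theta)
    - expR (- (\int[P]_w (S w ^+ 2) / 2)) * cos theta|
  <= 5 * #|K|%:R * D%:R ^+ 2 * m ^+ 3.
Proof.
have LS : L2 P S.
  by apply: L2_sum => e _; apply: (@L2_bounded _ _ _ _ _ m).
apply: Ex_cos_limit => //.
- by apply: Ex_ge0 => w; exact: sqr_ge0.
- by rewrite !mulr_ge0 ?exprn_ge0.
move=> s s01.
have mSs : measurable_fun setT (fun w => s * S w + theta) by exact: mlin.
have -> : \int[P]_w (S w * sin (s * S w + theta)) =
    \sum_e \int[P]_w (zeta e w * sin (s * S w + theta)).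
  rewrite -Ex_sum; last by move=> e _; exact: L1_sinM.
  by apply: eq_Rintegral => w _; rewrite mulr_suml.
rewrite ES2 mulr_sumr mulr_suml -sumrB; apply: (le_trans (ler_norm_sum _ _ _)).
rewrite (bigID K)/= [X in _ + X]big1 ?addr0; last first.
  move=> e nKe; rewrite big_pred0 ?mulr0 ?mul0r ?subr0; last first.
    by move=> g; apply/negbTE; apply: contra nKe; exact: nbK.
  under eq_Rintegral do rewrite zK// mul0r.
  by rewrite Ex_cst normr0.
apply: (@le_trans _ _ (\sum_(e | K e) (5 * D%:R ^+ 2 * m ^+ 3))).
  by apply: ler_sum => e _; exact: first_order.
apply: (@le_trans _ _ (#|K|%:R * (5 * D%:R ^+ 2 * m ^+ 3))).
  by apply: sum_cst_le => //; rewrite !mulr_ge0 ?exprn_ge0.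
by rewrite le_eqVlt; apply/orP; left; apply/eqP; ring.
Qed.

End LocalDependence.

(** * Approximation by trigonometric polynomials *)

Section Bernstein.
Context {R : realType}.
Implicit Types (x y : R) (g : nat -> R).

(* the binomial weight 'C(m, i) x^i (1 - x)^(m - i), by Pascal's recursion *)
Fixpoint bweight (m i : nat) x : R :=
  if m is m'.+1 then
    (1 - x) * bweight m' i x + x * (if i is i'.+1 then bweight m' i' x else 0)
  else (i == 0)%:R.

Lemma bweight_ge0 m i x : 0 <= x <= 1 -> 0 <= bweight m i x.
Proof.
move=> /andP[x0 x1]; elim: m i => [|m IHm] i /=; first by case: (i == 0)%N.
by rewrite addr_ge0// mulr_ge0// ?subr_ge0//; case: i.
Qed.

Lemma bweight_small m i x : (m < i)%N -> bweight m i x = 0.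
Proof.
elim: m i => [|m IHm] [|i]//= mi.
by rewrite !IHm ?mulr0 ?addr0//; exact: ltnW.
Qed.

Lemma sum_bweightS m x g :
  \sum_(i < m.+2) bweight m.+1 i x * g i =
  (1 - x) * \sum_(i < m.+1) bweight m i x * g i +
  x * \sum_(i < m.+1) bweight m i x * g i.+1.
Proof.
transitivity (\sum_(i < m.+2) ((1 - x) * (bweight m i x * g i)) +
    \sum_(i < m.+2) (x * ((if nat_of_ord i is i'.+1 then bweight m i' x else 0) * g i))).
  by rewrite -big_split; apply: eq_bigr => i _ /=; ring.
congr (_ + _).
  by rewrite big_ord_recr/= bweight_small// mul0r mulr0 addr0 mulr_sumr.
rewrite big_ord_recl/= mul0r mulr0 add0r mulr_sumr.
by apply: eq_bigr.
Qed.

Lemma sum_bweight m x : \sum_(i < m.+1) bweight m i x = 1.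
Proof.
have E k : \sum_(i < k.+1) bweight k i x = \sum_(i < k.+1) bweight k i x * 1.
  by apply: eq_bigr => i _; rewrite mulr1.
elim: m => [|m IHm]; first by rewrite big_ord1.
by rewrite E (sum_bweightS _ _ (fun=> 1)) -!E IHm; ring.
Qed.

(** Variance of the binomial law plus squared bias. The centre [a] is arbitrary because the
    induction step shifts it by 1. *)
Lemma sum_bweight_sqr m x (a : R) :
  \sum_(i < m.+1) bweight m i x * (i%:R - a) ^+ 2 =
  m%:R * x * (1 - x) + (m%:R * x - a) ^+ 2.
Proof.
elim: m a => [|m IHm] a; first by rewrite big_ord1/=; ring.
rewrite (sum_bweightS _ _ (fun i => (i%:R - a) ^+ 2)) IHm.
rewrite (eq_bigr (fun i : 'I_m.+1 => bweight m i x * (i%:R - (a - 1)) ^+ 2)).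
  by rewrite IHm -[m.+1%:R]natr1; ring.
by move=> i _; rewrite -natr1; congr (_ * _ ^+ 2); ring.
Qed.

Lemma sum_bweight_dev m x : 0 <= x <= 1 ->
  \sum_(i < m.+2) bweight m.+1 i x * (i%:R / m.+1%:R - x) ^+ 2 <= m.+1%:R^-1.
Proof.
move=> /andP[x0 x1]; have m0 : 0 < m.+1%:R :> R by rewrite ltr0n.
rewrite (eq_bigr (fun i : 'I_m.+2 => m.+1%:R ^- 2 *
    (bweight m.+1 i x * (i%:R - m.+1%:R * x) ^+ 2))); last first.
  by move=> i _; field; rewrite gt_eqF.
rewrite -mulr_sumr sum_bweight_sqr subrr expr0n/= addr0.
have -> : m.+1%:R ^- 2 * (m.+1%:R * x * (1 - x)) = m.+1%:R^-1 * (x * (1 - x)).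
  by field; rewrite gt_eqF.
by rewrite ler_piMr ?invr_ge0 ?ltW//; nra.
Qed.

Variable k : nat.
Implicit Types (G : 'rV[R]_k -> R) (v : 'rV[R]_k).

Definition lattice_point m (I : {ffun 'I_k -> 'I_m.+1}) : 'rV[R]_k :=
  \row_j ((I j)%:R / m%:R).

Definition lattice_weight m (I : {ffun 'I_k -> 'I_m.+1}) v : R :=
  \prod_j bweight m (I j) (v 0 j).

Definition bernstein G m v : R :=
  \sum_(I : {ffun 'I_k -> 'I_m.+1}) G (lattice_point I) * lattice_weight I v.

Definition cube : set 'rV[R]_k := [set v | forall j, `[(0 : R), 1]%classic (v 0 j)].

Lemma cube_le v j : cube v -> 0 <= v 0 j <= 1.
Proof. by move=> /(_ j) /=; rewrite in_itv. Qed.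

Lemma lattice_weight_ge0 m (I : {ffun 'I_k -> 'I_m.+1}) v : cube v ->
  0 <= lattice_weight I v.
Proof. by move=> cv; apply: prodr_ge0 => j _; exact/bweight_ge0/cube_le. Qed.

Lemma sum_lattice_weight m v :
  \sum_(I : {ffun 'I_k -> 'I_m.+1}) lattice_weight I v = 1.
Proof.
rewrite /lattice_weight -(bigA_distr_bigA (fun j (a : 'I_m.+1) => bweight m a (v 0 j))).
by rewrite big1// => j _; exact: sum_bweight.
Qed.

(** The lattice weights form a product law, so the coordinates other than [j] sum to 1 and the
    one-dimensional estimate remains. *)
Lemma sum_lattice_weight_dev m v j : cube v ->
  \sum_(I : {ffun 'I_k -> 'I_m.+2})
    lattice_weight I v * ((I j)%:R / m.+1%:R - v 0 j) ^+ 2 <= m.+1%:R^-1.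
Proof.
move=> cv.
pose F (i : 'I_k) (a : 'I_m.+2) : R := bweight m.+1 a (v 0 i) *
  (if i == j then (a%:R / m.+1%:R - v 0 j) ^+ 2 else 1).
rewrite (eq_bigr (fun I : {ffun 'I_k -> 'I_m.+2} => \prod_i F i (I i))).
  rewrite -bigA_distr_bigA (bigD1 j)//= [X in _ * X]big1 ?mulr1.
    rewrite /F eqxx; apply: sum_bweight_dev; exact: cube_le.
  move=> i ij; rewrite -[RHS](sum_bweight m.+1 (v 0 i)).
  by apply: eq_bigr => a _; rewrite /F (negbTE ij) mulr1.
move=> I _; rewrite /F big_split/=; congr (_ * _).
rewrite (bigD1 j)//= eqxx big1 ?mulr1// => i ij.
by rewrite (negbTE ij).
Qed.

Lemma bernstein_le G (C : R) m v : cube v -> (forall x : 'rV[R]_k, `|G x| <= C) ->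
  `|bernstein G m v| <= C.
Proof.
move=> cv GC; apply: (le_trans (ler_norm_sum _ _ _)).
rewrite -[leRHS]mulr1 -(sum_lattice_weight m v) mulr_sumr.
apply: ler_sum => I _; have w0 := lattice_weight_ge0 I cv.
by rewrite normrM (ger0_norm w0) ler_wpM2r.
Qed.

(* Chebyshev's estimate handles the lattice points which are far from [v]. *)
Lemma bernstein_local G (C e delta : R) m v : cube v -> 0 < delta -> 0 <= e ->
  (forall x : 'rV[R]_k, `|G x| <= C) ->
  (forall x : 'rV[R]_k, (forall j, `|x 0 j - v 0 j| < delta) -> `|G x - G v| <= e) ->
  `|bernstein G m.+1 v - G v| <= e + 2 * C / delta ^+ 2 * k%:R / m.+1%:R.
Proof.
move=> cv d0 e0 GC Gv.
have C0 : 0 <= C by exact: le_trans (GC 0).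
have -> : bernstein G m.+1 v - G v =
    \sum_(I : {ffun 'I_k -> 'I_m.+2}) (G (lattice_point I) - G v) * lattice_weight I v.
  rewrite /bernstein -[X in _ - X]mulr1 -(sum_lattice_weight m.+1 v) mulr_sumr -sumrB.
  by apply: eq_bigr => I _; rewrite mulrBl.
apply: (le_trans (ler_norm_sum _ _ _)).
pose dev (I : {ffun 'I_k -> 'I_m.+2}) j := ((I j)%:R / m.+1%:R - v 0 j) ^+ 2.
have dev0 I j : 0 <= dev I j by exact: sqr_ge0.
have K0 : 0 <= 2 * C / delta ^+ 2 by apply: divr_ge0; [exact: mulr_ge0|exact: sqr_ge0].
apply: (@le_trans _ _ (\sum_(I : {ffun 'I_k -> 'I_m.+2})
    (e * lattice_weight I v + 2 * C / delta ^+ 2 *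
      \sum_j (lattice_weight I v * dev I j)))).
  apply: ler_sum => I _; have w0 := lattice_weight_ge0 I cv.
  have -> : e * lattice_weight I v +
      2 * C / delta ^+ 2 * \sum_j lattice_weight I v * dev I j =
      lattice_weight I v * (e + 2 * C / delta ^+ 2 * \sum_j dev I j).
    by rewrite -mulr_sumr; ring.
  rewrite normrM (ger0_norm w0) [leLHS]mulrC.
  apply: ler_wpM2l => //.
  have [/forallP near|] := boolP [forall j, `|lattice_point I 0 j - v 0 j| < delta].
    apply: (le_trans (Gv _ near)); rewrite lerDl mulr_ge0//.
    by apply: sumr_ge0 => j _.
  rewrite negb_forall => /existsP[j]; rewrite -leNgt => dj.
  apply: (@le_trans _ _ (2 * C)).
    by apply: (le_trans (ler_normB _ _)); rewrite mulr_natl mulr2n lerD.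
  rewrite ler_wpDl// -mulrA ler_peMr ?mulr_ge0//.
  rewrite mulrC ler_pdivlMr ?exprn_gt0// mul1r (bigD1 j)//=.
  rewrite ler_wpDr//; first by apply: sumr_ge0.
  rewrite /dev -[leRHS]real_normK ?num_real// lerXn2r ?nnegrE ?(ltW d0)//.
  by move: dj; rewrite mxE.
rewrite big_split/= -!mulr_sumr sum_lattice_weight mulr1 lerD2l.
rewrite -[leRHS]mulrA; apply: ler_wpM2l => //.
rewrite exchange_big/=.
apply: (@le_trans _ _ (\sum_(j < k) (m.+1%:R^-1 : R))).
  by apply: ler_sum => j _; exact: sum_lattice_weight_dev.
by rewrite sumr_const card_ord -[leLHS]mulr_natl.
Qed.

(** The radius of continuity depends on the point; compactness of the cube, in its near-covering
    form, makes the degree uniform. Half of the radius is spent on moving the centre from [v] to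
    [v'], the other half on the lattice points around [v']. *)
Lemma bernstein_uniform G (C e : R) : continuous G -> (forall x : 'rV[R]_k, `|G x| <= C) ->
  0 < e -> exists m, forall v, cube v -> `|bernstein G m v - G v| <= e.
Proof.
move=> cG GC e0.
have C0 : 0 <= C by exact: le_trans (GC 0).
have cK : compact cube by apply: (@rV_compact R k (fun=> `[0, 1]%classic)) => j; exact: segment_compact.
have : near_covering_within cube.
  by apply/near_covering_withinP/compact_near_coveringP.
move=> /(_ nat \oo (fun m v => `|bernstein G m.+1 v - G v| <= e)).
case=> [v cv|m _ mP]; last first.
  by exists m.+1 => v cv; exact: (mP m (leqnn m) v cv).
have e40 : 0 < e / 4 by rewrite divr_gt0.
have /cvgrPdist_le /(_ _ e40) := cG v.
move=> /nbhs_ballP[dl /= dl0 Hdl].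
have d20 : 0 < dl / 2 by rewrite divr_gt0.
near=> v' m => cv'.
have bv' : ball v (dl / 2) v' by near: v'; exact: nbhsx_ballx.
apply: (le_trans (@bernstein_local G C (e / 2) (dl / 2) m v' cv' d20 _ GC _)).
- by rewrite divr_ge0// ltW.
- move=> x xv'.
  have bx : ball v dl x.
    split=> // i j; rewrite (ord1 i).
    have := bv'; move=> [_ /(_ 0 j)] /=; rewrite /ball/= => h1.
    have := xv' j; rewrite distrC => h2.
    rewrite (_ : dl = dl / 2 + dl / 2); last by field.
    by rewrite -[X in `|X|](subrKA (v' 0 j)) (le_lt_trans (ler_normD _ _))// ltrD.
  have bv'' : ball v dl v'.
    by apply: le_ball bv'; lra.
  have h1 := Hdl _ bx; have h2 := Hdl _ bv''.
  rewrite -[X in `|X|](subrKA (G v)) (le_trans (ler_normD _ _))//.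
  rewrite (distrC (G x)); rewrite /= in h1 h2.
  by apply: (le_trans (lerD h1 h2)); lra.
- set K := 2 * C / (dl / 2) ^+ 2 * k%:R.
  have K0 : 0 <= K by rewrite mulr_ge0// divr_ge0 ?mulr_ge0 ?exprn_ge0// ltW.
  rewrite [leRHS](_ : e = e / 2 + e / 2); last by field.
  rewrite lerD2l ler_pdivrMr ?ltr0n// -ler_pdivrMl ?divr_gt0//.
  apply: (@le_trans _ _ m%:R); last by rewrite ler_nat.
  near: m; exact: nbhs_infty_ger.
Unshelve. all: by end_near. Qed.

End Bernstein.

Section TrigPolynomials.
Context {R : realType} {k : nat}.
Implicit Types (u z : 'rV[R]_k) (f g : 'rV[R]_k -> R).

Definition rdot u z : R := (u *m z^T) 0 0.

Lemma rdotE u z : rdot u z = \sum_j u 0 j * z 0 j.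
Proof. by rewrite /rdot mxE; apply: eq_bigr => j _; rewrite mxE. Qed.

Lemma rdotDl u v z : rdot (u + v) z = rdot u z + rdot v z.
Proof. by rewrite /rdot mulmxDl mxE. Qed.

Lemma rdotNl u z : rdot (- u) z = - rdot u z.
Proof. by rewrite /rdot mulNmx mxE. Qed.

(** Free phases make the sines and, at frequency 0, the constants into cosines, so linear
    combinations form an algebra by the product-to-sum formulas. The inductive form lets convergence
    of cosines extend by induction. *)
Inductive trig_poly : ('rV[R]_k -> R) -> Prop :=
| trig_cos u (theta : R) : trig_poly (fun z => cos (rdot u z + theta))
| trig_add f g : trig_poly f -> trig_poly g -> trig_poly (fun z => f z + g z)
| trig_scale (c : R) f : trig_poly f -> trig_poly (fun z => c * f z).

Lemma trig_cst (c : R) : trig_poly (fun=> c).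
Proof.
have := trig_scale c (trig_cos 0 0); congr trig_poly; apply/funext => z.
by rewrite /rdot mul0mx mxE addr0 cos0 mulr1.
Qed.

Lemma trig_mul f g : trig_poly f -> trig_poly g -> trig_poly (fun z => f z * g z).
Proof.
elim=> {f} [u t|f1 f2 _ IH1 _ IH2|c f _ IH] Hg; last 2 first.
- have := trig_add (IH1 Hg) (IH2 Hg); congr trig_poly; apply/funext => z.
  by rewrite mulrDl.
- have := trig_scale c (IH Hg); congr trig_poly; apply/funext => z.
  by rewrite mulrA.
elim: Hg => {g} [v s|g1 g2 _ IH1 _ IH2|c g _ IH]; last 2 first.
- have := trig_add IH1 IH2; congr trig_poly; apply/funext => z.
  by rewrite mulrDr.
- have := trig_scale c IH; congr trig_poly; apply/funext => z.
  by rewrite mulrCA.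
have := trig_scale 2^-1 (trig_add (trig_cos (u - v) (t - s)) (trig_cos (u + v) (t + s))).
congr trig_poly; apply/funext => z.
rewrite rdotDl rdotNl (rdotDl u v).
rewrite (_ : rdot u z - rdot v z + (t - s) = (rdot u z + t) - (rdot v z + s)); last by ring.
rewrite (_ : rdot u z + rdot v z + (t + s) = (rdot u z + t) + (rdot v z + s)); last by ring.
move: (rdot u z + t) (rdot v z + s) => A B; by rewrite cosB cosD; field.
Qed.

Lemma trig_sum (I : Type) (s : seq I) (F : I -> 'rV[R]_k -> R) :
  (forall i, trig_poly (F i)) -> trig_poly (fun z => \sum_(i <- s) F i z).
Proof.
move=> HF; elim: s => [|i s IHs].
  by under eq_fun do rewrite big_nil; exact: trig_cst.
by under eq_fun do rewrite big_cons; exact: trig_add.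
Qed.

Lemma trig_prod (I : Type) (s : seq I) (F : I -> 'rV[R]_k -> R) :
  (forall i, trig_poly (F i)) -> trig_poly (fun z => \prod_(i <- s) F i z).
Proof.
move=> HF; elim: s => [|i s IHs].
  by under eq_fun do rewrite big_nil; exact: trig_cst.
by under eq_fun do rewrite big_cons; exact: trig_mul.
Qed.

(** A map of the whole space into the cube whose coordinates are trigonometric polynomials:
    composing a Bernstein polynomial with it yields a trigonometric polynomial. *)
Definition wave (c : R) z : 'rV[R]_k := \row_j ((1 + sin (c * z 0 j)) / 2).

Lemma wave_cube c z : cube (wave c z).
Proof.
move=> j /=; rewrite mxE in_itv/=.
by have := sin_le1 (c * z 0 j); have := sin_geN1 (c * z 0 j); lra.
Qed.

Lemma trig_wave c j : trig_poly (fun z => wave c z 0 j).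
Proof.
have := trig_scale 2^-1 (trig_add (trig_cst 1) (trig_cos (c *: delta_mx 0 j) (- (pi / 2)))).
congr trig_poly; apply/funext => z; rewrite mxE mulrC; congr ((_ + _) / _).
rewrite cosBpihalf; congr sin; rewrite rdotE (bigD1 j)//= big1 ?addr0.
  by rewrite !mxE !eqxx mulr1.
by move=> i ij; rewrite !mxE eqxx/= (negbTE ij) mulr0 mul0r.
Qed.

Lemma trig_bweight c j m i : trig_poly (fun z => bweight m i (wave c z 0 j)).
Proof.
elim: m i => [|m IHm] i /=; first exact: trig_cst.
apply: trig_add; apply: trig_mul => //.
- by apply: trig_add; [exact: trig_cst|have := trig_scale (-1) (trig_wave c j);
    congr trig_poly; apply/funext => z; rewrite mulN1r].
- exact: trig_wave.
- by case: i => [|i]; [exact: trig_cst|exact: IHm].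
Qed.

Lemma trig_bernstein c G m : trig_poly (fun z => bernstein G m (wave c z)).
Proof.
apply: trig_sum => I; apply: trig_scale; apply: trig_prod => j.
exact: trig_bweight.
Qed.

(** At frequency [1 / L] a point of the cube of half-side [L] has angles at most 1 in absolute
    value, whose sines stay within [s1 < 1]. Clamping to this range keeps the argument of [asin]
    away from the endpoints, so that [unwave] is continuous everywhere. *)
Let s1 : R := sin 1.

Let s1_lt1 : s1 < 1.
Proof.
rewrite lt_neqAle sin_le1 andbT; apply/eqP => s11.
have := cos2Dsin2 (1 : R); rewrite -/s1 s11 expr1n => /eqP.
rewrite -[X in _ == X]add0r (inj_eq (addIr _)) expf_eq0/= => /eqP c0.
by have := @cos1_gt0 R; rewrite c0 ltxx.
Qed.

Let s1_gt0 : 0 < s1.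
Proof. by apply: sin2_gt0; rewrite ltr01/= ltr1n. Qed.

Let clamp (x : R) : R := Num.max (- s1) (Num.min s1 x).

Let clamp_bnd x : - s1 <= clamp x <= s1.
Proof.
rewrite /clamp le_max lexx/= ge_max ge_min lexx/= andbT.
by rewrite (@le_trans _ _ 0)// ?oppr_le0 ltW.
Qed.

Let clampK x : - s1 <= x <= s1 -> clamp x = x.
Proof. by move=> /andP[h1 h2]; rewrite /clamp min_r// max_r. Qed.

(* a left inverse of [wave L^-1] on the cube of half-side [L] *)
Let unwave (L : R) (y : 'rV[R]_k) : 'rV[R]_k :=
  \row_j (L * asin (clamp (2 * y 0 j - 1))).

Let waveK (L : R) z : 0 < L -> (forall j, `|z 0 j| <= L) ->
  unwave L (wave L^-1 z) = z.
Proof.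
move=> L0 zL; apply/rowP => j; rewrite !mxE.
have -> : 2 * ((1 + sin (L^-1 * z 0 j)) / 2) - 1 = sin (L^-1 * z 0 j) by field.
have y1 : - 1 <= L^-1 * z 0 j <= 1.
  by rewrite -ler_norml normrM gtr0_norm ?invr_gt0// ler_pdivrMl// mulr1.
have /andP[yl yr] := y1.
have p1 : 1 <= pi / 2 :> R by exact: pihalf_ge1.
have y2 : L^-1 * z 0 j \in `[- (pi / 2), pi / 2].
  by rewrite in_itv/=; apply/andP; split; lra.
have i1 : (1 : R) \in `[- (pi / 2), pi / 2] by rewrite in_itv/=; apply/andP; split; lra.
have iN1 : (- 1 : R) \in `[- (pi / 2), pi / 2] by rewrite in_itv/=; apply/andP; split; lra.
have lesin (a b : R) : a \in `[- (pi / 2), pi / 2] -> b \in `[- (pi / 2), pi / 2] ->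
    a <= b -> sin a <= sin b.
  by move=> ha hb; rewrite le_eqVlt => /predU1P[->//|ab]; apply: ltW; rewrite ltr_sin.
rewrite clampK ?sinK// ?mulVKf ?gt_eqF//.
by rewrite /s1 -sinN !lesin.
Qed.

Let continuous_unwave L : continuous (unwave L).
Proof.
move=> y A /= /nbhs_ballP[e /= e0 eA].
have FF : Filter (nbhs y) := nbhs_filter (y : 'rV[R]_k).
suff H j : \forall y' \near y, ball ((unwave L y) 0 j) e ((unwave L y') 0 j).
  have := filter_forall (nbhs_filter (y : 'rV[R]_k)) H.
  by apply: filterS => y' Hy'; apply: eA; split => // i j; rewrite (ord1 i).
have cj : {for y, continuous (fun y' : 'rV[R]_k => unwave L y' 0 j)}.
  rewrite (_ : (fun y' : 'rV[R]_k => unwave L y' 0 j) =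
      fun y' => L * asin (clamp (2 * y' 0 j - 1))); last first.
    by apply/funext => y'; rewrite mxE.
  apply: cvgM; first exact: cvg_cst.
  apply: (@continuous_comp _ _ _ (fun y' : 'rV[R]_k => clamp (2 * y' 0 j - 1)) asin).
    have c1 : {for y, continuous (fun y' : 'rV[R]_k => 2 * y' 0 j - 1)}.
      apply: cvgB; last exact: cvg_cst.
      by apply: cvgM; [exact: cvg_cst|exact: coord_continuous].
    apply: (@continuous_max _ _ (fun=> - s1) (fun y' : 'rV[R]_k => Num.min s1 (2 * y' 0 j - 1))).
      exact: cvg_cst.
    apply: (@continuous_min _ _ (fun=> s1) (fun y' : 'rV[R]_k => 2 * y' 0 j - 1)) => //.
    exact: cvg_cst.
  apply: continuous_asin; have /andP[h1 h2] := clamp_bnd (2 * y 0 j - 1).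
  by rewrite (lt_le_trans _ h1) ?ltrN2//= (le_lt_trans h2).
by have := cj; move=> /cvg_ballP /(_ e e0).
Qed.

(* Substituting bounded waves for the variables of a Bernstein polynomial preserves
   the bound of [g] on the whole space, not only on the cube. *)
Lemma trig_approximation g (C e L : R) : continuous g -> (forall z, `|g z| <= C) ->
  0 < e -> 0 < L -> exists t, [/\ trig_poly t, forall z, `|t z| <= C &
    forall z, (forall j, `|z 0 j| <= L) -> `|t z - g z| <= e].
Proof.
move=> cg gC e0 L0; pose G := g \o unwave L.
have cG : continuous G.
  by move=> y; apply: continuous_comp; [exact: continuous_unwave|exact: cg].
have GC y : `|G y| <= C by exact: gC.
have [m Hm] := bernstein_uniform cG GC e0.
exists (fun z => bernstein G m (wave L^-1 z)); split.
- exact: trig_bernstein.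
- by move=> z; apply: bernstein_le => //; exact: wave_cube.
- move=> z zL; have := Hm _ (wave_cube L^-1 z).
  by rewrite {2}/G /= waveK.
Qed.

End TrigPolynomials.

(** * Convergence in distribution and stochastic orders *)

Section Tail.
Context {R : realType} {d : measure_display} {T : measurableType d}.
Variable P : probability T R.

Lemma Ex_indic A : measurable A -> \int[P]_w (\1_A w : R) = fine (P A).
Proof. by move=> mA; rewrite /Rintegral integral_indic// setIT. Qed.

Lemma prob_fine_le (A : set T) (e : R) : measurable A -> (P A <= e%:E)%E -> fine (P A) <= e.
Proof. by move=> mA PA; rewrite -lee_fin fineK// fin_num_measure. Qed.

Lemma tail_small (X : T -> R) (e : R) : measurable_fun setT X -> 0 < e ->
  exists n : nat, (P [set w | (n%:R < `|X w|)%R] <= e%:E)%E.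
Proof.
move=> mX e0; pose F n := [set w | n%:R < `|X w|].
have mF n : measurable (F n).
  rewrite -[X in measurable X]setTI.
  by apply: measurable_fun_ltr => //; exact: measurableT_comp.
have cap0 : \bigcap_n F n = set0.
  apply/seteqP; split => // w /(_ (Num.truncn `|X w|).+1 I) /=.
  by rewrite /F /= => /lt_trans /(_ (truncnS_gt _)); rewrite ltxx.
have := @nonincreasing_cvg_mu _ T R P F.
rewrite cap0 measure0 => /(_ _ mF measurable0) H.
have {}H : (P \o F) x @[x --> \oo] --> 0%E.
  apply: H.
    by rewrite -ge0_fin_numE//; exact: fin_num_measure.
  move=> a b ab; apply/subsetPset => w; rewrite /F /=.
  by apply: le_lt_trans; rewrite ler_nat.
move/fine_cvgP : H => [_ /cvgrPdist_le /(_ e e0)] [n _ /(_ n (leqnn n))] /=.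
rewrite sub0r normrN => H; exists n.
rewrite -/(F n) -(fineK (fin_num_measure P (F n) (mF n))) lee_fin.
exact: le_trans (ler_norm _) H.
Qed.

Lemma tail_small_fin (I : finType) (X : I -> T -> R) (e : R) :
  (forall i, measurable_fun setT (X i)) -> 0 < e ->
  exists K : R, exists A, [/\ measurable A, (P A <= e%:E)%E &
    forall w, ~ A w -> forall i, `|X i w| <= K].
Proof.
move=> mX e0; pose Y w := \sum_i `|X i w|.
have mY : measurable_fun setT Y.
  by apply: measurable_sum => i; exact: measurableT_comp.
have [n Hn] := tail_small mY e0.
exists n%:R, [set w | (n%:R < `|Y w|)%R]; split => //.
  rewrite -[X in measurable X]setTI.
  by apply: measurable_fun_ltr => //; exact: measurableT_comp.
move=> w /= /negP; rewrite -leNgt => H i; apply: le_trans H.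
have Y0 : 0 <= Y w by rewrite /Y; exact: sumr_ge0.
rewrite (ger0_norm Y0) /Y.
by rewrite (bigD1 i)//= lerDl; exact: sumr_ge0.
Qed.

End Tail.

Section DistributionCriterion.
Context {R : realType} {k : nat}.

Section OneSpace.
Context {d : measure_display} {T : measurableType d}.
Variables (P : probability T R) (X : T -> 'rV[R]_k).
Hypothesis mX : forall i, measurable_fun setT (fun w => X w 0 i).

Lemma measurable_rdot (u : 'rV[R]_k) : measurable_fun setT (fun w => rdot u (X w)).
Proof.
under eq_fun do rewrite rdotE.
by apply: measurable_sum => j; exact: measurable_funM.
Qed.

Lemma trig_poly_L1 t : trig_poly t -> L1 P (fun w => t (X w)).
Proof.
elim=> {t} [u theta|f g _ IH1 _ IH2|c f _ IH].
- by apply: L1_cos; apply: measurable_funD => //; exact: measurable_rdot.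
- exact: L1D.
- exact: L1Zl.
Qed.

(** Only the coordinates of [X] are known to be measurable. On growing cubes [g] is approximated by
    trigonometric polynomials of these coordinates, and [g (X w)] is their pointwise limit. *)
Lemma measurable_continuous_comp (g : 'rV[R]_k -> R) (C : R) : continuous g ->
  (forall z, `|g z| <= C) -> measurable_fun setT (fun w => g (X w)).
Proof.
move=> cg gC.
have /choice[t Ht] (n : nat) : exists t, [/\ @trig_poly R k t, forall z, `|t z| <= C &
    forall z : 'rV[R]_k, (forall j, `|z 0 j| <= n.+1%:R) -> `|t z - g z| <= n.+1%:R^-1].
  by apply: trig_approximation.
apply: (@measurable_fun_cvg _ _ _ _ (fun n w => t n (X w))).
  by move=> n; apply: (L1_measurable (P := P)); apply: trig_poly_L1; case: (Ht n).
move=> w _; apply/cvgrPdist_le => e e0.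
near=> n; rewrite distrC; have [_ _ Hn] := Ht n.
apply: (@le_trans _ _ n.+1%:R^-1).
  apply: Hn; near: n; apply: filter_forall => j.
  near=> n; apply: (@le_trans _ _ n%:R); last by rewrite ler_nat.
  near: n; exact: nbhs_infty_ger.
near: n; have := near_infty_natSinv_lt (PosNum e0); apply: filterS => n; exact: ltW.
Unshelve. all: by end_near. Qed.

Lemma Ex_trig_approx (g t : 'rV[R]_k -> R) (C e : R) (A : set T) :
  0 <= C -> 0 <= e -> measurable A ->
  continuous g -> (forall z, `|g z| <= C) -> trig_poly t ->
  (forall z, `|t z| <= C) ->
  (forall w, ~ A w -> `|t (X w) - g (X w)| <= e) ->
  `|\int[P]_w g (X w) - \int[P]_w t (X w)| <= e + 2 * C * fine (P A).
Proof.
move=> C0 e0 mA cg gC tt tC Htg.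
have Lg : L1 P (fun w => g (X w)).
  by apply: (@L1_bounded _ _ _ _ _ C) => //; exact: measurable_continuous_comp gC.
have Lt := trig_poly_L1 tt.
have LA : L1 P (\1_A : T -> R) by exact: integrable_indic.
rewrite -ExB// -(Ex_indic _ mA) -(Ex_cst P e) -ExZl// -ExD//; last 2 first.
- exact: L1_cst.
- exact: L1Zl.
apply: Ex_norm_le; [exact: L1B|by apply: L1D; [exact: L1_cst|exact: L1Zl]|].
move=> w; rewrite indicE; have [Aw|nAw] := pselect (A w).
  rewrite mem_set// mulr1 (le_trans (ler_normB _ _))// ler_wpDl//.
  by rewrite mulr_natl mulr2n lerD.
by rewrite memNset// mulr0 addr0 distrC; exact: Htg.
Qed.

End OneSpace.

Context {d d' : measure_display} {T : measurableType d} {T' : measurableType d'}.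
Variables (P : probability T R) (P' : probability T' R)
  (Z : nat -> T -> 'rV[R]_k) (Q : T' -> 'rV[R]_k).
(** Measurability is asked only eventually: a grid is constrained only for [n > 0], so nothing
    places the points of the grid of index 0 in the time interval. *)
Hypothesis mZ : \forall n \near \oo, forall i, measurable_fun setT (fun w => Z n w 0 i).
Hypothesis mQ : forall i, measurable_fun setT (fun w => Q w 0 i).
Hypothesis cos_cvg : forall u theta,
  \int[P]_w cos (rdot u (Z n w) + theta) @[n --> \oo] -->
  \int[P']_w cos (rdot u (Q w) + theta).
Hypothesis tight : forall e : R, 0 < e -> exists L : R, \forall n \near \oo,
  exists A, [/\ measurable A, (P A <= e%:E)%E &
    forall w, ~ A w -> forall j, `|Z n w 0 j| <= L].

Lemma trig_poly_cvg t : trig_poly t ->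
  \int[P]_w t (Z n w) @[n --> \oo] --> \int[P']_w t (Q w).
Proof.
elim=> {t} [u theta|f g tf IH1 tg IH2|c f tf IH].
- exact: cos_cvg.
- rewrite ExD; [|exact: trig_poly_L1..].
  apply: cvg_trans (cvgD IH1 IH2); apply: near_eq_cvg.
  by apply: filterS mZ => n mZn; rewrite ExD//; exact: trig_poly_L1.
- rewrite ExZl; last exact: trig_poly_L1.
  apply: cvg_trans (cvgM (cvg_cst c) IH); apply: near_eq_cvg.
  by apply: filterS mZ => n mZn; rewrite ExZl//; exact: trig_poly_L1.
Qed.

Lemma trig_cvg_in_distribution : cvg_in_distribution P P' Z Q.
Proof.
move=> g cg [C gC].
have C0 : 0 <= C by exact: le_trans (gC 0).
have LQ : L1 P' (fun w => g (Q w)).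
  by apply: (@L1_bounded _ _ _ _ _ C) => //; exact: measurable_continuous_comp gC.
have LZ n : (forall i, measurable_fun setT (fun w => Z n w 0 i)) -> L1 P (fun w => g (Z n w)).
  move=> mZn; apply: (@L1_bounded _ _ _ _ _ C) => //.
  exact: measurable_continuous_comp gC.
have goalR : \int[P]_w g (Z n w) @[n --> \oo] --> \int[P']_w g (Q w).
  apply/cvgrPdist_le => e e0.
  (* Replacing [g] by [t] costs [(1 + 2 C) e1] for each of the two laws, and the convergence for [t]
     costs [e1]; the denominator exceeds this total. *)
  pose e1 := e / (4 * (1 + 2 * C) + 1).
  have den : 0 < 4 * (1 + 2 * C) + 1 by lra.
  have e10 : 0 < e1 by rewrite divr_gt0.
  have [L HL] := tight e10.
  have [L' [A' [mA' PA' HA']]] := tail_small_fin P' mQ e10.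
  pose L0 := `|L| + `|L'| + 1.
  have L00 : 0 < L0 by rewrite ltr_wpDl// addr_ge0.
  have [t [tt tC tg]] := trig_approximation cg gC e10 L00.
  have /cvgrPdist_le /(_ e1 e10) Ht := trig_poly_cvg tt.
  have HQ : `|\int[P']_w g (Q w) - \int[P']_w t (Q w)| <= e1 + 2 * C * e1.
    apply: (le_trans (@Ex_trig_approx _ _ P' Q mQ g t C e1 A' C0 _ mA' cg gC tt tC _)).
    - exact: ltW.
    - move=> w /HA' Hw; apply: tg => j; apply: (le_trans (Hw j)).
      by rewrite /L0; have := ler_norm L'; have := normr_ge0 L; lra.
    - by rewrite lerD2l ler_wpM2l ?mulr_ge0// prob_fine_le.
  near=> n.
  have mZn : forall i, measurable_fun setT (fun w => Z n w 0 i) by near: n.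
  have [A [mA PA HA]] : exists A, [/\ measurable A, (P A <= e1%:E)%E &
    forall w, ~ A w -> forall j, `|Z n w 0 j| <= L] by near: n.
  have HZ : `|\int[P]_w g (Z n w) - \int[P]_w t (Z n w)| <= e1 + 2 * C * e1.
    apply: (le_trans (@Ex_trig_approx _ _ P (Z n) mZn g t C e1 A C0 _ mA cg gC tt tC _)).
    - exact: ltW.
    - move=> w /HA Hw; apply: tg => j; apply: (le_trans (Hw j)).
      by rewrite /L0; have := ler_norm L; have := normr_ge0 L'; lra.
    - by rewrite lerD2l ler_wpM2l ?mulr_ge0// prob_fine_le.
  have Htn : `|\int[P']_w t (Q w) - \int[P]_w t (Z n w)| <= e1 by near: n.
  have -> : \int[P']_w g (Q w) - \int[P]_w g (Z n w) =
    (\int[P']_w g (Q w) - \int[P']_w t (Q w)) +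
    (\int[P']_w t (Q w) - \int[P]_w t (Z n w)) -
    (\int[P]_w g (Z n w) - \int[P]_w t (Z n w)) by ring.
  apply: (le_trans (ler_normB _ _)).
  apply: (le_trans (lerD (ler_normD _ _) (lexx _))).
  apply: (le_trans (lerD (lerD HQ Htn) HZ)).
  have -> : e = e1 * (4 * (1 + 2 * C) + 1) by rewrite /e1; field; rewrite gt_eqF.
  by have Ce : 0 <= C * e1 by [rewrite mulr_ge0// ltW]; lra.
rewrite unlock Ex_EFin//.
apply/fine_cvgP; split; last exact: goalR.
apply: filterS mZ => n mZn.
by apply: integrable_fin_num => //; exact: LZ.
Unshelve. all: by end_near. Qed.

End DistributionCriterion.

Section StochasticOrder.
Context {R : realType} {d : measure_display} {T : measurableType d}.
Variable P : probability T R.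
Implicit Types X Y : nat -> T -> R.

(* The exceptional events are allowed to be larger than the events of interest,
   so that no measurability is required of the variables. *)
Definition oP X := forall e : R, 0 < e -> \forall n \near \oo,
  exists A, [/\ measurable A, (P A <= e%:E)%E & forall w, ~ A w -> `|X n w| <= e].

Definition OP X := forall e : R, 0 < e -> exists K : R, \forall n \near \oo,
  exists A, [/\ measurable A, (P A <= e%:E)%E & forall w, ~ A w -> `|X n w| <= K].

Let P_setU (A B : set T) (a b : R) : measurable A -> measurable B ->
  (P A <= a%:E)%E -> (P B <= b%:E)%E -> (P (A `|` B) <= (a + b)%:E)%E.
Proof.
move=> mA mB PA PB; apply: (le_trans (measureU2 _ mA mB)).
by rewrite EFinD; exact: leeD.
Qed.

Lemma oP_le X Y : (\forall n \near \oo, forall w, `|X n w| <= `|Y n w|) -> oP Y -> oP X.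
Proof.
move=> XY oY e e0; near=> n.
have [A [mA PA HA]] : exists A, [/\ measurable A, (P A <= e%:E)%E &
  forall w, ~ A w -> `|Y n w| <= e] by near: n; exact: oY.
have XYn : forall w, `|X n w| <= `|Y n w| by near: n.
by exists A; split => // w /HA; exact: le_trans.
Unshelve. all: by end_near. Qed.

Lemma oP_eq X Y : (\forall n \near \oo, forall w, X n w = Y n w) -> oP Y -> oP X.
Proof. by move=> XY; apply: oP_le; apply: filterS XY => n E w; rewrite E. Qed.

Lemma OP_eq X Y : (\forall n \near \oo, forall w, X n w = Y n w) -> OP Y -> OP X.
Proof.
move=> XY OY e e0; have [K HK] := OY e e0; exists K; near=> n.
have [A [mA PA HA]] : exists A, [/\ measurable A, (P A <= e%:E)%E &
  forall w, ~ A w -> `|Y n w| <= K] by near: n.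
have XYn : forall w, X n w = Y n w by near: n.
by exists A; split => // w /HA; rewrite XYn.
Unshelve. all: by end_near. Qed.

Lemma oPD X Y : oP X -> oP Y -> oP (fun n w => X n w + Y n w).
Proof.
move=> oX oY e e0; have e20 : 0 < e / 2 by rewrite divr_gt0.
near=> n.
have [A [mA PA HA]] : exists A, [/\ measurable A, (P A <= (e / 2)%:E)%E &
  forall w, ~ A w -> `|X n w| <= e / 2] by near: n; exact: oX.
have [B [mB PB HB]] : exists A, [/\ measurable A, (P A <= (e / 2)%:E)%E &
  forall w, ~ A w -> `|Y n w| <= e / 2] by near: n; exact: oY.
exists (A `|` B); split.
- exact: measurableU.
- by have := P_setU mA mB PA PB; rewrite -splitr.
- move=> w /not_orP[/HA h1 /HB h2]; apply: (le_trans (ler_normD _ _)).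
  by rewrite [leRHS]splitr lerD.
Unshelve. all: by end_near. Qed.

Lemma OPD X Y : OP X -> OP Y -> OP (fun n w => X n w + Y n w).
Proof.
move=> oX oY e e0; have e20 : 0 < e / 2 by rewrite divr_gt0.
have [K HK] := oX _ e20; have [L HL] := oY _ e20.
exists (K + L); near=> n.
have [A [mA PA HA]] : exists A, [/\ measurable A, (P A <= (e / 2)%:E)%E &
  forall w, ~ A w -> `|X n w| <= K] by near: n.
have [B [mB PB HB]] : exists A, [/\ measurable A, (P A <= (e / 2)%:E)%E &
  forall w, ~ A w -> `|Y n w| <= L] by near: n.
exists (A `|` B); split.
- exact: measurableU.
- by have := P_setU mA mB PA PB; rewrite -splitr.
- move=> w /not_orP[/HA h1 /HB h2]; apply: (le_trans (ler_normD _ _)).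
  by rewrite lerD.
Unshelve. all: by end_near. Qed.

Lemma OP_oPM X Y : OP X -> oP Y -> oP (fun n w => X n w * Y n w).
Proof.
move=> oX oY e e0; have e20 : 0 < e / 2 by rewrite divr_gt0.
have [K HK] := oX _ e20.
have K1 : 0 < `|K| + 1 by rewrite ltr_wpDl.
pose e' := Num.min (e / 2) (e / (`|K| + 1)).
have e'0 : 0 < e' by rewrite lt_min e20 divr_gt0.
near=> n.
have [A [mA PA HA]] : exists A, [/\ measurable A, (P A <= (e / 2)%:E)%E &
  forall w, ~ A w -> `|X n w| <= K] by near: n.
have [B [mB PB HB]] : exists A, [/\ measurable A, (P A <= e'%:E)%E &
  forall w, ~ A w -> `|Y n w| <= e'] by near: n; exact: oY.
have PB' : (P B <= (e / 2)%:E)%E.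
  by apply: (le_trans PB); rewrite lee_fin /e' ge_min lexx.
exists (A `|` B); split.
- exact: measurableU.
- by have := P_setU mA mB PA PB'; rewrite -splitr.
- move=> w /not_orP[/HA h1 /HB h2]; rewrite normrM.
  apply: (@le_trans _ _ ((`|K| + 1) * (e / (`|K| + 1)))).
    apply: ler_pM => //.
      by apply: (le_trans h1); apply: (le_trans (ler_norm K)); rewrite lerDl.
    by apply: (le_trans h2); rewrite /e' ge_min lexx orbT.
  by rewrite mulrCA divff ?mulr1// gt_eqF.
Unshelve. all: by end_near. Qed.

Lemma OPM X Y : OP X -> OP Y -> OP (fun n w => X n w * Y n w).
Proof.
move=> oX oY e e0; have e20 : 0 < e / 2 by rewrite divr_gt0.
have [K HK] := oX _ e20; have [L HL] := oY _ e20.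
exists (K * L); near=> n.
have [A [mA PA HA]] : exists A, [/\ measurable A, (P A <= (e / 2)%:E)%E &
  forall w, ~ A w -> `|X n w| <= K] by near: n.
have [B [mB PB HB]] : exists A, [/\ measurable A, (P A <= (e / 2)%:E)%E &
  forall w, ~ A w -> `|Y n w| <= L] by near: n.
exists (A `|` B); split.
- exact: measurableU.
- by have := P_setU mA mB PA PB; rewrite -splitr.
- move=> w /not_orP[/HA h1 /HB h2]; rewrite normrM.
  by rewrite ler_pM.
Unshelve. all: by end_near. Qed.

Lemma oP_OP X : oP X -> OP X.
Proof.
move=> oX e e0; exists e; exact: oX.
Qed.

Lemma oP_deterministic (x : nat -> R) : x n @[n --> \oo] --> 0 -> oP (fun n _ => x n).
Proof.
move=> /cvgrPdist_le cx e e0; have := cx e e0; apply: filterS => n.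
rewrite sub0r normrN => xn; exists set0; split => //.
by rewrite measure0 lee_fin ltW.
Qed.

Lemma OP_cst (c : R) : OP (fun _ _ => c).
Proof.
move=> e e0; exists `|c|; apply: nearW => n; exists set0; split => //.
by rewrite measure0 lee_fin ltW.
Qed.

Lemma oPZl (c : R) X : oP X -> oP (fun n w => c * X n w).
Proof. exact: OP_oPM (OP_cst c). Qed.

Lemma OPZl (c : R) X : OP X -> OP (fun n w => c * X n w).
Proof. exact: OPM (OP_cst c). Qed.

Lemma oPN X : oP X -> oP (fun n w => - X n w).
Proof. by apply: oP_le; apply: nearW => n w; rewrite normrN. Qed.

Lemma oPB X Y : oP X -> oP Y -> oP (fun n w => X n w - Y n w).
Proof. by move=> oX /oPN; exact: oPD. Qed.

Lemma oP0 : oP (fun _ _ => 0).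
Proof. by apply: oP_deterministic; exact: cvg_cst. Qed.

Lemma oP_sum (I : eqType) (s : seq I) (Q : pred I) (X : I -> nat -> T -> R) :
  (forall i, i \in s -> Q i -> oP (X i)) -> oP (fun n w => \sum_(i <- s | Q i) X i n w).
Proof.
move=> oX; elim: s oX => [|i s IHs] oX.
  by apply: oP_eq oP0; apply: nearW => n w; rewrite big_nil.
have oXs : oP (fun n w => \sum_(j <- s | Q j) X j n w).
  by apply: IHs => j js; apply: oX; rewrite in_cons js orbT.
have [Qi|nQi] := boolP (Q i).
  apply: oP_eq (oPD (oX i (mem_head _ _) Qi) oXs).
  by apply: nearW => n w; rewrite big_cons Qi.
by apply: oP_eq oXs; apply: nearW => n w; rewrite big_cons (negbTE nQi).
Qed.

Lemma OP_sum (I : eqType) (s : seq I) (Q : pred I) (X : I -> nat -> T -> R) :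
  (forall i, i \in s -> Q i -> OP (X i)) -> OP (fun n w => \sum_(i <- s | Q i) X i n w).
Proof.
move=> oX; elim: s oX => [|i s IHs] oX.
  by apply: OP_eq (OP_cst 0); apply: nearW => n w; rewrite big_nil.
have oXs : OP (fun n w => \sum_(j <- s | Q j) X j n w).
  by apply: IHs => j js; apply: oX; rewrite in_cons js orbT.
have [Qi|nQi] := boolP (Q i).
  apply: OP_eq (OPD (oX i (mem_head _ _) Qi) oXs).
  by apply: nearW => n w; rewrite big_cons Qi.
by apply: OP_eq oXs; apply: nearW => n w; rewrite big_cons (negbTE nQi).
Qed.

(** Slutsky's argument for one cosine: it is 1-Lipschitz off the exceptional event, and two cosines
    differ by at most 2 on it. *)
Lemma Ex_cos_oP X Y (l theta : R) :
  (\forall n \near \oo, measurable_fun setT (X n)) ->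
  (\forall n \near \oo, measurable_fun setT (Y n)) ->
  oP (fun n w => X n w - Y n w) ->
  \int[P]_w cos (Y n w + theta) @[n --> \oo] --> l ->
  \int[P]_w cos (X n w + theta) @[n --> \oo] --> l.
Proof.
move=> mX mY oXY; rewrite -[l in X in _ -> X]add0r => cY.
suff H : \int[P]_w cos (X n w + theta) - \int[P]_w cos (Y n w + theta) @[n --> \oo] --> 0.
  apply: cvg_trans (cvgD H cY); apply: near_eq_cvg.
  by apply: nearW => n; rewrite subrK.
apply/cvgrPdist_le => e e0; have e30 : 0 < e / 3 by rewrite divr_gt0.
near=> n; rewrite sub0r normrN.
have mXn : measurable_fun setT (X n) by near: n.
have mYn : measurable_fun setT (Y n) by near: n.
have [A [mA PA HA]] : exists A, [/\ measurable A, (P A <= (e / 3)%:E)%E &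
  forall w, ~ A w -> `|X n w - Y n w| <= e / 3] by near: n; exact: oXY.
have LX : L1 P (fun w => cos (X n w + theta)) by apply: L1_cos; exact: measurable_funD.
have LY : L1 P (fun w => cos (Y n w + theta)) by apply: L1_cos; exact: measurable_funD.
have LA : L1 P (\1_A : T -> R) by exact: integrable_indic.
rewrite -ExB//; apply: (@le_trans _ _ (\int[P]_w (e / 3 + 2 * \1_A w))).
  apply: Ex_norm_le; [exact: L1B|by apply: L1D; [exact: L1_cst|exact: L1Zl]|].
  move=> w; rewrite indicE; have [Aw|nAw] := pselect (A w).
    rewrite mem_set// mulr1 (le_trans (ler_normB _ _))//.
    have := cos_max (X n w + theta); have := cos_max (Y n w + theta).
    by move=> ? ?; lra.
  rewrite memNset// mulr0 addr0; apply: (le_trans (cosB_le _ _)).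
  by rewrite opprD addrACA subrr addr0; exact: HA.
rewrite ExD//; [|exact: L1_cst|exact: L1Zl].
rewrite Ex_cst ExZl// Ex_indic//.
have : fine (P A) <= e / 3 by rewrite -lee_fin fineK// fin_num_measure.
by lra.
Unshelve. all: by end_near. Qed.

Lemma OP_L2 X (K : R) : (\forall n \near \oo, L2 P (X n)) ->
  (\forall n \near \oo, \int[P]_w (X n w ^+ 2) <= K) -> OP X.
Proof.
move=> LX XK e e0; pose K1 := `|K| + 1.
have K10 : 0 < K1 by rewrite ltr_wpDl.
exists (Num.sqrt (K1 / e)); near=> n.
have Ke0 : 0 < K1 / e by rewrite divr_gt0.
have [mXn LXn] : L2 P (X n) by near: n.
exists [set w | (K1 / e <= X n w ^+ 2)%R]; split.
- rewrite -[X in measurable X]setTI.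
  by apply: measurable_fun_ler => //; exact: measurable_funX.
- apply: le_trans (markov_ge Ke0 LXn _) _; first by move=> w; exact: sqr_ge0.
  rewrite lee_fin ler_pdivrMr// mulrCA divff ?gt_eqF// mulr1.
  have H : \int[P]_w (X n w ^+ 2) <= K by near: n.
  by apply: (le_trans H); apply: (le_trans (ler_norm _)); rewrite lerDl.
- move=> w /= /negP; rewrite -ltNge => H.
  by rewrite -sqrtr_sqr ler_wsqrtr// ltW.
Unshelve. all: by end_near. Qed.

End StochasticOrder.

(** * Sums over pairs of independent variables *)

Section PairSums.
Context {R : realType} {d : measure_display} {T : measurableType d}.
Variables (P : probability T R) (n : nat) (U : 'I_n -> T -> R).
Hypotheses (mU : forall i, measurable_fun setT (U i))
  (indU : independent_variables P U).
Variables (K : pred ('I_n * 'I_n)) (kappa : nat).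
Hypotheses (Kr : forall i, (#|[pred l | K (i, l)]| <= kappa)%N)
  (Kl : forall i, (#|[pred l | K (l, i)]| <= kappa)%N).
Implicit Types e g : ('I_n * 'I_n)%type.

Definition share e g := [|| g.1 == e.1, g.1 == e.2, g.2 == e.1 | g.2 == e.2].
Definition adj e g := [&& K e, K g & share e g].

(** There are four ways for a pair to share an end with [e], and each fixes one coordinate, which
    leaves at most [kappa] choices. *)
Lemma card_adj e : (#|[pred g | adj e g]| <= 4 * kappa)%N.
Proof.
have c1 i : (#|[pred g : 'I_n * 'I_n | K g && (g.1 == i)]| <= kappa)%N.
  apply: leq_trans (Kr i).
  rewrite -(card_in_image (f := fun l => (i, l)) (A := [pred l | K (i, l)])); last first.
    by move=> x y _ _ [].
  apply: subset_leq_card; apply/fintype.subsetP => -[a b]; rewrite !inE/= => /andP[Kab /eqP ai].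
  by rewrite ai; apply: (fintype.image_f (fun l => (i, l))); rewrite inE -ai.
have c2 i : (#|[pred g : 'I_n * 'I_n | K g && (g.2 == i)]| <= kappa)%N.
  apply: leq_trans (Kl i).
  rewrite -(card_in_image (f := fun l => (l, i)) (A := [pred l | K (l, i)])); last first.
    by move=> x y _ _ [].
  apply: subset_leq_card; apply/fintype.subsetP => -[a b]; rewrite !inE/= => /andP[Kab /eqP bi].
  by rewrite bi; apply: (fintype.image_f (fun l => (l, i))); rewrite inE -bi.
pose A1 i := [pred g : 'I_n * 'I_n | K g && (g.1 == i)].
pose A2 i := [pred g : 'I_n * 'I_n | K g && (g.2 == i)].
have cU (A B : pred ('I_n * 'I_n)) : (#|[predU A & B]| <= #|A| + #|B|)%N.
  by rewrite -cardUI leq_addr.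
apply: (@leq_trans #|[predU [predU A1 e.1 & A1 e.2] & [predU A2 e.1 & A2 e.2]]|).
  apply: subset_leq_card; apply/fintype.subsetP => g; rewrite !inE /adj /share /=.
  by move=> /and3P[_ ->] /=; rewrite orbA.
apply: (leq_trans (cU _ _)); apply: (leq_trans (leq_add (cU _ _) (cU _ _))).
apply: (leq_trans (leq_add (leq_add (c1 _) (c1 _)) (leq_add (c2 _) (c2 _)))); lia.
Qed.

Let sU S := @sigma_of_sigma_algebra _ _ R 'I_n S U.
Let subU S : sigma_of S U `<=` measurable.
Proof. by apply: sigma_of_subset => i _; exact: mU. Qed.

Definition ends e : set 'I_n := [set i | i = e.1 \/ i = e.2].

Lemma share_ends e g : ~~ share e g -> forall i, ends e i -> ~ ends g i.
Proof.
rewrite /share !negb_or => /and4P[/eqP h1 /eqP h2 /eqP h3 /eqP h4] i.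
by move=> [->|->] [|] E; [case: h1|case: h3|case: h2|case: h4].
Qed.

Lemma pair_measurable_wrt (phi : R * R -> R) e : measurable_fun setT phi ->
  measurable_wrt (sigma_of (ends e) U) (fun w => phi (U e.1 w, U e.2 w)).
Proof.
move=> mphi; apply: (measurable_wrt_comp2 (sU _)) => //.
- by apply: sigma_of_measurable; left.
- by apply: sigma_of_measurable; right.
Qed.

Lemma measurable_pair_fun (phi : R * R -> R) e : measurable_fun setT phi ->
  measurable_fun setT (fun w => phi (U e.1 w, U e.2 w)).
Proof.
by move=> mphi; exact: (measurable_wrt_fun (@subU _) (pair_measurable_wrt mphi)).
Qed.

Lemma Ex_disjoint (S S' : set 'I_n) (Y Z : T -> R) :
  (forall i, S i -> ~ S' i) ->
  measurable_wrt (sigma_of S U) Y -> measurable_wrt (sigma_of S' U) Z ->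
  L1 P Y -> L1 P Z ->
  \int[P]_w (Y w * Z w) = \int[P]_w Y w * \int[P]_w Z w.
Proof.
move=> SS' mY mZ LY LZ.
by have [_ ->] := Ex_indep (independent_disjoint mU indU SS') mY mZ LY LZ.
Qed.

Section SquareIntegrable.
Variables (phi : 'I_n * 'I_n -> R * R -> R) (eta : R).
Hypothesis mphi : forall e, measurable_fun setT (phi e).
Let z e w := phi e (U e.1 w, U e.2 w).
Hypotheses (zL2 : forall e, K e -> L2 P (z e))
  (z0 : forall e, K e -> \int[P]_w z e w = 0).

Lemma pair_cov0 e g : K e -> K g -> ~~ share e g -> \int[P]_w (z e w * z g w) = 0.
Proof.
move=> Ke Kg sh; rewrite (Ex_disjoint (share_ends sh)).
- by rewrite z0// mul0r.
- exact: pair_measurable_wrt.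
- exact: pair_measurable_wrt.
- exact/L2_L1/zL2.
- exact/L2_L1/zL2.
Qed.

Hypothesis zeta : forall e, K e -> \int[P]_w (z e w ^+ 2) <= eta.

(** Pairs without a common index are uncorrelated by [pair_cov0]; each of the remaining covariances,
    at most [4 kappa] per pair, is bounded by [eta]. *)
Lemma pair_sum_variance : 0 <= eta ->
  \int[P]_w ((\sum_(e | K e) z e w) ^+ 2) <= #|K|%:R * ((4 * kappa)%:R * eta).
Proof.
move=> eta0.
have -> : \int[P]_w ((\sum_(e | K e) z e w) ^+ 2) =
    \int[P]_w (\sum_(e | K e) \sum_(g | K g) z e w * z g w).
  by apply: eq_Rintegral => w _; rewrite expr2 big_distrlr.
rewrite Ex_sum; last first.
  by move=> e Ke; apply: L1_sum => g Kg; apply: L2M; exact: zL2.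
apply: (@le_trans _ _ (\sum_(e | K e) (4 * kappa)%:R * eta)); last first.
  by apply: sum_cst_le => //; rewrite mulr_ge0.
apply: ler_sum => e Ke; rewrite Ex_sum; last first.
  by move=> g Kg; apply: L2M; exact: zL2.
rewrite (bigID (share e))/= [X in _ + X]big1 ?addr0; last first.
  by move=> g /andP[Kg sh]; exact: pair_cov0.
apply: (@le_trans _ _ (\sum_(g | adj e g) eta)); last first.
  by apply: sum_cst_le => //; exact: card_adj.
rewrite (eq_bigl (adj e)); last by move=> g; rewrite /adj Ke.
apply: ler_sum => g /and3P[_ Kg _].
apply: (le_trans (ler_norm _)); apply: (le_trans (Ex_normM_le (zL2 Ke) (zL2 Kg))).
by have := zeta Ke; have := zeta Kg; lra.
Qed.

End SquareIntegrable.

Section Bounded.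
Variables (phi : 'I_n * 'I_n -> R * R -> R) (m : R).
Hypotheses (m0 : 0 <= m) (mphi : forall e, measurable_fun setT (phi e))
  (phim : forall e z, `|phi e z| <= m)
  (phi0 : forall e, K e -> \int[P]_w phi e (U e.1 w, U e.2 w) = 0).

(** Extension by zero outside [K], so that [local_dependence_cos] applies with the whole type of
    pairs as index type. *)
Let z e w := if K e then phi e (U e.1 w, U e.2 w) else 0.

Let mz e : measurable_fun setT (z e).
Proof. by rewrite /z; case: (K e) => //; exact: measurable_pair_fun. Qed.

Let zm e w : `|z e w| <= m.
Proof. by rewrite /z; case: (K e) => //; rewrite normr0. Qed.

Let zwrt e : measurable_wrt (sigma_of (ends e) U) (z e).
Proof.
rewrite /z; case: (K e); last exact: (measurable_wrt_cst (sU _)).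
exact: pair_measurable_wrt.
Qed.

Let Ez e : \int[P]_w z e w = 0.
Proof. by rewrite /z; case: (boolP (K e)) => [/phi0//|_]; rewrite Ex_cst. Qed.

Let sumz w : \sum_e z e w = \sum_(e | K e) phi e (U e.1 w, U e.2 w).
Proof. by rewrite [RHS]big_mkcond. Qed.

(* removing the pairs adjacent to [e] leaves pairs which do not meet it *)
Let rest_wrt (S : set 'I_n) (A : pred ('I_n * 'I_n)) :
  (forall g, ~~ A g -> K g -> forall i, ends g i -> ~ S i) ->
  measurable_wrt (sigma_of (~` S) U)
    (fun w => \sum_g z g w - \sum_(g | A g) z g w).
Proof.
move=> HA.
have -> : (fun w => \sum_g z g w - \sum_(g | A g) z g w) =
    (fun w => \sum_(g | ~~ A g && K g) z g w).
  apply/funext => w; rewrite [X in X - _](bigID A)/= [X in X - _]addrC addrK.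
  rewrite (bigID K)/= [X in _ + X]big1 ?addr0//.
  by move=> g /andP[_ nK]; rewrite /z (negbTE nK).
apply: (measurable_wrt_sum (sU _)) => g /andP[nA Kg].
by apply: (measurable_wrtS _ (@zwrt g)); apply: sigma_ofS => i; exact: (HA g).
Qed.

Let trig_wrt (h : R -> R) G (s theta : R) (Y : T -> R) : sigma_algebra setT G ->
  continuous h -> measurable_wrt G Y -> measurable_wrt G (fun w => h (s * Y w + theta)).
Proof.
move=> sG ch mY; apply: (measurable_wrt_comp sG (h := fun y => h (s * y + theta))) => //.
apply: measurableT_comp; first exact: continuous_measurable_fun.
by apply: measurable_funD => //; exact: measurable_funM.
Qed.

Lemma pair_sum_cos theta :
  `|\int[P]_w cos (\sum_(e | K e) phi e (U e.1 w, U e.2 w) + theta)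
    - expR (- (\int[P]_w ((\sum_(e | K e) phi e (U e.1 w, U e.2 w)) ^+ 2) / 2))
      * cos theta|
  <= 5 * #|K|%:R * (4 * kappa)%:R ^+ 2 * m ^+ 3.
Proof.
under eq_Rintegral do rewrite -sumz.
under [X in expR (- (X / 2))]eq_Rintegral do rewrite -sumz.
have restm (A : pred ('I_n * 'I_n)) :
    measurable_fun setT (fun w => \sum_g z g w - \sum_(g | A g) z g w).
  by apply: measurable_funB; apply: measurable_sum_cond.
have Lz e : L1 P (z e) by exact: (L1_bounded P (mz e) (zm e)).
have Lzz e g : L1 P (fun w => z e w * z g w).
  by apply: L1M_bounded (Lz g) => //; exact: zm.
apply: (@local_dependence_cos _ _ _ P _ z adj) => //.
- exact: card_adj.
- by move=> e w nK; rewrite /z (negbTE nK).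
- by move=> e g /and3P[].
- move=> e s th; have [Ke|nKe] := boolP (K e); last first.
    under eq_Rintegral do rewrite /z (negbTE nKe) mul0r.
    by rewrite Ex_cst.
  rewrite (@Ex_disjoint (ends e) (~` ends e)).
  + by rewrite Ez mul0r.
  + by move=> i ei; apply.
  + exact: zwrt.
  + apply: (trig_wrt (h := sin)); first exact: sigma_of_sigma_algebra.
      exact: continuous_sin.
    apply: rest_wrt => g; rewrite /adj Ke/= => nA Kg.
    rewrite Kg/= in nA => i gi ei; exact: (share_ends nA ei gi).
  + exact: Lz.
  + apply: (@L1_bounded _ _ _ _ _ 1); last by move=> w; exact: sin_max.
    by apply: measurable_sin_comp; apply: measurable_funD => //; exact: measurable_funM.
- move=> e e' s th /and3P[Ke Ke' _].
  rewrite (@Ex_disjoint (ends e `|` ends e') (~` (ends e `|` ends e'))) => //.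
  + by move=> i ei; apply.
  + apply: (measurable_wrtM (sU _)).
      by apply: (measurable_wrtS _ (@zwrt e)); apply: sigma_ofS => i; left.
    by apply: (measurable_wrtS _ (@zwrt e')); apply: sigma_ofS => i; right.
  + apply: (trig_wrt (h := cos)); first exact: sigma_of_sigma_algebra.
      exact: continuous_cos.
    apply: rest_wrt => g; rewrite /adj Ke Ke'/= => nA Kg.
    rewrite Kg/= negb_or in nA; have /andP[n1 n2] := nA.
    by move=> i gi [ei|ei]; [exact: (share_ends n1 ei gi)|exact: (share_ends n2 ei gi)].
  + apply: L1_cos; apply: measurable_funD => //; exact: measurable_funM.
- move=> e g; have [Ke|nKe] := boolP (K e); last first.
    move=> _; under eq_Rintegral do rewrite /z (negbTE nKe) mul0r.
    by rewrite Ex_cst.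
  have [Kg|nKg] := boolP (K g); last first.
    move=> _; under eq_Rintegral do rewrite /z (negbTE nKg) mulr0.
    by rewrite Ex_cst.
  rewrite /adj Ke Kg /= => sh.
  by rewrite (Ex_disjoint (share_ends sh))// Ez mul0r.
Qed.

End Bounded.

End PairSums.

Section SameLaw.
Context {R : realType} {d : measure_display} {T : measurableType d}.
Variable P : probability T R.

Lemma same_law_Ex (X X' : T -> (R * R)%type) (h : R * R -> R) :
  measurable_fun setT X -> measurable_fun setT X' ->
  (forall A, measurable A -> P (X @^-1` A) = P (X' @^-1` A)) ->
  measurable_fun setT h -> L1 P (fun w => h (X w)) ->
  L1 P (fun w => h (X' w)) /\ \int[P]_w h (X' w) = \int[P]_w h (X w).
Proof.
move=> mX mX' XX' mh Lh.
pose f : {mfun T >-> (R * R)%type} := mfun_Sub (mem_set mX).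
pose f' : {mfun T >-> (R * R)%type} := mfun_Sub (mem_set mX').
have E (phi : R * R -> \bar R) :
    (\int[distribution P f']_z phi z = \int[distribution P f]_z phi z)%E.
  by apply: eq_measure_integral => A mA _; rewrite /= /distribution /pushforward /= XX'.
have mhE : measurable_fun setT (EFin \o h) by exact/measurable_EFinP.
have Lh' : L1 P (fun w => h (X' w)).
  apply/integrableP; split; first by apply/measurable_EFinP; exact: measurableT_comp.
  have /integrableP[_] := Lh.
  have mhA : measurable_fun setT (fun z => `|(h z)%:E|%E) by exact: measurableT_comp.
  have := E (fun z => `|(h z)%:E|%E).
  rewrite !ge0_integral_pushforward//= => E'.
  by rewrite -[X in (X < _)%E]E'.
split => //; rewrite /Rintegral.
have := E (EFin \o h); rewrite !integral_pushforward//= => ->//.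
Qed.

Lemma same_joint_law (G H G' H' : set (set T)) (Y Z Y' Z' : T -> R) :
  measurable_fun setT Y -> measurable_fun setT Z ->
  measurable_fun setT Y' -> measurable_fun setT Z' ->
  independent_sigma P G H -> measurable_wrt G Y -> measurable_wrt H Z ->
  independent_sigma P G' H' -> measurable_wrt G' Y' -> measurable_wrt H' Z' ->
  (forall A, measurable A -> P (Y @^-1` A) = P (Y' @^-1` A)) ->
  (forall A, measurable A -> P (Z @^-1` A) = P (Z' @^-1` A)) ->
  forall A, measurable A -> P ((fun w => (Y w, Z w)) @^-1` A) =
    P ((fun w => (Y' w, Z' w)) @^-1` A).
Proof.
move=> mY mZ mY' mZ' GH GY HZ GH' GY' HZ' YY' ZZ' A mA.
rewrite -(independent_distribution mY mZ GH GY HZ mA).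
pose f : {mfun T >-> R} := mfun_Sub (mem_set mY).
pose g : {mfun T >-> R} := mfun_Sub (mem_set mZ).
have mfg : measurable_fun setT (fun w => (Y' w, Z' w)) by exact: measurable_fun_pair.
pose fg : {mfun T >-> (R * R)%type} := mfun_Sub (mem_set mfg).
apply: (@product_measure_unique _ _ _ _ _ (distribution P f) (distribution P g)
  (distribution P fg)) => // B C mB mC.
rewrite /distribution /pushforward /=.
have := GH' _ _ (GY' _ mB) (HZ' _ mC).
by rewrite -YY'// -ZZ'//.
Qed.

End SameLaw.

Section Truncation.
Context {R : realType}.

Definition clamp (M x : R) : R := Num.max (- M) (Num.min M x).

Lemma clamp_norm M x : 0 <= M -> `|clamp M x| <= M.
Proof.
move=> M0; rewrite ler_norml /clamp le_max lexx/= ge_max ge_min lexx/= andbT.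
by rewrite (le_trans _ M0)// oppr_le0.
Qed.

Lemma clamp_id M x : `|x| <= M -> clamp M x = x.
Proof.
by rewrite ler_norml => /andP[h1 h2]; rewrite /clamp min_r// max_r.
Qed.

Lemma clamp_dist M x : 0 <= M -> `|x - clamp M x| <= `|x|.
Proof.
move=> M0; rewrite /clamp.
have [xM|Mx] := leP x M.
  have [h|h] := leP (- M) x; first by rewrite subrr normr0.
  by rewrite !ler0_norm ?subr_le0; lra.
have hM : - M <= M by lra.
by rewrite max_r// !ger0_norm ?subr_ge0; lra.
Qed.

Lemma measurable_clamp M : measurable_fun setT (clamp M).
Proof. by apply: measurable_maxr => //; exact: measurable_minr. Qed.

Context {d : measure_display} {T : measurableType d}.
Variable P : probability T R.

Lemma clamp_L2_cvg (X : T -> R) : L2 P X ->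
  \int[P]_w ((X w - clamp n%:R (X w)) ^+ 2) @[n --> \oo] --> 0.
Proof.
move=> [mX LX].
have mD n : measurable_fun setT (fun w => (X w - clamp n%:R (X w)) ^+ 2).
  apply: measurable_funX; apply: measurable_funB => //.
  exact: measurableT_comp (measurable_clamp _) mX.
have [|||||_ _ H] := @dominated_convergence _ _ _ P setT measurableT
  (fun n w => ((X w - clamp n%:R (X w)) ^+ 2)%:E) (cst 0%E)
  (fun w => (X w ^+ 2)%:E).
- by move=> n; exact/measurable_EFinP.
- exact: measurable_cst.
- apply: aeW => w _; apply: cvg_near_cst; near=> n.
  rewrite clamp_id ?subrr ?expr0n//.
  near: n; exact: nbhs_infty_ger.
- by [].
- apply: aeW => w n _; rewrite lee_fin normrX -[leRHS]real_normK ?num_real//.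
  by rewrite lerXn2r ?nnegrE// clamp_dist.
rewrite integral0 in H; have /fine_cvgP[_ H'] := H.
exact: H'.
Unshelve. all: by end_near. Qed.

Lemma expRN_half_lip (a b : R) : 0 <= a -> 0 <= b ->
  `|expR (- (a / 2)) - expR (- (b / 2))| <= `|a - b|.
Proof.
wlog ab : a b / a <= b.
  move=> hw a0 b0; have [/hw|/ltW /hw] := leP a b; first exact.
  by rewrite distrC (distrC a); apply.
move=> a0 b0; rewrite ger0_norm; last by rewrite subr_ge0 ler_expR; lra.
rewrite ler0_norm ?subr_le0//.
have -> : expR (- (b / 2)) = expR (- (a / 2)) * expR ((a - b) / 2).
  by rewrite -expRD; congr expR; field.
have := expR_ge1Dx ((a - b) / 2).
have e1 : expR (- (a / 2)) <= 1 by rewrite -[leRHS]expR0 ler_expR; lra.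
have e0 := expR_gt0 (- (a / 2)).
set x := expR (- (a / 2)) in e1 e0 *; set y := expR _ => hy.
have : x * (1 - y) <= 1 * ((b - a) / 2).
  have [y1|y1] := leP y 1; first by apply: ler_pM; lra.
  by apply: (@le_trans _ _ 0); [rewrite pmulr_rle0//; lra|lra].
by lra.
Qed.

End Truncation.

(** * Central limit theorem for square integrable kernels of pairs *)

Section PairCLT.
Context {R : realType} {d : measure_display} {T : measurableType d}.
Variables (P : probability T R) (U : forall n : nat, 'I_n.+1 -> T -> R).
Hypotheses (mU : forall n i, measurable_fun setT (@U n i))
  (indU : forall n, independent_variables P (@U n)).
Hypothesis idU : forall n i m j (A : set R), measurable A ->
  P (@U n i @^-1` A) = P (@U m j @^-1` A).
Variable H : R * R -> R.
Hypothesis mH : measurable_fun setT H.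

(** The smallest sample with two errors serves as reference: every pair of distinct errors, in any
    sample, has the same law, so truncation levels and means are fixed once for all [n]. *)
Definition ref_pair w : R * R := (@U 1 ord0 w, @U 1 (lift ord0 ord0) w).

Lemma pair_Ex n (e : 'I_n.+1 * 'I_n.+1) (h : R * R -> R) : e.1 != e.2 ->
  measurable_fun setT h -> L1 P (fun w => h (ref_pair w)) ->
  L1 P (fun w => h (U e.1 w, U e.2 w)) /\
  \int[P]_w h (U e.1 w, U e.2 w) = \int[P]_w h (ref_pair w).
Proof.
move=> e12 mh Lh; apply: same_law_Ex mh Lh.
- by apply: measurable_fun_pair.
- by apply: measurable_fun_pair.
have ind m (i j : 'I_m.+1) : i != j ->
    independent_sigma P (sigma_of [set i] (@U m)) (sigma_of [set j] (@U m)).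
  move=> ij; apply: independent_disjoint => // k -> /= kj.
  by move: ij; rewrite kj eqxx.
apply: (same_joint_law _ _ _ _ (@ind 1 ord0 (lift ord0 ord0) isT) _ _ (ind n e.1 e.2 e12)) => //;
  try exact: sigma_of_measurable; by move=> A mA; exact: idU.
Qed.

Variables (K : forall n, pred ('I_n.+1 * 'I_n.+1)) (kappa : nat -> nat) (c : nat -> R).
Hypotheses (Kneq : forall n e, @K n e -> e.1 != e.2)
  (Kr : forall n i, (#|[pred l | @K n (i, l)]| <= kappa n)%N)
  (Kl : forall n i, (#|[pred l | @K n (l, i)]| <= kappa n)%N).
Variables (C v : R).
(** The two scale conditions act on the two halves of the truncated kernel: [cC] keeps the variance
    of the cut-off part small uniformly in [n], and [c3] removes the third-order error of the
    bounded part at each fixed level. *)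
Hypothesis c0 : forall n, 0 <= c n.
Hypothesis cC : \forall n \near \oo,
  #|@K n|%:R * (4 * kappa n)%:R * c n ^+ 2 <= C.
Hypothesis c3 : #|@K n|%:R * (4 * kappa n)%:R ^+ 2 * c n ^+ 3 @[n --> \oo] --> 0.
Hypotheses (LH : L2 P (fun w => H (ref_pair w)))
  (EH : \int[P]_w H (ref_pair w) = 0).

Let mpair n (e : 'I_n.+1 * 'I_n.+1) (h : R * R -> R) : measurable_fun setT h ->
  measurable_fun setT (fun w => h (@U n e.1 w, @U n e.2 w)).
Proof. by move=> mh; apply: measurableT_comp => //; exact: measurable_fun_pair. Qed.

Let S n w := \sum_(e | @K n e) c n * H (U e.1 w, U e.2 w).

Let LHe n e : @K n e -> L2 P (fun w => H (U e.1 w, U e.2 w)).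
Proof.
move=> Ke; split; first exact: mpair.
have [+ _] := @pair_Ex n e (fun z => H z ^+ 2) (Kneq Ke) (measurable_funX _ mH) LH.2.
exact.
Qed.

Lemma pair_clt_L2 n : L2 P (S n).
Proof. by apply: L2_sum => e Ke; apply: L2Zl; exact: LHe. Qed.

Hypothesis Sv : \int[P]_w (S n w ^+ 2) @[n --> \oo] --> v.

Let C0 : 0 <= C.
Proof.
have [n _ Hn] := cC; apply: le_trans (Hn n (leqnn n)).
by rewrite !mulr_ge0 ?exprn_ge0.
Qed.

(** Truncation destroys the centering of the kernel. Moving the mean [mu_ M] from the bounded part
    [phi] to the remainder [psi] centers both, since [H] itself is centered. *)
Let mu_ M := \int[P]_w clamp M (H (ref_pair w)).
Let phi M n (z : R * R) := c n * (clamp M (H z) - mu_ M).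
Let psi M n (z : R * R) := c n * (H z - clamp M (H z) + mu_ M).
Let eta M := \int[P]_w ((H (ref_pair w) - clamp M (H (ref_pair w))) ^+ 2).

Let mclampH M : measurable_fun setT (fun z => clamp M (H z)).
Proof. exact: measurableT_comp (measurable_clamp M) mH. Qed.

Let mphi M n : measurable_fun setT (phi M n).
Proof. by apply: measurable_funM => //; exact: measurable_funB. Qed.

Let mpsi M n : measurable_fun setT (psi M n).
Proof.
by apply: measurable_funM => //; apply: measurable_funD => //; exact: measurable_funB.
Qed.

Let mref : measurable_fun setT ref_pair.
Proof. by apply: measurable_fun_pair. Qed.

Let Lclamp M : 0 <= M -> L2 P (fun w => clamp M (H (ref_pair w))).
Proof.
move=> M0; apply: (@L2_bounded _ _ _ _ _ M).
  exact: measurableT_comp (mclampH M) mref.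
by move=> w; exact: clamp_norm.
Qed.

Let mu_le M : 0 <= M -> `|mu_ M| <= M.
Proof.
move=> M0; apply: Ex_norm_bound; first exact: L2_L1 (Lclamp M0).
by move=> w; exact: clamp_norm.
Qed.

Let phi_le M n z : 0 <= M -> `|phi M n z| <= c n * (2 * M).
Proof.
move=> M0; rewrite normrM (ger0_norm (c0 n)) ler_wpM2l//.
apply: (le_trans (ler_normB _ _)); rewrite mulr_natl mulr2n lerD//.
  exact: clamp_norm.
exact: mu_le.
Qed.

Let Ephi M n e : 0 <= M -> @K n e -> \int[P]_w phi M n (U e.1 w, U e.2 w) = 0.
Proof.
move=> M0 Ke; have Lc := L2_L1 (Lclamp M0).
have L : L1 P (fun w => phi M n (ref_pair w)).
  by apply: L1Zl; apply: L1B => //; exact: L1_cst.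
have [_ ->] := pair_Ex (Kneq Ke) (mphi M n) L.
rewrite ExZl; last by apply: L1B => //; exact: L1_cst.
by rewrite ExB//; [rewrite Ex_cst subrr mulr0|exact: L1_cst].
Qed.

Let Lpsi_ref M n : 0 <= M -> L2 P (fun w => psi M n (ref_pair w)).
Proof.
move=> M0; apply: L2Zl; apply: L2D; last exact: L2_cst.
by apply: L2B => //; exact: Lclamp.
Qed.

Let Lpsi M n e : 0 <= M -> @K n e -> L2 P (fun w => psi M n (U e.1 w, U e.2 w)).
Proof.
move=> M0 Ke; split; first exact: mpair.
have [+ _] := @pair_Ex n e (fun z => psi M n z ^+ 2) (Kneq Ke)
  (measurable_funX _ (mpsi M n)) (Lpsi_ref n M0).2.
exact.
Qed.

Let Epsi M n e : 0 <= M -> @K n e -> \int[P]_w psi M n (U e.1 w, U e.2 w) = 0.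
Proof.
move=> M0 Ke; have Lc := L2_L1 (Lclamp M0); have LH1 := L2_L1 LH.
have [_ ->] := pair_Ex (Kneq Ke) (mpsi M n) (L2_L1 (Lpsi_ref n M0)).
rewrite ExZl; last by apply: L1D; [exact: L1B|exact: L1_cst].
rewrite ExD; [|exact: L1B|exact: L1_cst].
by rewrite ExB// EH Ex_cst sub0r addNr mulr0.
Qed.

Let Epsi2 M n e : 0 <= M -> @K n e ->
  \int[P]_w (psi M n (U e.1 w, U e.2 w) ^+ 2) <= c n ^+ 2 * eta M.
Proof.
move=> M0 Ke; have Lc := Lclamp M0.
have [_ ->] := @pair_Ex n e (fun z => psi M n z ^+ 2) (Kneq Ke)
  (measurable_funX _ (mpsi M n)) (Lpsi_ref n M0).2.
have LD : L2 P (fun w => H (ref_pair w) - clamp M (H (ref_pair w))) by exact: L2B.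
have L1D' := L2_L1 LD; have LD2 := LD.2.
have -> : \int[P]_w (psi M n (ref_pair w) ^+ 2) =
    c n ^+ 2 * (eta M - mu_ M ^+ 2).
  transitivity (\int[P]_w (c n ^+ 2 *
      ((H (ref_pair w) - clamp M (H (ref_pair w))) ^+ 2 +
       (2 * mu_ M * (H (ref_pair w) - clamp M (H (ref_pair w))) + mu_ M ^+ 2)))).
    by apply: eq_Rintegral => w _; rewrite /psi; ring.
  have L2' : L1 P (fun w => 2 * mu_ M * (H (ref_pair w) - clamp M (H (ref_pair w))) + mu_ M ^+ 2).
    by apply: L1D; [exact: L1Zl|exact: L1_cst].
  rewrite ExZl; last exact: L1D.
  rewrite ExD// ExD; [|exact: L1Zl|exact: L1_cst].
  rewrite ExZl// Ex_cst ExB//; [|exact: L2_L1|exact: L2_L1].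
  by rewrite EH -/(mu_ M) -/(eta M); ring.
by rewrite ler_wpM2l ?sqr_ge0// lerBlDr lerDl sqr_ge0.
Qed.

Let SM M n w := \sum_(e | @K n e) phi M n (U e.1 w, U e.2 w).
Let DM M n w := \sum_(e | @K n e) psi M n (U e.1 w, U e.2 w).

Let S_split M n w : S n w = SM M n w + DM M n w.
Proof.
by rewrite /SM /DM -big_split /=; apply: eq_bigr => e _; rewrite /phi /psi; ring.
Qed.

Let LDM M n : 0 <= M -> L2 P (DM M n).
Proof. by move=> M0; apply: L2_sum => e Ke; exact: Lpsi. Qed.

Let LSM M n : 0 <= M -> L2 P (SM M n).
Proof.
move=> M0; apply: L2_sum => e Ke; apply: (@L2_bounded _ _ _ _ _ (c n * (2 * M))).
  exact: mpair.
by move=> w; exact: phi_le.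
Qed.

Let EDM2 M n : 0 <= M -> #|@K n|%:R * (4 * kappa n)%:R * c n ^+ 2 <= C ->
  \int[P]_w (DM M n w ^+ 2) <= C * eta M.
Proof.
move=> M0 CC; have eta0 : 0 <= eta M by apply: Ex_ge0 => w; exact: sqr_ge0.
have h := @pair_sum_variance _ _ _ P n.+1 (@U n) (@mU n) (@indU n) (@K n)
  (kappa n) (Kr (n := n)) (Kl (n := n)) (fun=> psi M n) (c n ^+ 2 * eta M).
apply: (le_trans (h _ _ _ _ _)).
- by move=> e; exact: mpsi.
- by move=> e Ke; exact: Lpsi.
- by move=> e Ke; exact: Epsi.
- by move=> e Ke; exact: Epsi2.
- by rewrite mulr_ge0 ?sqr_ge0.
- rewrite mulrA [X in X <= _]mulrA.
  by apply: ler_wpM2r.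
Qed.

(** The level [M] is chosen first, so that the remainder is small in mean square for all large [n];
    only then does [n] grow and make the error of [pair_sum_cos] vanish. The variance of the bounded
    part is compared with that of the full sum, whose limit is [v]. *)
Lemma pair_clt theta :
  \int[P]_w cos (S n w + theta) @[n --> \oo] --> expR (- (v / 2)) * cos theta.
Proof.
apply/cvgrPdist_le => e e0.
have B0 : 0 < `|v| + 1 by rewrite ltr_wpDl.
set B := `|v| + 1 in B0 *.
(* Six of the ten shares are spent: one on dropping the remainder, one on the bounded sum and four
   on exchanging the variances. *)
pose q1 := e / 10; have q10 : 0 < q1 by rewrite divr_gt0.
(* Weight of the inequality [2 |x y| <= tau x^2 + y^2 / tau] for the cross term of the variances;
   [B] bounds the second moment of [S], so the first term costs [q1]. *)
pose tau := q1 / B; have tau0 : 0 < tau by rewrite divr_gt0.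
(* The second moment of the remainder must lie below [q1 ^ 2] for its mean absolute value, below
   [tau * q1] for the term divided by [tau], and below [q1] for its own contribution to the
   variance. *)
pose q := Num.min q1 (Num.min (q1 ^+ 2) (tau * q1)).
have q0 : 0 < q by rewrite !lt_min q10 exprn_gt0// mulr_gt0.
have C10 : 0 < C + 1 by rewrite ltr_wpDl.
have qC : 0 < q / (C + 1) by rewrite divr_gt0.
have [M M0 etaM] : exists2 M : R, 0 <= M & eta M <= q / (C + 1).
  have /cvgrPdist_le /(_ _ qC) [N _ /(_ N (leqnn N))] := clamp_L2_cvg LH.
  rewrite sub0r normrN => h; exists N%:R => //.
  exact: le_trans (ler_norm _) h.
have eta0 : 0 <= eta M by apply: Ex_ge0 => w; exact: sqr_ge0.
have Ceta : C * eta M <= q.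
  apply: (@le_trans _ _ ((C + 1) * (q / (C + 1)))).
    by rewrite ler_pM// lerDl.
  by rewrite mulrCA divff ?mulr1// gt_eqF.
have q_le1 : q <= q1 by rewrite /q ge_min lexx.
have q_le2 : q <= q1 ^+ 2 by rewrite /q !ge_min lexx !orbT.
have q_le3 : q <= tau * q1 by rewrite /q !ge_min lexx !orbT.
pose m3 := 5 * (2 * M) ^+ 3 + 1.
have m30 : 0 < m3 by rewrite ltr_wpDl// mulr_ge0// exprn_ge0// mulr_ge0.
have v0 : 0 <= v.
  apply: (cvgr_to_ge Sv); apply: nearW => n.
  by apply: Ex_ge0 => w; exact: sqr_ge0.
have e50 : 0 < q1 / m3 by rewrite divr_gt0.
near=> n.
have Cn : #|@K n|%:R * (4 * kappa n)%:R * c n ^+ 2 <= C by near: n.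
have c3n : #|@K n|%:R * (4 * kappa n)%:R ^+ 2 * c n ^+ 3 <= q1 / m3.
  have : `|0 - #|@K n|%:R * (4 * kappa n)%:R ^+ 2 * c n ^+ 3| <= q1 / m3.
    by near: n; move/cvgrPdist_le: c3; apply.
  by rewrite sub0r normrN; apply: le_trans; exact: ler_norm.
have vn : `|v - \int[P]_w (S n w ^+ 2)| <= q1.
  by near: n; move/cvgrPdist_le: Sv; apply.
have vB : \int[P]_w (S n w ^+ 2) <= B.
  have : `|v - \int[P]_w (S n w ^+ 2)| <= 1 by near: n; move/cvgrPdist_le: Sv; apply.
  by rewrite ler_distl /B => /andP[+ _]; have := ler_norm v; lra.
have LS := pair_clt_L2 n; have LS' := LSM n M0; have LD := LDM n M0.
have [[mS S2] [[mS' S2'] [mD D2]]] := (LS, (LS', LD)).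
have ED : \int[P]_w (DM M n w ^+ 2) <= q by apply: (le_trans (EDM2 M0 Cn)).
set vM := \int[P]_w (SM M n w ^+ 2).
have vM0 : 0 <= vM by apply: Ex_ge0 => w; exact: sqr_ge0.
set vS := \int[P]_w (S n w ^+ 2) in vn vB.
have vS0 : 0 <= vS by apply: Ex_ge0 => w; exact: sqr_ge0.
have step1 : `|\int[P]_w cos (S n w + theta) - \int[P]_w cos (SM M n w + theta)| <= q1.
  rewrite -ExB; [|by apply: L1_cos; exact: measurable_funD..].
  apply: (@le_trans _ _ (\int[P]_w `|DM M n w|)).
    apply: Ex_norm_le.
    - by apply: L1B; apply: L1_cos; exact: measurable_funD.
    - exact/L1_norm/L2_L1.
    - move=> w; apply: (le_trans (cosB_le _ _)).
      by rewrite (S_split M) opprD addrACA subrr addr0 addrAC subrr add0r.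
  apply: (le_trans (Ex_norm_sqrt LD)).
  rewrite -(ger0_norm (ltW q10)) -sqrtr_sqr ler_wsqrtr//.
  exact: le_trans ED q_le2.
have step2 : `|\int[P]_w cos (SM M n w + theta) - expR (- (vM / 2)) * cos theta| <= q1.
  have cM0 : 0 <= c n * (2 * M) by rewrite !mulr_ge0.
  have h := @pair_sum_cos _ _ _ P n.+1 (@U n) (@mU n) (@indU n) (@K n)
    (kappa n) (Kr (n := n)) (Kl (n := n)) (fun=> phi M n) (c n * (2 * M)) cM0.
  apply: (le_trans (h _ _ _ theta)).
  - by move=> ?; exact: mphi.
  - by move=> ? z; exact: phi_le.
  - by move=> ? Ke; exact: Ephi.
  - apply: (@le_trans _ _ (m3 * (q1 / m3))); last by rewrite mulrCA divff ?mulr1// gt_eqF.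
    have -> : 5 * #|@K n|%:R * (4 * kappa n)%:R ^+ 2 * (c n * (2 * M)) ^+ 3 =
      (5 * (2 * M) ^+ 3) * (#|@K n|%:R * (4 * kappa n)%:R ^+ 2 * c n ^+ 3) by ring.
    apply: ler_pM => //.
    + by rewrite mulr_ge0// exprn_ge0// mulr_ge0.
    + by rewrite !mulr_ge0// exprn_ge0.
    + by rewrite /m3 lerDl.
have step3 : `|vM - vS| <= q1 + q1 + q1.
  pose h w := tau * S n w ^+ 2 + (tau^-1 + 1) * DM M n w ^+ 2.
  have Lh : L1 P h by apply: L1D; exact: L1Zl.
  apply: (@le_trans _ _ (\int[P]_w h w)).
    rewrite -ExB//; apply: Ex_norm_le => //; first exact: L1B.
    move=> w; have -> : SM M n w = S n w - DM M n w by rewrite (S_split M) addrK.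
    have -> : (S n w - DM M n w) ^+ 2 - S n w ^+ 2 =
      DM M n w ^+ 2 - 2 * (S n w * DM M n w) by ring.
    apply: (le_trans (ler_normB _ _)); rewrite normrX real_normK ?num_real//.
    rewrite !normrM (ger0_norm (_ : 0 <= 2))//.
    rewrite /h -(real_normK (num_real (S n w))) -(real_normK (num_real (DM M n w))).
    set x := `|S n w|; set y := `|DM M n w|.
    have : 0 <= tau^-1 * (tau * x - y) ^+ 2 by rewrite mulr_ge0 ?sqr_ge0// ltW// invr_gt0.
    have -> : tau^-1 * (tau * x - y) ^+ 2 = tau * x ^+ 2 - 2 * (x * y) + tau^-1 * y ^+ 2.
      by field; rewrite gt_eqF.
    by lra.
  rewrite /h ExD; [|exact: L1Zl..].
  rewrite !ExZl// mulrDl mul1r addrA lerD//; last exact: le_trans q_le1.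
  apply: lerD.
    apply: (@le_trans _ _ (tau * B)); first by rewrite ler_wpM2l// ltW.
    by rewrite /tau divfK// gt_eqF.
  apply: (@le_trans _ _ (tau^-1 * (tau * q1))).
    by rewrite ler_wpM2l ?invr_ge0 ?(ltW tau0)//; exact: le_trans q_le3.
  by rewrite mulKf// gt_eqF.
have step4 : `|expR (- (vM / 2)) * cos theta - expR (- (v / 2)) * cos theta| <= 4 * q1.
  rewrite -mulrBl normrM; apply: (@le_trans _ _ (`|vM - v| * 1)).
    by rewrite ler_pM// ?expRN_half_lip// cos_max.
  rewrite mulr1 (_ : vM - v = (vM - vS) - (v - vS)); last by ring.
  by apply: (le_trans (ler_normB _ _)); lra.
rewrite distrC (_ : _ - _ = (\int[P]_w cos (S n w + theta) - \int[P]_w cos (SM M n w + theta))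
  + (\int[P]_w cos (SM M n w + theta) - expR (- (vM / 2)) * cos theta)
  + (expR (- (vM / 2)) * cos theta - expR (- (v / 2)) * cos theta)); last by ring.
apply: (le_trans (ler_normD _ _)); apply: (le_trans (lerD (ler_normD _ _) (lexx _))).
have -> : e = q1 * 10 by rewrite /q1; field.
by lra.
Unshelve. all: by end_near. Qed.

End PairCLT.

(** * Moments of the errors *)

Section Tensor.
Context {d1 d2 : measure_display} {T1 : measurableType d1} {T2 : measurableType d2}
  {R : realType}.
Variables (m1 : {sigma_finite_measure set T1 -> \bar R})
  (m2 : {sigma_finite_measure set T2 -> \bar R}).

Lemma integrable_tensor (g : T1 -> R) (h : T2 -> R) :
  m1.-integrable setT (EFin \o g) -> m2.-integrable setT (EFin \o h) ->
  (m1 \x m2)%E.-integrable setT (fun z : T1 * T2 => (g z.1 * h z.2)%:E) /\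
  (\int[m1 \x m2]_z (g z.1 * h z.2)%:E = (\int[m1]_x g x * \int[m2]_y h y)%:E)%E.
Proof.
move=> ig ih; have /integrableP[/measurable_EFinP mg g1] := ig.
have /integrableP[/measurable_EFinP mh h1] := ih.
have mM : measurable_fun [set: T1 * T2] (fun z : T1 * T2 => (g z.1 * h z.2)%:E).
  by apply/measurable_EFinP; apply: measurable_funM; apply: measurableT_comp.
have iM : (m1 \x m2)%E.-integrable setT (fun z : T1 * T2 => (g z.1 * h z.2)%:E).
  apply/integrable12ltyP => //.
  under eq_integral => x _.
    rewrite (_ : (fun y => _) = fun y => (`|g x|%:E * `|(h y)%:E|)%E); last first.
      by apply/funext => y /=; rewrite normrM EFinM.
    rewrite ge0_integralZl//; last by apply: measurableT_comp => //; exact/measurable_EFinP.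
    over.
  rewrite ge0_integralZr//; last 2 first.
  - by apply/measurable_EFinP; exact: measurableT_comp.
  - exact: integral_ge0.
  rewrite lte_mul_pinfty//; first exact: integral_ge0.
  by rewrite ge0_fin_numE//; exact: integral_ge0.
split => //; rewrite -integral12_prod_meas1//.
have hfin := integrable_fin_num measurableT ih.
have gfin := integrable_fin_num measurableT ig.
transitivity (\int[m1]_x ((g x)%:E * \int[m2]_y (h y)%:E))%E.
  by apply: eq_integral => x _; rewrite /fubini_F -integralZl.
by rewrite -[in LHS](fineK hfin) integralZr// -[in LHS](fineK gfin).
Qed.

End Tensor.

Section Moments.
Context {R : realType} {d : measure_display} {T : measurableType d}.
Variables (P : probability T R) (f : R -> R).
Hypotheses (mf : measurable_fun setT f) (f0 : forall x, 0 <= f x)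
  (f1 : (\int[lebesgue_measure]_x (f x)%:E = 1)%E).
Variables (r : R) (q0 : nat).
Hypothesis q0r : q0%:R <= r.
Hypothesis fr : (\int[lebesgue_measure]_x (`|x| `^ r * f x)%:E < +oo)%E.
Implicit Types X Y : T -> R.
Local Notation mu := (@lebesgue_measure R).

Lemma norm_pow_le (q : nat) (x : R) : q%:R <= r -> `|x ^+ q| <= 1 + `|x| `^ r.
Proof.
move=> qr; rewrite normrX; have [x1|/ltW x1] := leP `|x| 1.
  by apply: (@le_trans _ _ 1); [rewrite exprn_ile1|rewrite lerDl powR_ge0].
apply: (@le_trans _ _ (`|x| `^ r)); last by rewrite lerDr.
by rewrite -powR_mulrn// ler_powR.
Qed.

Lemma integrable_pow q : (q <= q0)%N -> mu.-integrable setT (fun x => (x ^+ q * f x)%:E).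
Proof.
move=> qq0; have qr : q%:R <= r by apply: le_trans q0r; rewrite ler_nat.
have mp : measurable_fun setT (fun x : R => `|x| `^ r * f x).
  by apply: measurable_funM => //; apply: measurableT_comp (measurable_powR _) _.
have i1 : mu.-integrable setT (EFin \o f).
  apply/integrableP; split; first exact/measurable_EFinP.
  under eq_integral do rewrite gee0_abs ?lee_fin//.
  by rewrite f1 ltry.
have i2 : mu.-integrable setT (fun x => (`|x| `^ r * f x)%:E).
  apply/integrableP; split; first exact/measurable_EFinP.
  by under eq_integral do rewrite gee0_abs ?lee_fin ?mulr_ge0 ?powR_ge0//.
apply: le_integrable (integrableD measurableT i1 i2) => //.
  by apply/measurable_EFinP; apply: measurable_funM => //; exact: measurable_funX.
move=> x _; rewrite /= lee_fin normrM (ger0_norm (f0 x)).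
rewrite [leRHS]ger0_norm; last by rewrite addr_ge0// mulr_ge0// powR_ge0.
by rewrite -{2}(mul1r (f x)) -mulrDl ler_wpM2r// norm_pow_le.
Qed.

Lemma moment0 : moment f 0 = 1.
Proof. by rewrite /moment /Rintegral; under eq_integral do rewrite mul1r; rewrite f1. Qed.

Section OneVariable.
Variable X : T -> R.
Hypotheses (mX : measurable_fun setT X) (Xf : has_density P f X).

Lemma L1_pow q : (q <= q0)%N -> L1 P (fun w => X w ^+ q).
Proof.
move=> qq0; apply: (L1_density mX mf f0 Xf (h := fun x => x ^+ q)).
  exact: measurable_funX.
exact: integrable_pow.
Qed.

Lemma Ex_pow q : (q <= q0)%N -> \int[P]_w (X w ^+ q) = moment f q.
Proof.
move=> qq0; apply: (Ex_density mX mf f0 Xf (h := fun x => x ^+ q)).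
  exact: measurable_funX.
exact: integrable_pow.
Qed.

Hypothesis fsym : forall s : R, complex.Im (charfun f s) = 0.

Lemma Ex_sin s : \int[P]_w sin (s * X w) = 0.
Proof.
have mh : measurable_fun setT (fun x : R => sin (s * x)).
  by apply: measurable_sin_comp; exact: measurable_funM.
rewrite (Ex_density mX mf f0 Xf (h := fun x => sin (s * x)))//; first exact: fsym.
apply: (integrable_density mX mf f0 Xf) => //.
apply: (@L1_bounded _ _ _ _ _ 1); last by move=> w; exact: sin_max.
by apply: measurable_sin_comp; exact: measurable_funM.
Qed.

(* product-to-sum formulas reduce the exponent by two at each step *)
Lemma Ex_sin_pow_sin (s : R) (m : nat) a :
  \int[P]_w (sin (s * X w) ^+ (2 * m) * sin (a * X w)) = 0.
Proof.
have mS b : measurable_fun setT (fun w => sin (b * X w)).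
  by apply: measurable_sin_comp; exact: measurable_funM.
have L m' b : L1 P (fun w => sin (s * X w) ^+ (2 * m') * sin (b * X w)).
  apply: (@L1_bounded _ _ _ _ _ 1).
    by apply: measurable_funM => //; exact: measurable_funX.
  move=> w; rewrite normrM normrX -[leRHS]mulr1 ler_pM ?exprn_ge0 ?sin_max//.
  by rewrite exprn_ile1 ?sin_max.
elim: m a => [|m IHm] a.
  by under eq_Rintegral do rewrite mul1r; exact: Ex_sin.
transitivity (\int[P]_w
    (2^-1 * (sin (s * X w) ^+ (2 * m) * sin (a * X w)) +
    (- 4^-1 * (sin (s * X w) ^+ (2 * m) * sin ((a + 2 * s) * X w)) +
     - 4^-1 * (sin (s * X w) ^+ (2 * m) * sin ((a - 2 * s) * X w))))).
  apply: eq_Rintegral => w _; set x := X w.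
  have -> : (a + 2 * s) * x = a * x + (s * x + s * x) by ring.
  have -> : (a - 2 * s) * x = a * x - (s * x + s * x) by ring.
  rewrite sinB !sinD !cosD (_ : (2 * m.+1)%N = (2 * m).+2); last by lia.
  rewrite !exprS.
  have c2 := cos2Dsin2 (s * x).
  set S := sin (s * x) in c2 *; set A := sin (a * x); set C := cos (s * x) in c2 *.
  have {c2} c2 : C * C = 1 - S * S by rewrite -!expr2; lra.
  rewrite c2; by field.
rewrite ExD; [|exact: L1Zl|by apply: L1D; exact: L1Zl].
by rewrite ExD; [|exact: L1Zl..]; rewrite !ExZl// !IHm !mulr0 !addr0.
Qed.

Lemma Ex_sin_odd (s : R) (m : nat) : odd m -> \int[P]_w (sin (s * X w) ^+ m) = 0.
Proof.
move=> om; rewrite -(Ex_sin_pow_sin s m./2 s); apply: eq_Rintegral => w _.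
by rewrite -exprSr mul2n -{1}(odd_double_half m) om.
Qed.

Lemma cvg_scaled_sin (x : R) : n.+1%:R * sin (n.+1%:R^-1 * x) @[n --> \oo] --> x.
Proof.
apply/cvgrPdist_le => e e0; near=> n.
have n0 : 0 < n.+1%:R :> R by rewrite ltr0n.
have := sin_taylor1 0 (n.+1%:R^-1 * x).
rewrite add0r sin0 cos0 subr0 mulr1 => h.
rewrite distrC (_ : _ - x = n.+1%:R * (sin (n.+1%:R^-1 * x) - n.+1%:R^-1 * x)); last first.
  by rewrite mulrBr mulVKf// gt_eqF.
rewrite normrM gtr0_norm//; apply: (le_trans (ler_wpM2l (ltW n0) h)).
rewrite exprMn mulrA exprVn expr2 invfM mulVKf ?gt_eqF//.
rewrite mulrC ler_pdivrMr//; near: n.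
have := nbhs_infty_ger (x ^+ 2 / e); apply: filterS => n h.
rewrite -ler_pdivrMl// mulrC; apply: (le_trans h); by rewrite ler_nat.
Unshelve. all: by end_near. Qed.

(** A real characteristic function says that sines of [X] have mean zero, hence so do odd powers of
    sines. The power [x^q] is the limit of [(n sin(x / n))^q], dominated by [|x|^q], so neither
    symmetry of the law nor derivatives of the characteristic function have to be discussed. *)
Lemma moment_odd q : odd q -> (q <= q0)%N -> moment f q = 0.
Proof.
move=> oq qq0; rewrite -Ex_pow//.
have L := L1_pow qq0.
have mS n : measurable_fun setT (fun w => (n.+1%:R * sin (n.+1%:R^-1 * X w)) ^+ q).
  apply: measurable_funX; apply: measurable_funM => //.
  by apply: measurable_sin_comp; exact: measurable_funM.
have [|||||_ _ H] := @dominated_convergence _ _ _ P setT measurableT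
  (fun n w => ((n.+1%:R * sin (n.+1%:R^-1 * X w)) ^+ q)%:E)
  (fun w => (X w ^+ q)%:E) (fun w => `|X w ^+ q|%:E).
- by move=> n; exact/measurable_EFinP.
- by apply/measurable_EFinP; exact: measurable_funX.
- apply: aeW => w _; apply: cvg_EFin; first exact: nearW.
  suff cm m : (n.+1%:R * sin (n.+1%:R^-1 * X w)) ^+ m @[n --> \oo] --> X w ^+ m by exact: cm.
  elim: m => [|m IHm]; first exact: cvg_cst.
  under eq_fun do rewrite exprS; rewrite exprS.
  by apply: cvgM IHm; exact: cvg_scaled_sin.
- exact: L1_norm.
- apply: aeW => w n _; rewrite lee_fin !normrX lerXn2r ?nnegrE//.
  have n0 : 0 < n.+1%:R :> R by rewrite ltr0n.
  rewrite normrM gtr0_norm// -ler_pdivlMl//.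
  have := sinB_le (n.+1%:R^-1 * X w) 0.
  by rewrite sin0 !subr0 normrM gtr0_norm// invr_gt0.
have {}H : (\int[P]_w (X w ^+ q)%:E = 0)%E.
  apply/esym; move: H; set u := (X in X @ \oo --> _) => H.
  have u0 : u = fun=> 0%E.
    apply/funext => n; rewrite /u /=.
    have Ln : L1 P (fun w => sin (n.+1%:R^-1 * X w) ^+ q).
      apply: (@L1_bounded _ _ _ _ _ 1).
        by apply: measurable_funX; apply: measurable_sin_comp; exact: measurable_funM.
      by move=> w; rewrite normrX exprn_ile1 ?sin_max.
    under eq_integral do rewrite exprMn.
    by rewrite Ex_EFin ?ExZl ?Ex_sin_odd ?mulr0//; exact: L1Zl.
  rewrite u0 in H; apply: cvg_unique H => //.
  exact: cvg_cst.
by rewrite /Rintegral H.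
Qed.

End OneVariable.

Definition diff_moment_sum q : R :=
  \sum_(i < q.+1) ((-1) ^+ i * moment f (q - i) * moment f i) *+ 'C(q, i).

Lemma diff_momentE q : (q <= q0)%N -> diff_moment f q = diff_moment_sum q.
Proof.
move=> qq0; rewrite /diff_moment /diff_moment_sum.
have ipow i : (i <= q)%N -> mu.-integrable setT (EFin \o (fun x => x ^+ i * f x)).
  by move=> iq; apply: integrable_pow; exact: leq_trans qq0.
have tens (i : 'I_q.+1) := integrable_tensor (ipow _ (leq_subr i q)) (ipow _ (ltn_ord i)).
under eq_integral => z _.
  rewrite (_ : (_)%:E = (\sum_(i < q.+1) (((-1) ^+ i *+ 'C(q, i))%:E *
    ((z.1 ^+ (q - i) * f z.1) * (z.2 ^+ i * f z.2))%:E))%E); last first.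
    rewrite exprBn mulr_suml -sumEFin; apply: eq_bigr => i _.
    by rewrite -EFinM; congr (_%:E); rewrite !mulrnAl; congr (_ *+ _); ring.
  over.
rewrite integral_sum//; last by move=> i; apply: integrableZl => //; exact: (tens i).1.
rewrite -sum_fine; last first.
  move=> i _; rewrite integralZl//; last exact: (tens i).1.
  by rewrite (tens i).2.
apply: eq_bigr => i _; rewrite integralZl//; last exact: (tens i).1.
by rewrite (tens i).2 /= mulrnAl mulrA.
Qed.

(** The expectation and the double integral [diff_moment] both expand to the binomial sum
    [diff_moment_sum], so the joint law of [X] and [Y] is never computed. *)
Lemma Ex_diff_pow X Y G H q : (q <= q0)%N ->
  measurable_fun setT X -> measurable_fun setT Y ->
  has_density P f X -> has_density P f Y ->
  independent_sigma P G H -> measurable_wrt G X -> measurable_wrt H Y ->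
  sigma_algebra setT G -> sigma_algebra setT H ->
  L1 P (fun w => (X w - Y w) ^+ q) /\ \int[P]_w ((X w - Y w) ^+ q) = diff_moment f q.
Proof.
move=> qq0 mX mY Xf Yf GH GX HY sG sH.
have tens (i : 'I_q.+1) : L1 P (fun w => X w ^+ (q - i) * Y w ^+ i) /\
    \int[P]_w (X w ^+ (q - i) * Y w ^+ i) = moment f (q - i) * moment f i.
  have i1 : (q - i <= q0)%N by rewrite (leq_trans (leq_subr _ _)).
  have i2 : (i <= q0)%N by rewrite (leq_trans _ qq0)// -ltnS.
  rewrite -(Ex_pow mX Xf i1) -(Ex_pow mY Yf i2); apply: (Ex_indep GH).
  - by apply: (measurable_wrt_comp sG (h := fun x => x ^+ (q - i))) => //; exact: measurable_funX.
  - by apply: (measurable_wrt_comp sH (h := fun x => x ^+ i)) => //; exact: measurable_funX.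
  - exact: L1_pow.
  - exact: L1_pow.
have E : (fun w => (X w - Y w) ^+ q) = (fun w => \sum_(i < q.+1)
    ((-1) ^+ i *+ 'C(q, i)) * (X w ^+ (q - i) * Y w ^+ i)).
  apply/funext => w; rewrite exprBn; apply: eq_bigr => i _.
  by rewrite mulrnAl mulrA.
rewrite E diff_momentE//; split.
  by apply: L1_sum => i _; apply: L1Zl; exact: (tens i).1.
rewrite Ex_sum; last by move=> i _; apply: L1Zl; exact: (tens i).1.
apply: eq_bigr => i _; rewrite ExZl; last exact: (tens i).1.
by rewrite (tens i).2 mulrnAl mulrA.
Qed.

Hypothesis moment_odd0 : forall q, odd q -> (q <= q0)%N -> moment f q = 0.

Lemma diff_moment_odd q : odd q -> (q <= q0)%N -> diff_moment f q = 0.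
Proof.
move=> oq qq0; rewrite diff_momentE// /diff_moment_sum big1// => i _.
have iq : (i <= q)%N by rewrite -ltnS.
have [oi|ei] := boolP (odd i).
  by rewrite (moment_odd0 oi) ?mulr0 ?mul0rn// (leq_trans iq).
rewrite (_ : moment f (q - i) = 0) ?mulr0 ?mul0r ?mul0rn//.
apply: moment_odd0; first by rewrite oddB// oq (negbTE ei).
by rewrite (leq_trans (leq_subr _ _)).
Qed.

Lemma sum_even (F : nat -> R) l : (forall i, odd i -> (i < 2 * l)%N -> F i = 0) ->
  \sum_(0 <= i < (2 * l).+1) F i = \sum_(0 <= j < l.+1) F (2 * j)%N.
Proof.
elim: l => [|l IHl] F0; first by rewrite muln0 !big_nat1.
rewrite (_ : (2 * l.+1).+1 = (2 * l).+3); last by lia.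
rewrite big_nat_recr// big_nat_recr//= IHl; last by move=> i oi il; apply: F0 => //; lia.
rewrite (F0 (2 * l).+1) ?addr0; last 2 first.
- by rewrite /= mul2n odd_double.
- by lia.
by rewrite [in RHS]big_nat_recr//= mulnS.
Qed.

(** The identity that the recursion for [moment_hat] inverts: in the binomial expansion the odd
    terms vanish and the two end terms together give [2 * moment f (2 * l)]. *)
Lemma diff_moment_even l : (0 < l)%N -> (2 * l <= q0)%N ->
  diff_moment f (2 * l) = 2 * moment f (2 * l) +
  \sum_(1 <= j < l) 'C(2 * l, 2 * j)%:R * moment f (2 * j) * moment f (2 * (l - j)).
Proof.
move=> l0 lq; rewrite diff_momentE// /diff_moment_sum.
pose F i := ((-1) ^+ i * moment f (2 * l - i) * moment f i) *+ 'C(2 * l, i).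
rewrite -(big_mkord xpredT F) sum_even; last first.
  move=> i oi il; rewrite /F (moment_odd0 oi) ?mulr0 ?mul0rn//; lia.
rewrite big_nat_recr//= big_ltn// /F !muln0 !subn0 subnn !bin0 binn moment0 !mulr1n.
rewrite expr0 exprM sqrrN expr1n expr1n !mul1r mulr1 -addrA addrC -addrA.
rewrite [RHS]addrC; congr (_ + _); last by rewrite mulr_natl mulr2n.
apply: eq_big_nat => j /andP[j1 jl].
rewrite exprM sqrrN expr1n expr1n mul1r mulnBr -mulrnAl -mulr_natl -mulrA.
by rewrite [X in _ * X]mulrC mulrA.
Qed.

End Moments.

(** * Close pairs of grid points *)

Section Neighbours.
Context {R : realType}.
Variables (n : nat) (t : nat -> R) (xi : R).
Hypothesis t_incr : forall j, (j < n)%N -> t j < t j.+1.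
Implicit Types j l : 'I_n.+1.
Local Notation kappa := (nbr_max n t xi).
Local Notation N := (nbr_total n t xi).

Definition close : pred ('I_n.+1 * 'I_n.+1) := [pred e | e.2 \in nbr t xi e.1].

Lemma close_sym j l : close (j, l) = close (l, j).
Proof. by rewrite /close /= !inE eq_sym distrC. Qed.

Lemma close_neq e : close e -> e.1 != e.2.
Proof. by rewrite /close /= inE eq_sym => /andP[]. Qed.

Lemma close_dist e : close e -> `|t e.2 - t e.1| <= xi.
Proof. by rewrite /close /= inE => /andP[]. Qed.

Lemma card_closer j : #|[pred l | close (j, l)]| = #|nbr t xi j|.
Proof. by apply: eq_card => l; rewrite inE. Qed.

Lemma card_closel j : #|[pred l | close (l, j)]| = #|nbr t xi j|.
Proof. by rewrite -card_closer; apply: eq_card => l; rewrite !inE close_sym. Qed.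

Lemma nbr_sumE (h : R -> R) (y : nat -> R) :
  nbr_sum n t xi h y = \sum_(e | close e) h (y e.2 - y e.1).
Proof. by rewrite /nbr_sum pair_big_dep. Qed.

Lemma card_close : #|close| = N.
Proof.
rewrite -sum1_card /nbr_total; under [RHS]eq_bigr do rewrite -sum1_card.
by rewrite pair_big_dep.
Qed.

Lemma grid_le (i j : nat) : (i <= j)%N -> (j <= n)%N -> t i <= t j.
Proof.
move=> ij; elim: j ij => [|j IHj]; first by rewrite leqn0 => /eqP ->.
rewrite leq_eqVlt => /predU1P[->//|]; rewrite ltnS => ij jn.
by apply: le_trans (ltW (t_incr jn)); apply: IHj => //; exact: ltnW.
Qed.

(** The maximum [nbr_max] leaves out the index 0. A neighbour of 0 other than 1 lies to the right of
    the first step, hence is also a neighbour of 1, and 0 and 1 are neighbours of each other or not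
    at all. *)
Lemma card_nbr_le j : (#|nbr t xi j| <= kappa)%N.
Proof.
have pos (i : 'I_n.+1) : (0 < i)%N -> (#|nbr t xi i| <= kappa)%N.
  move=> i0; rewrite /nbr_max (bigD1 i)//=; exact: leq_maxl.
have [/pos//|] := ltnP 0 j; rewrite leqn0 => /eqP j0.
case: (posnP n) => [n0|n0].
  rewrite (_ : nbr t xi j = finset.set0) ?cards0//.
  apply/setP => l; rewrite !inE; case: eqP => //= lj; case: lj; apply: val_inj => /=.
  by have := ltn_ord l; have := ltn_ord j; lia.
pose o : 'I_n.+1 := inord 1.
have o1 : o = 1%N :> nat by rewrite inordK.
apply: leq_trans (pos o _); last by rewrite o1.
have jo : (j == o) = false by apply/negbTE/eqP => E; move: j0; rewrite E o1.
have sym : (o \in nbr t xi j) = (j \in nbr t xi o).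
  exact: (close_sym j o).
rewrite (cardsD1 o) [leqRHS](cardsD1 j) sym leq_add2l.
apply: subset_leq_card; apply/fintype.subsetP => l; rewrite !inE => /and3P[lo lj].
rewrite lj lo /= j0 o1 => h.
have l1 : (1 <= l)%N by rewrite lt0n; apply: contra lj => /eqP l0; apply/eqP/val_inj; rewrite /= l0.
have ln : (l <= n)%N by rewrite -ltnS.
have h1 := grid_le l1 ln; have h0 := grid_le (leq0n 1) n0.
rewrite ger0_norm; last by rewrite subr_ge0.
apply: le_trans h; rewrite ger0_norm; last by rewrite subr_ge0 (le_trans h0).
by rewrite lerD2l lerN2.
Qed.

Lemma nbr_min_le j : (0 < j)%N -> (nbr_min n t xi <= #|nbr t xi j|)%N.
Proof.
move=> j0; rewrite /nbr_min; have := mem_index_enum j.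
elim: (index_enum _) => // i s IHs; rewrite in_cons big_cons => /predU1P[<-|js].
  by rewrite j0 geq_minl.
by case: ifP => _; [apply: (leq_trans (geq_minr _ _)); exact: IHs|exact: IHs].
Qed.

Lemma nbr_total_ge : (n * nbr_min n t xi <= N)%N.
Proof.
rewrite /nbr_total big_ord_recl /=; apply: leq_trans (leq_addl _ _).
rewrite -{1}(card_ord n) -sum_nat_const; apply: leq_sum => i _.
exact: nbr_min_le.
Qed.

(* A close pair separated by the step [i] consists of a neighbour of each of the
   two endpoints of this step. *)
Lemma card_crossing (i : nat) : (i < n)%N ->
  (#|[pred e | close e & (e.1 <= i < e.2)%N]| <= kappa ^ 2)%N.
Proof.
move=> i_n; pose a : 'I_n.+1 := inord i; pose b : 'I_n.+1 := inord i.+1.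
have ai : a = i :> nat by rewrite inordK// ltnW.
have bi : b = i.+1 :> nat by rewrite inordK.
apply: (@leq_trans #|finset.setX (nbr t xi b) (nbr t xi a)|); last first.
  by rewrite cardsX leq_mul ?card_nbr_le.
apply: subset_leq_card; apply/fintype.subsetP => -[j l]; rewrite !inE/=.
rewrite /close /= inE => /and3P[/andP[lj h] ji il].
have jn : (j <= n)%N by rewrite -ltnS. have ln : (l <= n)%N by rewrite -ltnS.
have h1 := grid_le ji (ltnW i_n); have h2 := grid_le il ln.
have h3 := ltW (t_incr i_n).
rewrite ger0_norm in h; last by rewrite subr_ge0 (le_trans h1)// (le_trans h3).
rewrite ai bi; apply/andP; split; apply/andP; split.
- by apply/eqP => E; have : (j : nat) = i.+1 by [rewrite E bi]; lia.
- by rewrite ler0_norm ?opprB; lra.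
- by apply/eqP => E; have : (l : nat) = i by [rewrite E ai]; lia.
- by rewrite ger0_norm; lra.
Qed.

(** Each increment is split into the steps between its two points, and the sums are exchanged: a
    step is crossed by at most [kappa ^ 2] close pairs in each of the two directions. *)
Lemma close_variation (a : nat -> R) : (forall i, (i < n)%N -> a i <= a i.+1) ->
  \sum_(e | close e) `|a e.2 - a e.1| <= 2 * kappa%:R ^+ 2 * (a n - a 0).
Proof.
move=> a_incr.
have tele (j l : nat) : (j <= l)%N -> (l <= n)%N ->
    a l - a j = \sum_(i < n) (if (j <= i < l)%N then a i.+1 - a i else 0).
  move=> jl; elim: l jl => [|l IHl].
    rewrite leqn0 => /eqP -> _; rewrite subrr big1// => i _; rewrite ifF//; lia.
  rewrite leq_eqVlt => /predU1P[<- _|].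
    by rewrite subrr big1// => i _; rewrite ifF//; lia.
  rewrite ltnS => jl ln; pose o := Ordinal ln.
  transitivity (\sum_(i < n) ((if (j <= i < l)%N then a i.+1 - a i else 0) +
      (if i == o then a i.+1 - a i else 0))).
    rewrite big_split/= -(IHl jl (ltnW ln)) (bigD1 o)//= eqxx big1; first by ring.
    by move=> i /negbTE ->.
  apply: eq_bigr => i _; rewrite -val_eqE /=.
  have [il|il|->] := ltngtP i l; rewrite ?andbF ?andbT ?addr0 ?add0r.
  - by rewrite ltnS (ltnW il) andbT.
  - by rewrite ifF//; lia.
  - by rewrite ltnS leqnn jl.
have da (i : 'I_n) : 0 <= a i.+1 - a i by rewrite subr_ge0 a_incr.
apply: (@le_trans _ _ (\sum_(e | close e) \sum_(i < n)
   ((if (e.1 <= i < e.2)%N then a i.+1 - a i else 0) +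
    (if (e.2 <= i < e.1)%N then a i.+1 - a i else 0)))).
  apply: ler_sum => -[j l] _ /=.
  have jn : (j <= n)%N by rewrite -ltnS. have ln : (l <= n)%N by rewrite -ltnS.
  rewrite big_split/=; have [jl|/ltnW lj] := leqP j l.
    rewrite tele// [X in _ + X]big1 ?addr0 ?ger0_norm//.
      by apply: sumr_ge0 => i _; case: ifP.
    by move=> i _; rewrite ifF//; lia.
  rewrite distrC tele// [X in X + _]big1 ?add0r ?ger0_norm//.
    by apply: sumr_ge0 => i _; case: ifP.
  by move=> i _; rewrite ifF//; lia.
rewrite exchange_big/= -(telescope_sumr _ (leq0n n)) big_mkord mulr_sumr.
have cnt (i : 'I_n) (Q : pred ('I_n.+1 * 'I_n.+1)) :
    (#|[pred e | close e & Q e]| <= kappa ^ 2)%N ->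
    \sum_(e | close e) (if Q e then a i.+1 - a i else 0) <= kappa%:R ^+ 2 * (a i.+1 - a i).
  move=> h; apply: (@le_trans _ _ (#|[pred e | close e & Q e]|%:R * (a i.+1 - a i))).
    by rewrite -big_mkcondr sumr_const mulr_natl.
  by rewrite ler_wpM2r// -natrX ler_nat.
apply: ler_sum => i _; rewrite big_split/= mulr_natl mulr2n mulrDl; apply: lerD.
  by apply: cnt; exact: card_crossing.
apply: (cnt i (fun e => e.2 <= i < e.1)%N).
rewrite -(card_in_image (f := fun e => (e.2, e.1))); last by move=> [? ?] [? ?] _ _ [-> ->].
apply: leq_trans (card_crossing (ltn_ord i)); apply: subset_leq_card.
apply/fintype.subsetP => e /fintype.imageP[[j l]]; rewrite inE /= => /andP[jl h] ->.
by rewrite inE /= close_sym jl.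
Qed.

End Neighbours.

(** * Orders of magnitude of the neighbourhood counts and of the bandwidth *)

Section Asymptotics.
Context {R : realType}.
Variables (t : nat -> nat -> R) (xi : nat -> R).
Hypothesis t_incr : forall n j, (j < n)%N -> t n j < t n j.+1.
Hypothesis xi_gt0 : forall n, 0 < xi n.
Hypothesis nbr_max_min : asymp (R := R) (fun n => (nbr_max n (t n) (xi n))%:R)
                       (fun n => (nbr_min n (t n) (xi n))%:R).
Hypothesis nbr_min_nxi : asymp (R := R) (fun n => (nbr_min n (t n) (xi n))%:R)
                       (fun n => n%:R * xi n).
Local Notation kappa n := (nbr_max n (t n) (xi n))%:R.
Local Notation N n := (nbr_total n (t n) (xi n))%:R.

Lemma nbr_total_gt0 n : (0 < n)%N -> (0 < nbr_total n (t n) (xi n))%N.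
Proof.
move=> n0; have [c1 [c2 [c10 _ H]]] := nbr_max_min.
apply: leq_trans (nbr_total_ge _ _ _); rewrite muln_gt0 n0 lt0n.
(* A vanishing minimum would make the ratio 0, as the inverse of 0 is 0, against the positive lower
   constant of [asymp]. *)
apply/eqP => m0; have := H n n0; rewrite m0 invr0 mulr0 => /andP[h _].
by have := lt_le_trans c10 h; rewrite ltxx.
Qed.

(** The indices from 1 to [n] alone contribute at least [n] times the smallest neighbourhood to the
    total, and the smallest is comparable to the largest. *)
Lemma nbr_max_le_total : exists2 C : R, 0 < C &
  forall n, (0 < n)%N -> kappa n * n%:R <= C * N n.
Proof.
have [c1 [c2 [c10 c20 H]]] := nbr_max_min; exists c2 => // n n0.
have m0 : 0 < (nbr_min n (t n) (xi n))%:R :> R.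
  rewrite ltr0n lt0n; apply/eqP => m0; have := H n n0; rewrite m0 invr0 mulr0 => /andP[h _].
  by have := lt_le_trans c10 h; rewrite ltxx.
have /andP[_] := H n n0; rewrite ler_pdivrMr// => h.
apply: (@le_trans _ _ (c2 * (nbr_min n (t n) (xi n))%:R * n%:R)).
  by rewrite ler_wpM2r.
rewrite -mulrA ler_wpM2l ?(ltW c20)//.
by rewrite -natrM ler_nat mulnC; exact: nbr_total_ge.
Qed.

Lemma nbr_max_le_bandwidth : exists2 C : R, 0 < C &
  forall n, (0 < n)%N -> kappa n <= C * (n%:R * xi n).
Proof.
have [c1 [c2 [c10 c20 H]]] := nbr_max_min.
have [c1' [c2' [c10' c20' H']]] := nbr_min_nxi.
exists (c2 * c2'); first exact: mulr_gt0.
move=> n n0; have m0 : 0 < (nbr_min n (t n) (xi n))%:R :> R.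
  rewrite ltr0n lt0n; apply/eqP => m0; have := H n n0; rewrite m0 invr0 mulr0 => /andP[h _].
  by have := lt_le_trans c10 h; rewrite ltxx.
have nx : 0 < n%:R * xi n by rewrite mulr_gt0// ltr0n.
have /andP[_] := H n n0; rewrite ler_pdivrMr// => h.
have /andP[_] := H' n n0; rewrite ler_pdivrMr// => h'.
by apply: (le_trans h); rewrite -mulrA ler_wpM2l// ltW.
Qed.

Lemma scale_variance_bound : exists C : R, \forall n \near \oo,
  N n * (4 * nbr_max n (t n) (xi n))%:R * (Num.sqrt n%:R / N n) ^+ 2 <= C.
Proof.
have [C C0 HC] := nbr_max_le_total; exists (4 * C); near=> n.
have n0 : (0 < n)%N by near: n; exact: nbhs_infty_gt.
have N0 : 0 < N n :> R by rewrite ltr0n nbr_total_gt0.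
rewrite exprMn sqr_sqrtr// natrM.
have -> : N n * (4 * kappa n) * (n%:R * (N n)^-1 ^+ 2) = 4 * ((kappa n * n%:R) / N n) :> R.
  by field; rewrite gt_eqF.
by rewrite ler_pM2l// ler_pdivrMr// HC.
Unshelve. all: by end_near. Qed.

(** The product equals [16 (kappa n / N)^2 / sqrt n], and [kappa n / N] is bounded by
    [nbr_max_le_total]. *)
Lemma scale_third_order :
  N n * (4 * nbr_max n (t n) (xi n))%:R ^+ 2 * (Num.sqrt n%:R / N n) ^+ 3
    @[n --> \oo] --> (0 : R).
Proof.
have [C C0 HC] := nbr_max_le_total; apply/cvgrPdist_le => e e0; near=> n.
have n0 : (0 < n)%N by near: n; exact: nbhs_infty_gt.
have n0R : 0 < n%:R :> R by rewrite ltr0n.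
have N0 : 0 < N n :> R by rewrite ltr0n nbr_total_gt0.
set s := Num.sqrt n%:R; have s0 : 0 < s by rewrite sqrtr_gt0.
have s2 : s ^+ 2 = n%:R by rewrite sqr_sqrtr.
rewrite sub0r normrN ger0_norm; last first.
  by apply: mulr_ge0; [exact: mulr_ge0|rewrite exprn_ge0// divr_ge0// ltW].
rewrite natrM.
have -> : N n * (4 * kappa n) ^+ 2 * (s / N n) ^+ 3 =
    16 * ((kappa n * n%:R) / N n) ^+ 2 / s :> R.
  by rewrite -s2; field; rewrite !gt_eqF.
rewrite ler_pdivrMr//; apply: (@le_trans _ _ (16 * C ^+ 2)).
  rewrite ler_pM2l// lerXn2r ?nnegrE ?divr_ge0 ?mulr_ge0 ?(ltW C0)//.
  by rewrite ler_pdivrMr// HC.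
rewrite -ler_pdivrMl//; apply: (@le_trans _ _ (Num.sqrt ((e^-1 * (16 * C ^+ 2)) ^+ 2))).
  by rewrite sqrtr_sqr ler_norm.
by rewrite /s ler_wsqrtr//; near: n; exact: nbhs_infty_ger.
Unshelve. all: by end_near. Qed.

(** The exponent [p / (2 (p - 1))] is larger than 1/2; this turns the bandwidth condition into the
    rate which makes the signal negligible. *)
Lemma sqrt_bandwidth_cvg0 (p : R) : 2 < p <= 3 ->
  (xi : nat -> R^o) =o_\oo (fun n => n%:R `^ (- (p / (2 * (p - 1)))) : R^o) ->
  Num.sqrt n%:R * xi n @[n --> \oo] --> (0 : R).
Proof.
move=> /andP[p2 p3] /eqoP oxi; apply/cvgrPdist_le => e e0.
have := oxi e e0; apply: filter_app; near=> n.
have n0 : (0 < n)%N by near: n; exact: nbhs_infty_gt.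
have n1 : 1 <= n%:R :> R by rewrite ler1n.
have n0R : 0 < n%:R :> R by rewrite ltr0n.
rewrite /= => h; rewrite sub0r normrN ger0_norm ?mulr_ge0 ?sqrtr_ge0 ?(ltW (xi_gt0 n))//.
have {}h : xi n <= e * n%:R `^ (- 2^-1).
  have : xi n <= e * n%:R `^ (- (p / (2 * (p - 1)))).
    by move: h; rewrite !ger0_norm ?powR_ge0// ltW.
  move=> /le_trans; apply; rewrite ler_pM2l// ler_powR// lerN2.
  have p1 : 0 < 2 * (p - 1) by lra.
  by rewrite ler_pdivlMr//; lra.
apply: (le_trans (ler_wpM2l (sqrtr_ge0 _) h)).
rewrite mulrCA -powR12_sqrt; last exact: ltW.
by rewrite powRN mulfV ?mulr1// gt_eqF// powR_gt0.
Unshelve. all: by end_near. Qed.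

End Asymptotics.

(** * Simple stochastic integrals *)

Section BrownianIntegral.
Context {R : realType} {d : measure_display} {Omega : measurableType d}.
Variables (P : probability Omega R) (T : R) (F : R -> set (set Omega)).
Variable B : R -> Omega -> R.
Hypotheses (F_filtration : filtration T F) (B_brownian : brownian P T F B).
Implicit Types (s t u : R) (Y : Omega -> R).

Lemma filtration_sigma t : 0 <= t <= T -> sigma_algebra setT (F t).
Proof. by move=> tT; have [/(_ t tT)[]] := F_filtration. Qed.

Lemma filtration_measurable t : 0 <= t <= T -> F t `<=` measurable.
Proof. by move=> tT; have [/(_ t tT)[]] := F_filtration. Qed.

Lemma filtrationS s t : 0 <= s -> s <= t -> t <= T -> F s `<=` F t.
Proof. by have [_] := F_filtration; apply. Qed.

Lemma adapted_measurable (H : R -> Omega -> R) t : adapted T F H -> 0 <= t <= T ->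
  measurable_fun setT (H t).
Proof.
move=> aH tT; exact: measurable_wrt_fun (filtration_measurable tT) (aH t tT).
Qed.

(** Equal times are included, because clamping the times of a simple process to a shorter interval
    produces steps of length zero. *)
Lemma brownian_increment_indep Y s t : 0 <= s -> s <= t -> t <= T ->
  measurable_wrt (F s) Y -> L1 P Y ->
  [/\ L1 P (fun w => Y w * (B t w - B s w)),
      \int[P]_w (Y w * (B t w - B s w)) = 0,
      L1 P (fun w => Y w * (B t w - B s w) ^+ 2) &
      \int[P]_w (Y w * (B t w - B s w) ^+ 2) = (t - s) * \int[P]_w Y w].
Proof.
move=> s0; rewrite le_eqVlt => /predU1P[<- _ _ _|st tT FY LY].
  split; first by under eq_fun do rewrite subrr mulr0; exact: L1_cst.
  - by under eq_Rintegral do rewrite subrr mulr0; rewrite Ex_cst.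
  - by under eq_fun do rewrite subrr expr0n mulr0; exact: L1_cst.
  - by under eq_Rintegral do rewrite subrr expr0n mulr0; rewrite Ex_cst subrr mul0r.
have [aB _ /(_ s t s0 st tT)[law ind]] := B_brownian.
have sT : 0 <= s <= T by rewrite s0 (le_trans (ltW st)).
have tT' : 0 <= t <= T by rewrite tT (le_trans s0 (ltW st)).
set D := fun w => B t w - B s w.
have mD : measurable_fun setT D by apply: measurable_funB; exact: adapted_measurable.
have v0 : 0 <= t - s by rewrite subr_ge0 ltW.
have LD : L2 P D := centered_normal_L2 mD v0 law.
have HD : measurable_wrt (sigma_of setT (fun _ : unit => D)) D.
  exact: (@sigma_of_measurable _ _ _ _ _ (fun _ : unit => D) tt).
have HD2 : measurable_wrt (sigma_of setT (fun _ : unit => D)) (fun w => D w ^+ 2).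
  apply: (measurable_wrt_comp (@sigma_of_sigma_algebra _ _ _ _ _ _) (h := fun x => x ^+ 2)) HD.
  exact: measurable_funX.
have [i1 e1] := Ex_indep ind FY HD LY (L2_L1 LD).
have [i2 e2] := Ex_indep ind FY HD2 LY LD.2.
split => //; first by rewrite e1 (centered_normal_mean mD v0 law) mulr0.
by rewrite e2 (centered_normal_variance mD v0 law) mulrC.
Qed.

Section Isometry.
Variables (alpha : nat -> R) (c : nat -> Omega -> R).
Hypothesis alpha0 : 0 <= alpha 0.

(** Induction on the number of steps: the partial sum times the new coefficient is known at the
    start of the new step, so the cross term has mean zero. Adaptedness of the partial sum is part
    of the statement for this reason. *)
Lemma brownian_isometry r :
  (forall i, (i < r)%N -> alpha i <= alpha i.+1) -> alpha r <= T ->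
  (forall i, (i < r)%N -> measurable_wrt (F (alpha i)) (c i)) ->
  (forall i, (i < r)%N -> exists K : R, forall w, `|c i w| <= K) ->
  let S w := \sum_(i < r) c i w * (B (alpha i.+1) w - B (alpha i) w) in
  [/\ measurable_wrt (F (alpha r)) S, L2 P S &
      \int[P]_w (S w ^+ 2) =
      \sum_(i < r) (alpha i.+1 - alpha i) * \int[P]_w (c i w ^+ 2)].
Proof.
elim: r => [|r IHr] a_incr aT mc cK /=.
  have E : (fun w => \sum_(i < 0) c i w * (B (alpha i.+1) w - B (alpha i) w)) = fun=> 0.
    by apply/funext => w; rewrite big_ord0.
  under eq_Rintegral do rewrite big_ord0 expr0n /=.
  rewrite E Ex_cst big_ord0; split => //; last exact: L2_cst.
  by apply: measurable_wrt_cst; apply: filtration_sigma; rewrite alpha0.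
have a_le := a_incr r (ltnSn r).
have aT' : alpha r <= T := le_trans a_le aT.
have [FS LS ES] := IHr (fun i ir => a_incr i (ltnW ir)) aT'
  (fun i ir => mc i (ltnW ir)) (fun i ir => cK i (ltnW ir)).
have pos i : (i <= r.+1)%N -> 0 <= alpha i.
  elim: i => // i IHi ir; apply: le_trans (a_incr i ir); apply: IHi; exact: ltnW.
have ar : 0 <= alpha r <= T by rewrite pos.
have ar1 : 0 <= alpha r.+1 <= T by rewrite pos.
have Fr := mc r (ltnSn r); have [K Kc] := cK r (ltnSn r).
have sF := filtration_sigma ar.
set S := fun w => \sum_(i < r) c i w * (B (alpha i.+1) w - B (alpha i) w) in FS LS ES.
set D := fun w => B (alpha r.+1) w - B (alpha r) w.
have mcr : measurable_fun setT (c r) := measurable_wrt_fun (filtration_measurable ar) Fr.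
have [aB _ _] := B_brownian.
have E : (fun w => \sum_(i < r.+1) c i w * (B (alpha i.+1) w - B (alpha i) w)) =
    fun w => S w + c r w * D w.
  by apply/funext => w; rewrite big_ord_recr.
have K0 (w : Omega) : 0 <= K by exact: le_trans (normr_ge0 _) (Kc w).
have Fc2 : measurable_wrt (F (alpha r)) (fun w => c r w ^+ 2).
  by apply: (measurable_wrt_comp sF (h := fun x => x ^+ 2)) => //; exact: measurable_funX.
have Lc2 : L1 P (fun w => c r w ^+ 2).
  apply: (@L1_bounded _ _ _ _ _ (K ^+ 2)); first exact: measurable_funX.
  by move=> w; rewrite normrX lerXn2r ?nnegrE ?(K0 w).
have [_ _ i2 e2] := brownian_increment_indep (pos r (leqnSn r)) a_le aT Fc2 Lc2.
have LSc : L1 P (fun w => c r w * S w) by apply: L1M_bounded mcr Kc (L2_L1 LS).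
have FSc : measurable_wrt (F (alpha r)) (fun w => c r w * S w).
  exact: measurable_wrtM.
have [i1 e1 _ _] := brownian_increment_indep (pos r (leqnSn r)) a_le aT FSc LSc.
have mD : measurable_fun setT D.
  by apply: measurable_funB; exact: adapted_measurable aB _.
have LcD : L2 P (fun w => c r w * D w).
  split; first exact: measurable_funM.
  by under eq_fun do rewrite exprMn.
rewrite big_ord_recr /= E; split.
- have Fle := filtrationS (pos r (leqnSn r)) a_le aT.
  have sF1 := filtration_sigma ar1.
  apply: (measurable_wrtD sF1); first exact: measurable_wrtS Fle FS.
  apply: (measurable_wrtM sF1); first exact: measurable_wrtS Fle Fr.
  apply: (measurable_wrtB sF1); first exact: aB.
  exact: measurable_wrtS Fle (aB _ ar).
- exact: L2D.
- transitivity (\int[P]_w (S w ^+ 2 + (2 * (c r w * S w * D w) + c r w ^+ 2 * D w ^+ 2))).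
    by apply: eq_Rintegral => w _; rewrite big_ord_recr /= -/(S w) -/(D w); ring.
  rewrite ExD; [|exact: LS.2|by apply: L1D => //; exact: L1Zl].
  by rewrite ExD ?ExZl//; [rewrite e1 e2 ES mulr0 add0r|exact: L1Zl].
Qed.

End Isometry.

Section SimpleProcess.
Variable S : simple_process (Omega := Omega) (R := R).
Hypothesis S_wf : simple_wf T F S.
Local Notation tau := (simple_time S).
Local Notation c := (simple_coef S).
Local Notation r := (simple_size S).

Lemma simple_time_le i j : (i <= j)%N -> (j <= r)%N -> tau i <= tau j.
Proof.
have [_ _ incr _] := S_wf.
elim: j => [|j IHj]; first by rewrite leqn0 => /eqP ->.
rewrite leq_eqVlt => /predU1P[->//|ij jr].
by apply: le_trans (incr j jr); apply: IHj => //; exact: ltnW.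
Qed.

Lemma simple_time_itv i : (i <= r)%N -> 0 <= tau i <= T.
Proof.
move=> ir; have [t0 tT _ _] := S_wf.
by rewrite (le_trans t0) ?simple_time_le//= (le_trans _ tT)// simple_time_le.
Qed.

(** The expected quadratic variation of the simple integral up to time [u]. It is monotone, so its
    increments over close pairs can be summed by [close_variation]. *)
Definition simple_clock u : R :=
  \sum_(i < r) (Num.min u (tau i.+1) - Num.min u (tau i)) * \int[P]_w (c i w ^+ 2).

Lemma simple_integral_increment s t w : s <= t ->
  simple_integral S B t w - simple_integral S B s w =
  \sum_(i < r) c i w * (B (Num.max s (Num.min t (tau i.+1))) w
                        - B (Num.max s (Num.min t (tau i))) w).
Proof.
move=> st; rewrite /simple_integral -sumrB; apply: eq_bigr => i _.
have H x : B (Num.min t x) w - B (Num.min s x) w = B (Num.max s (Num.min t x)) w - B s w.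
  have [xs|sx] := leP x s.
    by rewrite min_r ?(le_trans xs)// max_l// !subrr.
  by have [tx|xt] := leP t x; [rewrite max_r|rewrite max_r// ltW].
rewrite -mulrBr; congr (_ * _).
by have := H (tau i.+1); have := H (tau i); lra.
Qed.

Lemma clamp_length s t x y : s <= t -> x <= y ->
  Num.max s (Num.min t y) - Num.max s (Num.min t x) =
  (Num.min t y - Num.min t x) - (Num.min s y - Num.min s x).
Proof.
move=> st xy; rewrite /Order.max /Order.min.
case: (ltP t y) => ?; case: (ltP t x) => ?; case: (ltP s y) => ?; case: (ltP s x) => ?;
  try (case: (ltP s t) => ?); lra.
Qed.

Lemma simple_integral_isometry s t : 0 <= s -> s <= t -> t <= T ->
  L2 P (fun w => simple_integral S B t w - simple_integral S B s w) /\
  \int[P]_w ((simple_integral S B t w - simple_integral S B s w) ^+ 2) =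
  simple_clock t - simple_clock s.
Proof.
move=> s0 st tT; have [_ _ incr coef] := S_wf.
pose alpha i := Num.max s (Num.min t (tau i)).
(* A coefficient chosen after [t] is not known at its clamped time. Its increment is zero, so it may
   be replaced by 0. *)
pose c' i w := if tau i <= t then c i w else 0.
have E : (fun w => simple_integral S B t w - simple_integral S B s w) =
    fun w => \sum_(i < r) c' i w * (B (alpha i.+1) w - B (alpha i) w).
  apply/funext => w; rewrite simple_integral_increment//; apply: eq_bigr => i _.
  rewrite /c'; case: ifPn => //; rewrite -ltNge => ti.
  have ti' : t <= tau i.+1 by rewrite (le_trans (ltW ti))// incr.
  by rewrite (min_l ti') (min_l (ltW ti)) !subrr mulr0 mul0r.
have as_ i : s <= alpha i by rewrite /alpha le_max lexx.
have at_ i : alpha i <= t by rewrite /alpha ge_max st ge_min lexx.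
have a_incr i : (i < r)%N -> alpha i <= alpha i.+1.
  move=> ir; rewrite /alpha ge_max le_max lexx/= le_max; apply/orP; right.
  by rewrite le_min !ge_min lexx (incr i ir) orbT.
have [||||_ LS ES] := @brownian_isometry alpha c' (le_trans s0 (as_ 0%N)) r.
- exact: a_incr.
- exact: le_trans tT.
- move=> i ir; have ai : 0 <= alpha i <= T.
    by rewrite (le_trans s0 (as_ i)) (le_trans (at_ i)).
  have [ti _] := andP (simple_time_itv (ltnW ir)).
  rewrite /c'; case: (boolP (tau i <= t)) => [tit|_]; last exact: measurable_wrt_cst (filtration_sigma ai) _.
  apply: measurable_wrtS (coef i ir).1; apply: filtrationS => //.
    by rewrite /alpha min_r// le_max lexx orbT.
  by have [] := andP ai.
- move=> i ir; have [_ [K cK]] := coef i ir.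
  by exists `|K| => w; rewrite /c'; case: ifP; rewrite ?normr0// (le_trans (cK w))// ler_norm.
move: LS; rewrite /= -E => LS.
split => //; transitivity (\int[P]_w (\sum_(i < r) c' i w * (B (alpha i.+1) w - B (alpha i) w)) ^+ 2).
  by apply: eq_Rintegral => w _; have /(congr1 (fun h => h w)) /= -> := E.
rewrite ES /simple_clock -sumrB; apply: eq_bigr => i _.
rewrite -mulrBl /alpha clamp_length ?incr// /c'.
case: (boolP (tau i <= t)) => //; rewrite -ltNge => ti.
have ti' : t <= tau i.+1 by rewrite (le_trans (ltW ti))// incr.
rewrite (min_l ti') (min_l (ltW ti)) (min_l (le_trans st ti')) (min_l (le_trans st (ltW ti))).
by rewrite !subrr !mul0r.
Qed.

Lemma simple_clock_le s t : s <= t -> simple_clock s <= simple_clock t.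
Proof.
move=> st; have [_ _ incr _] := S_wf; rewrite -subr_ge0 /simple_clock -sumrB.
apply: sumr_ge0 => i _; rewrite -mulrBl mulr_ge0//; last by apply: Ex_ge0 => w; exact: sqr_ge0.
have ti := incr i (ltn_ord i).
rewrite -clamp_length// subr_ge0 ge_max le_max lexx/= le_max; apply/orP; right.
by rewrite le_min !ge_min lexx ti orbT.
Qed.

Definition simple_energy n w : R := \sum_(i < n) c i w ^+ 2 * (tau i.+1 - tau i).

Lemma simple_clockT (K : R) : (forall w, simple_energy r w <= K) ->
  simple_clock T - simple_clock 0 <= K.
Proof.
move=> HK; have [t0 tT incr coef] := S_wf.
have Lc i : (i < r)%N -> L1 P (fun w => c i w ^+ 2).
  move=> ir; have [mc [C cC]] := coef i ir.
  have mc' := measurable_wrt_fun (filtration_measurable (simple_time_itv (ltnW ir))) mc.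
  apply: (@L1_bounded _ _ _ _ _ (C ^+ 2)); first exact: measurable_funX.
  by move=> w; rewrite normrX lerXn2r ?nnegrE// (le_trans _ (cC w)).
have Le : L1 P (simple_energy r).
  by apply: L1_sum => i _; under eq_fun do rewrite mulrC; apply: L1Zl; exact: Lc.
rewrite (_ : _ - _ = \int[P]_w simple_energy r w).
  by rewrite -[leRHS](Ex_cst P); apply: Ex_le => //; exact: L1_cst.
rewrite Ex_sum; last first.
  by move=> i _; under eq_fun do rewrite mulrC; apply: L1Zl; exact: Lc.
rewrite /simple_clock -sumrB; apply: eq_bigr => i _.
under [RHS]eq_Rintegral do rewrite mulrC.
rewrite ExZl; last exact: Lc.
have /andP[a0 aT] := simple_time_itv (ltnW (ltn_ord i)).
have /andP[b0 bT] := simple_time_itv (ltn_ord i).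
by rewrite -mulrBl (min_r aT) (min_r bT) (min_l a0) (min_l b0) subrr subr0.
Qed.

(* The coefficients are switched off once the energy exceeds [K], which is
   known at the time at which they are chosen. *)
Definition truncated_process (K : R) := SimpleProcess r tau
  (fun i w => c i w * \1_[set w | simple_energy i.+1 w <= K] w).

End SimpleProcess.

Lemma truncated_wf S K : simple_wf T F S -> simple_wf T F (truncated_process S K).
Proof.
move=> S_wf; have [t0 tT incr coef] := S_wf; split => //= i ir.
have [mc [C cC]] := coef i ir; have ti := simple_time_itv S_wf (ltnW ir).
have sF := filtration_sigma ti; split; last first.
  exists `|C| => w; rewrite normrM -[leRHS]mulr1 ler_pM//.
    by apply: (le_trans (cC w)); exact: ler_norm.
  by rewrite indicE; case: (_ \in _); rewrite ?normr1 ?normr0.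
apply: (measurable_wrtM sF) => //; apply: (measurable_wrt_indic sF).
apply: (measurable_wrt_ler sF); last exact: measurable_wrt_cst.
apply: (measurable_wrt_sum sF) => j _; apply: (measurable_wrtM sF); last exact: measurable_wrt_cst.
have jr : (j < simple_size S)%N by exact: leq_trans (ltn_ord j) ir.
apply: (measurable_wrt_comp sF (h := fun x => x ^+ 2)); first exact: measurable_funX.
apply: measurable_wrtS (coef j jr).1.
have /andP[tj _] := simple_time_itv S_wf (ltnW jr).
by apply: filtrationS => //; [apply: simple_time_le => //; [rewrite -ltnS|exact: ltnW]|case/andP: ti].
Qed.

Lemma simple_energy_le S n m w : simple_wf T F S -> (n <= m)%N -> (m <= simple_size S)%N ->
  simple_energy S n w <= simple_energy S m w.
Proof.
move=> [_ _ incr _] nm mr; elim: m nm mr => [|m IHm]; first by rewrite leqn0 => /eqP ->.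
rewrite leq_eqVlt => /predU1P[->//|nm mr].
rewrite {2}/simple_energy big_ord_recr/= (le_trans (IHm nm (ltnW mr)))// lerDl.
by rewrite mulr_ge0 ?sqr_ge0// subr_ge0 incr.
Qed.

(** Induction on the number of steps: if the energy up to and including a step is at most [K], so is
    the truncated one; otherwise the coefficient of this step is switched off and adds nothing. *)
Lemma truncated_energy S K w : simple_wf T F S -> 0 <= K ->
  simple_energy (truncated_process S K) (simple_size S) w <= K.
Proof.
move=> S_wf K0; have [_ _ incr _] := S_wf.
have : (simple_size S <= simple_size S)%N by [].
elim: {1 3}(simple_size S) => [|n IHn] nr; first by rewrite /simple_energy big_ord0.
have [eK|Ke] := leP (simple_energy S n.+1 w) K.
  apply: le_trans eK; apply: ler_sum => i _; rewrite /= ler_wpM2r//.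
    by rewrite subr_ge0 incr// (leq_trans (ltn_ord i)).
  rewrite exprMn ler_piMr ?sqr_ge0// indicE; case: (_ \in _); rewrite ?expr1n ?expr0n//.
rewrite /simple_energy big_ord_recr/= [X in _ + X](_ : _ = 0) ?addr0; first exact: IHn (ltnW nr).
by rewrite indicE memNset ?mulr0 ?expr0n ?mul0r//= => ?; lra.
Qed.

Lemma truncated_integral S K w t : simple_wf T F S ->
  simple_energy S (simple_size S) w <= K ->
  simple_integral (truncated_process S K) B t w = simple_integral S B t w.
Proof.
move=> S_wf eK; apply: eq_bigr => i _ /=; congr (_ * _).
rewrite indicE mem_set ?mulr1//=; apply: le_trans eK.
exact: simple_energy_le (ltn_ord i) _.
Qed.

Lemma simple_valueE S s w : simple_wf T F S -> simple_value S s w ^+ 2 =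
  \sum_(i < simple_size S) simple_coef S i w ^+ 2
    * \1_(`]simple_time S i, simple_time S i.+1]) s.
Proof.
move=> S_wf; rewrite /simple_value expr2 big_distrlr; apply: eq_bigr => i _ /=.
rewrite (bigD1 i)//= [X in _ + X]big1 ?addr0.
  rewrite mulrACA -expr2 indicE; case: (_ \in _); rewrite ?mulr1 ?mulr0//.
move=> j ji; rewrite !indicE.
case: (boolP (s \in _)) => [si|_]; last by rewrite mulr0 mul0r.
case: (boolP (s \in _)) => [sj|_]; last by rewrite !mulr0.
move: si sj.
rewrite !inE /= !in_itv /= => /andP[h1 h2] /andP[h3 h4]; exfalso.
have := @simple_time_le S S_wf.
have [ij|ji'|E] := ltngtP i j; last by move: ji; rewrite (val_inj E) eqxx.
- by move=> /(_ i.+1 j ij (ltnW (ltn_ord j))); lra.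
- by move=> /(_ j.+1 i ji' (ltnW (ltn_ord i))); lra.
Qed.

Lemma simple_energyE S w : simple_wf T F S ->
  (\int[lebesgue_measure]_(s in `[0%R, T]) (simple_value S s w ^+ 2)%:E =
   (simple_energy S (simple_size S) w)%:E)%E.
Proof.
move=> S_wf; under eq_integral do rewrite simple_valueE// -sumEFin.
have mI i : measurable_fun `[0%R, T] (\1_(`]simple_time S i, simple_time S i.+1]) : R -> R).
  by apply: measurable_funTS; exact: measurable_indic.
rewrite ge0_integral_sum//; last 2 first.
- by move=> i; apply/measurable_EFinP; exact: measurable_funM.
- by move=> i s _; rewrite lee_fin mulr_ge0 ?sqr_ge0.
rewrite -sumEFin; apply: eq_bigr => i _.
under eq_integral do rewrite EFinM.
rewrite ge0_integralZl//; last 2 first.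
- exact/measurable_EFinP.
- by rewrite lee_fin sqr_ge0.
have /andP[a0 aT] := simple_time_itv S_wf (ltnW (ltn_ord i)).
have /andP[b0 bT] := simple_time_itv S_wf (ltn_ord i).
rewrite integral_indic// setIidl; last first.
  by move=> x /=; rewrite !in_itv /= => /andP[h1 h2]; apply/andP; split; lra.
have [_ _ incr _] := S_wf.
rewrite [X in (_ * X)%E](lebesgue_measure_itv
  (Interval (BRight (simple_time S i)) (BRight (simple_time S i.+1)))) /= lte_fin.
case: ifPn => [_|]; first by rewrite EFinM -EFinB.
rewrite -leNgt => h; rewrite (_ : simple_time S i.+1 = simple_time S i) ?subrr ?mulr0 ?mule0//.
by apply/eqP; rewrite eq_le h incr.
Qed.

End BrownianIntegral.

(** * Localization of the latent process *)

Section JointMeasurability.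
Context {R : realType} {d : measure_display} {Omega : measurableType d}.
Variable T : R.
Hypothesis T0 : 0 < T.
Local Notation mu := (@lebesgue_measure R).

Lemma measurable_fst_comp (h : R -> R) : measurable_fun setT h ->
  measurable_fun setT (fun z : R * Omega => h z.1).
Proof. by move=> mh; apply: measurableT_comp => //. Qed.

Lemma measurable_snd_comp (h : Omega -> R) : measurable_fun setT h ->
  measurable_fun setT (fun z : R * Omega => h z.2).
Proof. by move=> mh; apply: measurableT_comp => //. Qed.

Lemma measurable_indic_fst (A : set R) : measurable A ->
  measurable_fun setT (fun z : R * Omega => \1_A z.1 : R).
Proof. by move=> mA; apply: (@measurable_fst_comp (\1_A)); exact: measurable_indic. Qed.

Section Cadlag.
Variable H : R -> Omega -> R.
Hypothesis mH : forall t, 0 <= t <= T -> measurable_fun setT (H t).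
Hypothesis Hcadlag : forall w, cadlag_path T (H ^~ w).

Let node q i : R := T * i%:R / q.+1%:R.

(** On each cell the process is read at the right end of the cell, so that right continuity of the
    paths gives pointwise convergence; the last time [T] belongs to no cell and is added
    separately. *)
Let right_approx q (z : R * Omega) : R :=
  \sum_(i < q.+1) \1_(`[node q i, node q i.+1[) z.1 * H (node q i.+1) z.2
  + \1_[set T] z.1 * H T z.2.

Let measurable_right_approx q : measurable_fun setT (right_approx q).
Proof.
apply: measurable_funD; last first.
  apply: measurable_funM; first by apply: measurable_indic_fst.
  by apply: measurable_snd_comp; apply: mH; rewrite lexx ltW.
apply: measurable_sum_cond => i _; apply: measurable_funM.
  by apply: measurable_indic_fst.
apply: measurable_snd_comp; apply: mH; rewrite divr_ge0 ?mulr_ge0 ?(ltW T0)//=.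
by rewrite ler_pdivrMr ?ltr0n// ler_pM2l// ler_nat.
Qed.

Let right_approxE q s w : 0 <= s < T ->
  exists r, [/\ s < r, r <= s + T / q.+1%:R, r <= T & right_approx q (s, w) = H r w].
Proof.
move=> /andP[s0 sT]; have q0 : 0 < q.+1%:R :> R by rewrite ltr0n.
pose i := Num.truncn (s * q.+1%:R / T).
have /andP[i1 i2] : i%:R <= s * q.+1%:R / T < i.+1%:R.
  by apply: truncn_itv; rewrite divr_ge0 ?mulr_ge0 ?(ltW T0).
have h1 : node q i <= s.
  by rewrite /node ler_pdivrMr// mulrC -ler_pdivlMr.
have h2 : s < node q i.+1.
  by rewrite /node ltr_pdivlMr// [ltRHS]mulrC -ltr_pdivrMr.
have iq : (i < q.+1)%N.
  have : i%:R < q.+1%:R :> R.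
    by apply: (le_lt_trans i1); rewrite ltr_pdivrMr// mulrC ltr_pM2l.
  by rewrite ltr_nat.
exists (node q i.+1); split => //.
- apply: (@le_trans _ _ (node q i + T / q.+1%:R)); last by rewrite lerD2r.
  by rewrite /node -addn1 natrD mulrDr mulr1 mulrDl.
- by rewrite /node ler_pdivrMr// ler_pM2l// ler_nat.
- rewrite /right_approx /= [X in _ + X](_ : _ = 0) ?addr0; last first.
    by rewrite indicE memNset ?mul0r//= => E; move: sT; rewrite E ltxx.
  rewrite (bigD1 (Ordinal iq))//= indicE mem_set ?mul1r; last first.
    by rewrite /= in_itv /= h1 h2.
  rewrite big1 ?addr0// => j ji.
  rewrite indicE memNset ?mul0r//= in_itv /= => /andP[h3 h4].
  have nodeS a b : (a <= b)%N -> node q a <= node q b.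
    by move=> ab; rewrite /node ler_pM2r ?invr_gt0// ler_pM2l// ler_nat.
  have [ij|ij|E] := ltngtP j i.
  - by have := nodeS _ _ ij; lra.
  - by have := nodeS _ _ ij; lra.
  - by move: ji; rewrite -val_eqE /= E eqxx.
Qed.

Lemma cadlag_jointly_measurable :
  measurable_fun setT (fun z : R * Omega => H z.1 z.2 * \1_(`[0, T]) z.1).
Proof.
apply: (@measurable_fun_cvg _ _ _ _ right_approx) => //.
move=> [s w] _ /=.
have out i q : (i < q.+1)%N -> 0 <= node q i /\ node q i.+1 <= T.
  move=> iq; have q0 : 0 < q.+1%:R :> R by rewrite ltr0n.
  split; first by rewrite divr_ge0// mulr_ge0// ltW.
  by rewrite /node ler_pdivrMr// ler_pM2l// ler_nat.
have [sT|sT] := boolP (0 <= s <= T); last first.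
  rewrite indicE memNset ?mulr0 /=; last by rewrite in_itv /=; exact/negP.
  rewrite (_ : (fun q => right_approx q (s, w)) = fun=> 0); first exact: cvg_cst.
  apply/funext => q; rewrite /right_approx /= big1 ?add0r.
    rewrite indicE memNset ?mul0r//= => E; move/negP: sT; apply.
    by rewrite E lexx ltW.
  move=> i _; have [h1 h2] := out i q (ltn_ord i).
  rewrite indicE memNset ?mul0r//= in_itv /= => /andP[h3 h4]; move/negP: sT; apply.
  by apply/andP; split; lra.
rewrite indicE mem_set ?mulr1 /=; last by rewrite in_itv.
have /andP[s0 s1] := sT; have [sltT|Ts] := ltP s T; last first.
  have -> : s = T by apply/eqP; rewrite eq_le s1.
  rewrite (_ : (fun q => right_approx q (T, w)) = fun=> H T w); first exact: cvg_cst.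
  apply/funext => q; rewrite /right_approx /= big1 ?add0r.
    by rewrite indicE mem_set// mul1r.
  move=> i _; have [h1 h2] := out i q (ltn_ord i).
  by rewrite indicE memNset ?mul0r//= in_itv /= => /andP[h3 h4]; lra.
have [/(_ s) rc _] := Hcadlag w.
have {}rc : H x w @[x --> s^'+] --> H s w by apply: rc; rewrite s0.
apply/cvgrPdist_le => e e0.
move/cvgrPdist_le : rc => /(_ e e0) /nbhs_ballP[dlt /= d0 Hd].
near=> q; have [r [sr rs rT ->]] : exists r, [/\ s < r, r <= s + T / q.+1%:R, r <= T &
    right_approx q (s, w) = H r w] by apply: right_approxE; rewrite s0.
apply: Hd => //; rewrite /ball/= distrC ger0_norm ?subr_ge0 ?(ltW sr)//.
rewrite ltrBlDl; apply: (le_lt_trans rs); rewrite ltrD2l ltr_pdivrMr ?ltr0n//.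
rewrite mulrC -ltr_pdivrMr//.
have : T / dlt < q%:R by near: q; exact: nbhs_infty_gtr.
by move=> /lt_trans; apply; rewrite ltr_nat.
Unshelve. all: by end_near. Qed.

End Cadlag.

Lemma measurable_time_integral (g : R * Omega -> R) : measurable_fun setT g ->
  (forall z, 0 <= g z) ->
  measurable_fun setT (fun w => \int[mu]_(s in `[0%R, T]) (g (s, w))%:E)%E.
Proof.
move=> mg g0.
rewrite (_ : (fun w => _) = fubini_G mu (fun z => (g z * \1_(`[0, T]) z.1)%:E)); last first.
  apply/funext => w; rewrite /fubini_G [LHS]integral_mkcond; apply: eq_integral => s _.
  rewrite patchE indicE; case: ifP => /=; rewrite ?mulr1 ?mulr0//.
apply: measurable_fun_fubini_tonelli_G.
  by apply/measurable_EFinP; apply: measurable_funM => //; apply: measurable_indic_fst.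
by move=> z; rewrite lee_fin mulr_ge0// indicE.
Qed.

End JointMeasurability.

Section Events.
Context {R : realType} {d : measure_display} {Omega : measurableType d}.
Variable P : probability Omega R.

Lemma decreasing_events_small (A : nat -> set Omega) :
  (forall m, measurable (A m)) -> (forall m, A m.+1 `<=` A m) ->
  P.-negligible (\bigcap_m A m) ->
  forall e : R, 0 < e -> exists m, (P (A m) <= e%:E)%E.
Proof.
move=> mA decA negA e e0.
have mcap : measurable (\bigcap_m A m) by exact: bigcapT_measurable.
have P0 : P (\bigcap_m A m) = 0%E by apply/negligibleP.
have : P (A m) @[m --> \oo] --> 0%E.
  rewrite -P0; apply: (@nonincreasing_cvg_mu _ _ _ P A) => //.
    by rewrite ltey_eq fin_num_measure.
  apply/nonincreasing_seqP => m; apply/subsetPset; exact: decA.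
move=> /fine_cvgP[_ /cvgrPdist_le /(_ e e0)[N _ /(_ N (leqnn N))]].
rewrite sub0r normrN /= => h; exists N.
rewrite -[P (A N)]fineK ?fin_num_measure// lee_fin; exact: le_trans (ler_norm _) h.
Qed.

Lemma ae_exception (Q : Omega -> Prop) : {ae P, forall w, Q w} ->
  exists A, [/\ measurable A, P A = 0%E & forall w, ~ A w -> Q w].
Proof.
move=> [A [mA PA QA]]; exists A; split => // w nA; apply: contrapT => nQ.
by apply: nA; exact: QA.
Qed.

Lemma measure_setU_le (A B : set Omega) (a b : R) : measurable A -> measurable B ->
  (P A <= a%:E)%E -> (P B <= b%:E)%E -> (P (A `|` B) <= (a + b)%:E)%E.
Proof.
move=> mA mB PA PB; apply: (le_trans (measureU2 _ mA mB)).
by rewrite EFinD; exact: leeD.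
Qed.

Lemma finite_exception (n : nat) (A : nat -> set Omega) (a : R) :
  (forall i, (i < n)%N -> measurable (A i)) -> (forall i, (i < n)%N -> (P (A i) <= a%:E)%E) ->
  exists E, [/\ measurable E, (P E <= (n%:R * a)%:E)%E &
    forall i, (i < n)%N -> A i `<=` E].
Proof.
elim: n => [|n IHn] mA PA.
  by exists set0; split => //; rewrite measure0 mul0r.
have [|i ? |E [mE PE AE]] := IHn; [by move=> i /ltnW; exact: mA|by apply: PA; exact: ltnW|].
exists (E `|` A n); split.
- by apply: measurableU => //; exact: mA.
- by rewrite -addn1 natrD mulrDl mul1r; apply: measure_setU_le => //; [exact: mA|exact: PA].
- move=> i; rewrite ltnS leq_eqVlt => /predU1P[-> w|/AE iE w /iE]; first by right.
  by left.
Qed.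

Lemma cvg_in_probability_small (X : nat -> Omega -> \bar R) :
  cvg_in_probability P X -> (forall m, measurable_fun setT (X m)) ->
  forall e c : R, 0 < e -> 0 < c -> \forall m \near \oo,
  measurable [set w | (e%:E < `|X m w|)%E] /\ (P [set w | (e%:E < `|X m w|)%E] <= c%:E)%E.
Proof.
move=> cX mX e c e0 c0.
have mE m : measurable [set w | (e%:E < `|X m w|)%E].
  rewrite -[X in measurable X]setTI; apply: emeasurable_fun_o_infty => //.
  exact: measurableT_comp.
have /fine_cvgP[_ /cvgrPdist_le /(_ c c0)] := cX e e0; apply: filterS => m.
rewrite sub0r normrN /= => h; split => //.
rewrite -[leLHS]fineK ?fin_num_measure// lee_fin; exact: le_trans (ler_norm _) h.
Qed.

Section Localization.
Variables (T : R) (F : R -> set (set Omega)).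
Hypotheses (T0 : 0 < T) (F_filtration : filtration T F).

(** For large [m] the localizing time exceeds [T] outside a small event, and there the bound
    attached to [tau m] holds on the whole interval. *)
Lemma locally_bounded_tail (H : R -> Omega -> R) : locally_bounded P T F H ->
  forall e : R, 0 < e -> exists K A, [/\ measurable A, (P A <= e%:E)%E &
    forall w, ~ A w -> forall t, 0 <= t <= T -> `|H t w| <= K].
Proof.
move=> [tau [[stop incr esc] bd]] e e0.
have mA m : measurable [set w | (tau m w <= T%:E)%E].
  have TT : 0 <= T <= T by rewrite lexx ltW.
  apply: (filtration_measurable F_filtration TT).
  by have [_] := stop m; apply.
have [m Pm] : exists m, (P [set w | (tau m w <= T%:E)%E] <= e%:E)%E.
  apply: decreasing_events_small e0 => //.
    by move=> m w /=; exact: le_trans (incr m w).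
  have [N [mN PN HN]] := ae_exception esc; exists N; split => //.
  move=> w Hw; apply: contrapT => /HN [m Tm].
  by have := Hw m I => /= /(lt_le_trans Tm); rewrite ltxx.
have [K HK] := bd m; exists K, [set w | (tau m w <= T%:E)%E]; split => //.
move=> w /negP; rewrite -ltNge => Tw t /andP[t0 tT]; apply: HK.
- by rewrite t0.
- by apply: lt_trans Tw; rewrite lte_fin.
- by apply: le_trans (ltW Tw); rewrite lee_fin.
Qed.

(** One constant serves all grids at once. The exceptional event is a countable union over grid
    points, hence measurable, and continuity of the paths on a compact interval makes the
    intersection of these events negligible. *)
Lemma path_bounded_tail (I : R -> Omega -> R) (t : nat -> nat -> R) :
  adapted T F I -> {ae P, forall w, continuous_path T (I ^~ w)} ->
  (forall n j, (0 < n)%N -> (j <= n)%N -> 0 <= t n j <= T) ->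
  forall e : R, 0 < e -> exists K A, [/\ measurable A, (P A <= e%:E)%E &
    forall w, ~ A w -> forall n j, (0 < n)%N -> (j <= n)%N -> `|I (t n j) w| <= K].
Proof.
move=> aI cI tT e e0.
pose E m n j := if (0 < n)%N && (j <= n)%N then [set w | m%:R < `|I (t n j) w|] else set0.
have mE m n j : measurable (E m n j).
  rewrite /E; case: ifP => // /andP[n0 jn].
  rewrite -[X in measurable X]setTI; apply: measurable_fun_ltr => //.
  apply: (measurableT_comp (f := fun x : R => `|x|)) => //.
  exact: (adapted_measurable F_filtration aI (tT _ _ n0 jn)).
pose A m := \bigcup_n \bigcup_j E m n j.
have mA m : measurable (A m).
  by apply: bigcupT_measurable => n; exact: bigcupT_measurable.
have [m Pm] : exists m, (P (A m) <= e%:E)%E; last first.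
  exists m%:R, (A m); split => // w nA n j n0 jn; rewrite leNgt; apply/negP => h.
  by apply: nA; exists n => //; exists j => //; rewrite /E n0 jn.
apply: decreasing_events_small e0 => //.
- move=> m w [n _ [j _ Ew]]; exists n => //; exists j => //; move: Ew; rewrite /E.
  case: ifP => // _ /=; apply: le_lt_trans; by rewrite ler_nat.
- have [N [mN PN HN]] := ae_exception cI; exists N; split => //.
  move=> w Hw; apply: contrapT => /HN cw.
  have [c1 _ max_] := EVT_max (ltW T0) cw; have [c2 _ min_] := EVT_min (ltW T0) cw.
  pose b := `|I c1 w| + `|I c2 w|.
  have [n _ [j _]] := Hw (Num.truncn b).+1 Logic.I.
  rewrite /E; case: ifP => // /andP[n0 jn] /=.
  have /andP[_ bm] : (Num.truncn b)%:R <= b < (Num.truncn b).+1%:R.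
    by apply: truncn_itv; rewrite addr_ge0.
  have tj : t n j \in `[0, T] by rewrite in_itv /= tT.
  have h1 := max_ _ tj; have h2 := min_ _ tj => h3.
  have := lt_trans bm h3; apply/negP; rewrite -leNgt ler_norml /b.
  have := ler_norm (I c1 w); have := lerNnormlW (lexx `|I c2 w|).
  by have := normr_ge0 (I c1 w); have := normr_ge0 (I c2 w); lra.
Qed.

Lemma progressive_section (H : R -> Omega -> R) w : progressive T F H ->
  measurable_fun `[0, T] (H ^~ w).
Proof.
move=> pH _ A mA; have TT : 0 <= T <= T by rewrite lexx ltW.
pose E : set (R * Omega) := [set sw | 0 <= sw.1 <= T /\ A (H sw.1 sw.2)].
have mE : measurable E.
  have := pH T TT A mA; apply: smallest_sub => //; first exact: sigma_algebra_measurable.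
  move=> _ [C [D [mC FD ->]]]; apply: measurableX => //.
  exact: (filtration_measurable F_filtration TT).
have := measurable_ysection w mE; congr measurable.
by apply/seteqP; split => s; rewrite /ysection /= inE /E /= in_itv.
Qed.

Lemma drift_increment (h : R -> R) (K s t : R) : measurable_fun `[0, T] h ->
  (forall u, 0 <= u <= T -> `|h u| <= K) -> 0 <= s <= T -> 0 <= t <= T ->
  `|\int[lebesgue_measure]_(u in `[0, t]) h u - \int[lebesgue_measure]_(u in `[0, s]) h u|
  <= K * `|t - s|.
Proof.
move=> mh hK; wlog st : s t / s <= t.
  move=> hw sT tT; have [/hw|/ltW /hw] := leP s t; first exact.
  by rewrite distrC (distrC t); apply.
move=> /andP[s0 sT] /andP[t0 tT].
have int_ x y : 0 <= x -> y <= T -> lebesgue_measure.-integrable `[x, y] (EFin \o h).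
  move=> x0 yT.
  have sub : `[x, y]%classic `<=` `[0, T]%classic.
    by move=> u; rewrite /= !in_itv /= => /andP[h1 h2]; apply/andP; split; lra.
  apply: measurable_bounded_integrable => //.
  - rewrite [X in (X < _)%E](lebesgue_measure_itv `[x, y]) /=.
    by case: ifP => // _; rewrite -EFinB ltry.
  - exact: measurable_funS mh.
  - exists K; split; first exact: num_real.
    move=> M KM u /sub; rewrite /= in_itv /= => /hK; move/le_trans; apply; exact: ltW.
rewrite Rintegral_itvB ?bnd_simp//; last exact: int_.
have K0 : 0 <= K by apply: le_trans (hK 0 _) => //; rewrite lexx ltW.
have i1 : lebesgue_measure.-integrable `]s, t] (EFin \o h).
  apply: (integrableS _ _ _ (int_ s t s0 tT)) => //.
  by apply: subset_itvr; rewrite bnd_simp.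
apply: (le_trans (le_normr_Rintegral _ i1)) => //.
have i2 : lebesgue_measure.-integrable `]s, t] (EFin \o (fun=> K)).
  apply: measurable_bounded_integrable => //.
    rewrite [X in (X < _)%E](lebesgue_measure_itv `]s, t]) /=.
    by case: ifP => // _; rewrite -EFinB ltry.
  by exists `|K|; split; [exact: num_real|move=> M KM u _; exact: ltW].
apply: (@le_trans _ _ (\int[lebesgue_measure]_(u in `]s, t]) K)).
  apply: le_Rintegral => //; first exact: (integrable_norm i1).
  by move=> u; rewrite /= in_itv /= => /andP[h1 h2]; apply: hK; apply/andP; split; lra.
rewrite Rintegral_cst// [X in fine X](lebesgue_measure_itv `]s, t]) /= lte_fin.
rewrite ger0_norm ?subr_ge0//; case: ifPn => //= _.
by rewrite mulr0 mulr_ge0// subr_ge0.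
Qed.

End Localization.

End Events.

(** * Increments of the latent process *)

Section ItoIncrements.
Context {R : realType} {d : measure_display} {Omega : measurableType d}.
Variables (P : probability Omega R) (T : R) (F : R -> set (set Omega)).
Variables (B sigma I : R -> Omega -> R).
Hypotheses (T0 : 0 < T) (F_filtration : filtration T F) (B_brownian : brownian P T F B).
Hypotheses (sigma_adapted : adapted T F sigma)
  (sigma_cadlag : forall w, cadlag_path T (sigma ^~ w)).
Hypothesis I_ito : ito_integral P T F sigma B I.
Variable k : nat.
Hypotheses (k_gt0 : (0 < k)%N)
  (sigma_moment : (\int[P]_w \int[lebesgue_measure]_(s in `[0%R, T])
                     (sigma s w ^+ (2 * k))%:E < +oo)%E).
Local Notation mu := (@lebesgue_measure R).

(** Extension by zero outside the time interval, so that joint measurability can be stated on the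
    full product space. *)
Let sigma1 (z : R * Omega) := sigma z.1 z.2 * \1_(`[0, T]) z.1.

Let msigma1 : measurable_fun setT sigma1.
Proof.
apply: (cadlag_jointly_measurable T0) => // t tT.
exact: (adapted_measurable F_filtration sigma_adapted tT).
Qed.

Let sigma1E s w : `[0, T]%classic s -> sigma1 (s, w) = sigma s w.
Proof. by move=> sT; rewrite /sigma1 indicE mem_set ?mulr1. Qed.

Let measurable_section (g : R * Omega -> R) w : measurable_fun setT g ->
  measurable_fun setT (fun s => g (s, w)).
Proof. by move=> mg; apply: measurableT_comp => //. Qed.

Lemma measurable_energy (m : nat) :
  measurable_fun setT (fun w => \int[mu]_(s in `[0%R, T]) (sigma s w ^+ (2 * m))%:E)%E.
Proof.
rewrite (_ : (fun w => _) =
    fun w => (\int[mu]_(s in `[0%R, T]) (sigma1 (s, w) ^+ (2 * m))%:E)%E); last first.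
  by apply/funext => w; apply: eq_integral => s; rewrite inE => /sigma1E ->.
apply: (@measurable_time_integral _ _ _ T (fun z => sigma1 z ^+ (2 * m))).
  exact: measurable_funX.
by move=> z; rewrite exprM exprn_ge0// sqr_ge0.
Qed.

(** Since [sigma^2 <= 1 + sigma^(2k)], the moment hypothesis makes the expected energy finite, and
    Markov's inequality applies. *)
Lemma energy_tail (e : R) : 0 < e -> exists K A, [/\ 0 <= K, measurable A, (P A <= e%:E)%E &
  forall w, ~ A w -> (\int[mu]_(s in `[0%R, T]) (sigma s w ^+ 2)%:E <= K%:E)%E].
Proof.
move=> e0; have mG := measurable_energy 1; have mH := measurable_energy k.
rewrite muln1 in mG.
have G0 (m : nat) w : (0 <= \int[mu]_(s in `[0%R, T]) (sigma s w ^+ (2 * m))%:E)%E.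
  by apply: integral_ge0 => s _; rewrite lee_fin exprM exprn_ge0// sqr_ge0.
have mS (m : nat) w : measurable_fun `[0, T] (fun s => sigma s w ^+ (2 * m)).
  apply: (eq_measurable_fun (fun s => sigma1 (s, w) ^+ (2 * m))).
    by move=> s; rewrite inE => /sigma1E ->.
  apply: measurable_funTS; apply: measurable_funX; exact: measurable_section.
have GH w : (\int[mu]_(s in `[0%R, T]) (sigma s w ^+ 2)%:E <=
    T%:E + \int[mu]_(s in `[0%R, T]) (sigma s w ^+ (2 * k))%:E)%E.
  have -> : T%:E = (\int[mu]_(s in `[0%R, T]) 1%:E)%E.
    rewrite integral_cst// mul1e [RHS](lebesgue_measure_itv `[0, T]) /= lte_fin T0.
    by rewrite -EFinB subr0.
  rewrite -ge0_integralD//; last 2 first.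
  - by move=> s _; rewrite lee_fin exprM exprn_ge0// sqr_ge0.
  - by apply/measurable_EFinP; exact: mS.
  apply: ge0_le_integral => //.
  - by move=> s _; rewrite lee_fin sqr_ge0.
  - by apply/measurable_EFinP; have := mS 1%N w; rewrite muln1.
  - by apply: emeasurable_funD => //; apply/measurable_EFinP; exact: mS.
  - move=> s _; rewrite -EFinD lee_fin exprM; set y := _ ^+ 2.
    have y0 : 0 <= y by exact: sqr_ge0.
    have [y1|/ltW y1] := leP y 1; first by rewrite (le_trans y1)// lerDl exprn_ge0.
    by apply: (@le_trans _ _ (y ^+ k)); [exact: ler_eXnr|rewrite lerDr].
pose c := (\int[P]_w \int[mu]_(s in `[0%R, T]) (sigma s w ^+ 2)%:E)%E.
have c0 : (0 <= c)%E by apply: integral_ge0 => w _; have := G0 1%N w; rewrite muln1.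
have cfin : c \is a fin_num.
  rewrite ge0_fin_numE//; apply: (@le_lt_trans _ _
    (\int[P]_w (T%:E + \int[mu]_(s in `[0%R, T]) (sigma s w ^+ (2 * k))%:E))%E).
    apply: ge0_le_integral => //.
    - by move=> w _; have := G0 1%N w; rewrite muln1.
    - exact: emeasurable_funD.
  rewrite ge0_integralD//; last by move=> w _; rewrite lee_fin ltW.
  by rewrite lte_add_pinfty// integral_cst// [X in (_ * X)%E]probability_setT mule1 ltry.
pose K := fine c / e + 1.
have K0 : 0 < K by rewrite ltr_wpDl// divr_ge0 ?fine_ge0 ?(ltW e0).
exists K, (setT `&` [set w | (K%:E <= `|\int[mu]_(s in `[0%R, T]) (sigma s w ^+ 2)%:E|)%E]).
have mA : measurable (setT `&` [set w | (K%:E <= `|\int[mu]_(s in `[0%R, T]) (sigma s w ^+ 2)%:E|)%E]).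
  by apply: emeasurable_fun_c_infty => //; exact: measurableT_comp.
split => //.
- exact: ltW.
- have := le_integral_abse P measurableT mG K0.
  under eq_integral do rewrite gee0_abs ?(G0 1%N)//.
  move: mA; set A := (setT `&` _) => mA.
  have PAf : P A \is a fin_num by exact: fin_num_measure.
  rewrite -/c => h0; rewrite -(fineK PAf) lee_fin.
  have h : K * fine (P A) <= fine c by rewrite -lee_fin EFinM !fineK.
  rewrite -(ler_pM2l K0) (le_trans h)// /K mulrDl divfK ?gt_eqF// mul1r lerDl.
  exact: ltW.
- move=> w nA; rewrite leNgt; apply/negP => h; apply: nA; split => //=.
  by rewrite gee0_abs ?(ltW h)//; have := G0 1%N w; rewrite muln1.
Qed.

Lemma measurable_simple_error (S : simple_process) : simple_wf T F S ->
  measurable_fun setT (fun w =>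
    \int[mu]_(s in `[0%R, T]) ((simple_value S s w - sigma s w) ^+ 2)%:E)%E /\
  forall w, measurable_fun `[0, T] (simple_value S ^~ w).
Proof.
move=> S_wf; have [_ _ _ coef] := S_wf.
have mV : measurable_fun setT (fun z : R * Omega => simple_value S z.1 z.2).
  apply: measurable_sum_cond => i _; apply: measurable_funM.
    apply: measurable_snd_comp.
    have ti := simple_time_itv S_wf (ltnW (ltn_ord i)).
    exact: measurable_wrt_fun (filtration_measurable F_filtration ti) (coef i (ltn_ord i)).1.
  by apply: measurable_indic_fst.
split; last first.
  move=> w; apply: measurable_funTS.
  exact: (measurable_section (g := fun z => simple_value S z.1 z.2)).
rewrite (_ : (fun w => _) = fun w => (\int[mu]_(s in `[0%R, T])
    ((simple_value S (s, w).1 (s, w).2 - sigma1 (s, w)) ^+ 2)%:E)%E); last first.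
  by apply/funext => w; apply: eq_integral => s; rewrite inE => /sigma1E ->.
apply: (@measurable_time_integral _ _ _ T (fun z => (simple_value S z.1 z.2 - sigma1 z) ^+ 2)).
  by apply: measurable_funX; exact: measurable_funB.
by move=> z; exact: sqr_ge0.
Qed.

Lemma simple_energy_bound (S : simple_process) w (a b : R) : simple_wf T F S ->
  (\int[mu]_(s in `[0%R, T]) ((simple_value S s w - sigma s w) ^+ 2)%:E <= a%:E)%E ->
  (\int[mu]_(s in `[0%R, T]) (sigma s w ^+ 2)%:E <= b%:E)%E ->
  simple_energy S (simple_size S) w <= 2 * a + 2 * b.
Proof.
move=> S_wf ha hb; have [_ /(_ w) mV] := measurable_simple_error S_wf.
have mS : measurable_fun `[0, T] (sigma ^~ w).
  apply: (eq_measurable_fun (fun s => sigma1 (s, w))).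
    by move=> s; rewrite inE => /sigma1E ->.
  by apply: measurable_funTS; exact: measurable_section.
rewrite -lee_fin -(simple_energyE w S_wf).
apply: (@le_trans _ _ (\int[mu]_(s in `[0%R, T])
    (2%:E * ((simple_value S s w - sigma s w) ^+ 2)%:E + 2%:E * (sigma s w ^+ 2)%:E))%E).
  apply: ge0_le_integral => //.
  - by move=> s _; rewrite lee_fin sqr_ge0.
  - by apply/measurable_EFinP; exact: measurable_funX.
  - by apply/measurable_EFinP; apply: measurable_funD; apply: measurable_funM => //;
      apply: measurable_funX => //; exact: measurable_funB.
  - move=> s _; rewrite -!EFinM -EFinD lee_fin.
    by have := sqr_ge0 (simple_value S s w - 2 * sigma s w); lra.
rewrite ge0_integralD//; last 4 first.
- by move=> s _; rewrite -EFinM lee_fin mulr_ge0// sqr_ge0.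
- by apply/measurable_EFinP; apply: measurable_funM => //; apply: measurable_funX; exact: measurable_funB.
- by move=> s _; rewrite -EFinM lee_fin mulr_ge0// sqr_ge0.
- by apply/measurable_EFinP; apply: measurable_funM => //; exact: measurable_funX.
rewrite !ge0_integralZl//; last 4 first.
- by apply/measurable_EFinP; exact: measurable_funX.
- by move=> s _; rewrite lee_fin sqr_ge0.
- by apply/measurable_EFinP; apply: measurable_funX; exact: measurable_funB.
- by move=> s _; rewrite lee_fin sqr_ge0.
apply: (@le_trans _ _ (2%:E * a%:E + 2%:E * b%:E)%E); last by rewrite -!EFinM -EFinD.
by apply: leeD; rewrite lee_pmul2l.
Qed.

Lemma measurable_simple_integral (S : simple_process) t : simple_wf T F S -> 0 <= t <= T ->
  measurable_fun setT (simple_integral S B t).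
Proof.
move=> S_wf /andP[t0 tT]; have [_ _ _ coef] := S_wf; have [aB _ _] := B_brownian.
have mB i : (i <= simple_size S)%N -> measurable_fun setT (B (Num.min t (simple_time S i))).
  move=> ir; apply: (adapted_measurable F_filtration aB).
  have /andP[i0 iT] := simple_time_itv S_wf ir.
  by rewrite le_min t0 i0 ge_min tT.
apply: measurable_sum_cond => i _; apply: measurable_funM.
  have ti := simple_time_itv S_wf (ltnW (ltn_ord i)).
  exact: measurable_wrt_fun (filtration_measurable F_filtration ti) (coef i (ltn_ord i)).1.
by apply: measurable_funB; apply: mB; [|exact: ltnW].
Qed.

Section Grid.
Variables (n : nat) (t : nat -> R) (xi : R).
Hypotheses (t_incr : forall j, (j < n)%N -> t j < t j.+1)
  (t_itv : forall j, (j <= n)%N -> 0 <= t j <= T).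
Local Notation K := (@close R n t xi).
Local Notation kappa := (nbr_max n t xi).

Lemma simple_close_energy (S : simple_process) (c : R) : simple_wf T F S ->
  (forall w, simple_energy S (simple_size S) w <= c) ->
  let Q w := \sum_(e | K e)
    (simple_integral S B (t e.2) w - simple_integral S B (t e.1) w) ^+ 2 in
  L1 P Q /\ \int[P]_w Q w <= 2 * kappa%:R ^+ 2 * c.
Proof.
move=> S_wf Sc Q.
have pair j l : (j <= n)%N -> (l <= n)%N ->
    L1 P (fun w => (simple_integral S B (t l) w - simple_integral S B (t j) w) ^+ 2) /\
    \int[P]_w ((simple_integral S B (t l) w - simple_integral S B (t j) w) ^+ 2) =
    `|simple_clock P S (t l) - simple_clock P S (t j)|.
  wlog jl : j l / (j <= l)%N.
    move=> hw jn ln; have [/hw|/ltnW /hw] := leqP j l; first exact.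
    move=> /(_ ln jn) [h1 h2]; rewrite distrC -h2; split.
      by move: h1; congr L1; apply/funext => w; ring.
    by apply: eq_Rintegral => w _; ring.
  move=> jn ln; have tjl := grid_le t_incr jl ln.
  have /andP[j0 jT] := t_itv jn; have /andP[l0 lT] := t_itv ln.
  have [[_ h1] h2] := simple_integral_isometry F_filtration B_brownian S_wf j0 tjl lT.
  split => //; rewrite h2 ger0_norm// subr_ge0.
  exact: (simple_clock_le P S_wf).
have ordn (i : 'I_n.+1) : (i <= n)%N by rewrite -ltnS.
split; first by apply: L1_sum => e _; have [] := pair e.1 e.2 (ordn _) (ordn _).
rewrite Ex_sum; last by move=> e _; have [] := pair e.1 e.2 (ordn _) (ordn _).
under eq_bigr => e _ do rewrite (pair e.1 e.2 (ordn _) (ordn _)).2.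
apply: (le_trans (close_variation xi t_incr (a := fun i => simple_clock P S (t i)) _)).
  by move=> i i_n; by apply: (simple_clock_le P S_wf); exact/ltW/t_incr.
have k0 : 0 <= 2 * kappa%:R ^+ 2 :> R by rewrite mulr_ge0// exprn_ge0.
rewrite ler_wpM2l//.
have cT := simple_clockT P F_filtration S_wf Sc; apply: le_trans cT.
have /andP[a0 aT] := t_itv (leq0n n); have /andP[b0 bT] := t_itv (leqnn n).
by apply: lerD; [|rewrite lerN2]; exact: (simple_clock_le P S_wf).
Qed.

End Grid.

(* Every step of the grid is crossed by at most [kappa ^ 2] close pairs, so that by
   the isometry the expected sum is at most [kappa ^ 2] times the truncated energy. *)
Lemma ito_close_bound (e : R) : 0 < e -> exists2 K : R, 0 <= K &
  forall (n : nat) (t : nat -> R) (xi : R),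
  (forall j, (j < n)%N -> t j < t j.+1) -> (forall j, (j <= n)%N -> 0 <= t j <= T) ->
  forall delta : R, 0 < delta -> exists A, [/\ measurable A, (P A <= e%:E)%E &
    forall w, ~ A w -> \sum_(e | @close R n t xi e) (I (t e.2) w - I (t e.1) w) ^+ 2
      <= K * (nbr_max n t xi)%:R ^+ 2 + delta].
Proof.
move=> e0; have e40 : 0 < e / 4 by rewrite divr_gt0.
have [K0 [A1 [K00 mA1 PA1 HA1]]] := energy_tail e40.
(* The bound of [simple_energy_bound] for an approximating process at squared distance at most 1
   from [sigma], when the energy of [sigma] is at most [K0]. *)
pose c := 2 * 1 + 2 * K0; have c0 : 0 <= c by rewrite /c; lra.
(* The expected sum is at most [2 kappa^2 c], so by Markov's inequality it exceeds
   [(8 c / e) kappa^2] with probability at most [e / 4]; the outer 2 pays for passing from the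
   simple integral to [I]. The constant is fixed before the grid. *)
exists (2 * (8 * c / e)); first by rewrite mulr_ge0// divr_ge0 ?mulr_ge0// ltW.
move=> n t xi t_incr t_itv delta d0.
pose kap : R := (nbr_max n t xi)%:R; pose N : R := #|@close R n t xi|%:R.
have kap2 : 0 <= kap ^+ 2 by exact: sqr_ge0.
pose b := 8 * c / e * kap ^+ 2 + delta / 4.
have b0 : 0 < b by rewrite /b ltr_wpDl ?divr_gt0// mulr_ge0// divr_ge0 ?mulr_ge0// ltW.
(* The error allowed at each grid point. An increment is then off by at most [2 q], and the
   resulting [8 q^2] per close pair adds up to at most [delta / 2]. *)
pose q := Num.min 1 (delta / (16 * (N + 1))).
have N0 : 0 <= N by exact: ler0n.
have q0 : 0 < q by rewrite lt_min ltr01 divr_gt0// mulr_gt0// ltr_wpDl.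
have q2 : N * (8 * q ^+ 2) <= delta / 2.
  have q1 : q <= 1 by rewrite /q ge_min lexx.
  have qd : q * (16 * (N + 1)) <= delta.
    by rewrite -ler_pdivlMr ?mulr_gt0// ?ltr_wpDl// /q ge_min lexx orbT.
  have : q ^+ 2 <= q by rewrite expr2 ler_piMl// ltW.
  move=> /(ler_wpM2l N0); have : 0 <= q by exact: ltW.
  by lra.
have [aI _ [S [S_wf cS cI]]] := I_ito.
have mSE m := (measurable_simple_error (S_wf m)).1.
have small1 := cvg_in_probability_small cS mSE ltr01 e40.
pose a3 := e / 4 / n.+1%:R; have a30 : 0 < a3 by rewrite divr_gt0// ltr0n.
have small2 (j : 'I_n.+1) : \forall m \near \oo,
    measurable [set w | (q%:E < `|(simple_integral (S m) B (t j) w - I (t j) w)%:E|)%E] /\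
    (P [set w | (q%:E < `|(simple_integral (S m) B (t j) w - I (t j) w)%:E|)%E] <= a3%:E)%E.
  have tj : 0 <= t j <= T by apply: t_itv; rewrite -ltnS.
  apply: (cvg_in_probability_small (cI _ tj)) => // m.
  apply/measurable_EFinP; apply: measurable_funB.
    exact: (measurable_simple_integral (S_wf m) tj).
  exact: (adapted_measurable F_filtration aI tj).
(* One approximating process must serve for the energy and at every grid point; these finitely many
   conditions hold together from some index on. *)
have [m [[mA2 PA2] HA3]] : exists m,
    (measurable [set w | (1%:E < `|\int[mu]_(s in `[0%R, T])
       ((simple_value (S m) s w - sigma s w) ^+ 2)%:E|)%E] /\
     (P [set w | (1%:E < `|\int[mu]_(s in `[0%R, T])
       ((simple_value (S m) s w - sigma s w) ^+ 2)%:E|)%E] <= (e / 4)%:E)%E) /\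
    forall j : 'I_n.+1,
    measurable [set w | (q%:E < `|(simple_integral (S m) B (t j) w - I (t j) w)%:E|)%E] /\
    (P [set w | (q%:E < `|(simple_integral (S m) B (t j) w - I (t j) w)%:E|)%E] <= a3%:E)%E.
  near \oo => m; exists m; split; first by near: m; exact: small1.
  by near: m; apply: filter_forall => j; exact: small2.
set A2 := [set w | _] in mA2 PA2.
pose E3 j := [set w | (q%:E < `|(simple_integral (S m) B (t j) w - I (t j) w)%:E|)%E].
have [A3 [mA3 PA3 HA3']] : exists A3, [/\ measurable A3, (P A3 <= (n.+1%:R * a3)%:E)%E &
    forall j, (j < n.+1)%N -> E3 j `<=` A3].
  apply: finite_exception => j jn; first by have [] := HA3 (Ordinal jn).
  by have [] := HA3 (Ordinal jn).
have {}PA3 : (P A3 <= (e / 4)%:E)%E.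
  by move: PA3; rewrite /a3 mulrC divfK// gt_eqF// ltr0n.
have Sc := truncated_energy _ (S_wf m) c0.
have S'_wf := truncated_wf F_filtration c (S_wf m).
have [LQ EQ] := simple_close_energy xi t_incr t_itv S'_wf Sc.
set Q := (fun w => \sum_(_ | _) _) in LQ EQ.
have Q0 w : 0 <= Q w by apply: sumr_ge0 => ? _; exact: sqr_ge0.
pose A4 := [set w | (b <= Q w)%R].
have mA4 : measurable A4.
  rewrite -[X in measurable X]setTI; apply: measurable_fun_ler => //.
  exact: L1_measurable LQ.
have PA4 : (P A4 <= (e / 4)%:E)%E.
  apply: (le_trans (markov_ge b0 LQ Q0)); rewrite lee_fin ler_pdivrMr//.
  apply: (le_trans EQ); rewrite -/kap.
  have -> : e / 4 * b = 2 * kap ^+ 2 * c + e / 4 * (delta / 4).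
    by rewrite /b; field; rewrite gt_eqF.
  by rewrite lerDl mulr_ge0// divr_ge0// ltW.
exists ((A1 `|` A2) `|` (A3 `|` A4)); split.
- by apply: measurableU; exact: measurableU.
- have := measure_setU_le (measurableU _ _ mA1 mA2) (measurableU _ _ mA3 mA4)
    (measure_setU_le mA1 mA2 PA1 PA2) (measure_setU_le mA3 mA4 PA3 PA4).
  by rewrite (_ : e / 4 + e / 4 + (e / 4 + e / 4) = e)//; field.
move=> w /not_orP[/not_orP[nA1 nA2] /not_orP[nA3 nA4]].
have en : simple_energy (S m) (simple_size (S m)) w <= c.
  apply: simple_energy_bound; [exact: S_wf| |exact: HA1].
  move/negP: nA2; rewrite -leNgt gee0_abs//.
  by apply: integral_ge0 => s _; rewrite lee_fin sqr_ge0.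
have Qb : Q w <= b by rewrite leNgt; apply/negP => h; apply: nA4; exact: ltW.
have err (j : 'I_n.+1) : `|simple_integral (S m) B (t j) w - I (t j) w| <= q.
  rewrite leNgt; apply/negP => h; apply: nA3.
  have Ew : E3 j w by rewrite /E3 /= lte_fin.
  exact: HA3' (ltn_ord j) w Ew.
apply: (@le_trans _ _ (2 * Q w + N * (8 * q ^+ 2))); last first.
  apply: (@le_trans _ _ (2 * b + delta / 2)); first by rewrite lerD// ler_pM2l.
  by rewrite /b -/kap; lra.
have -> : N * (8 * q ^+ 2) = \sum_(e | @close R n t xi e) (8 * q ^+ 2).
  by rewrite [RHS]sumr_const -[RHS]mulr_natl.
rewrite /Q mulr_sumr -big_split/=; apply: ler_sum => g _.
rewrite !(truncated_integral B _ (S_wf m) en).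
have := err g.1; have := err g.2.
set x := simple_integral _ _ _ _; set y := simple_integral _ _ _ _ => h2 h1.
pose u := (x - I (t g.2) w) - (y - I (t g.1) w).
have -> : I (t g.2) w - I (t g.1) w = (x - y) - u by rewrite /u; ring.
have uq : u ^+ 2 <= (2 * q) ^+ 2.
  rewrite -(real_normK (num_real u)) lerXn2r ?nnegrE ?mulr_ge0 ?(ltW q0)//.
  apply: (le_trans (ler_normB _ _)); rewrite mulr_natl mulr2n; exact: lerD.
by have := sqr_ge0 (x - y + u); lra.
Unshelve. all: by end_near. Qed.

End ItoIncrements.

Section LatentProcess.
Context {R : realType} {d : measure_display} {Omega : measurableType d}.
Variables (P : probability Omega R) (T : R) (F : R -> set (set Omega)).
Variables (B mu sigma X : R -> Omega -> R).
Hypotheses (T0 : 0 < T) (F_filtration : filtration T F) (B_brownian : brownian P T F B).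
Hypotheses (mu_progressive : progressive T F mu) (mu_bounded : locally_bounded P T F mu)
  (sigma_adapted : adapted T F sigma) (sigma_cadlag : forall w, cadlag_path T (sigma ^~ w))
  (X_ito : ito_process P T F mu sigma B X).
Variable k : nat.
Hypotheses (k_gt0 : (0 < k)%N)
  (sigma_moment : (\int[P]_w \int[lebesgue_measure]_(s in `[0%R, T])
                     (sigma s w ^+ (2 * k))%:E < +oo)%E).
Variables (t : nat -> nat -> R) (xi : nat -> R).
Hypotheses (t_first : forall n, (0 < n)%N -> t n 0 = 0)
  (t_last : forall n, (0 < n)%N -> t n n = T)
  (t_incr : forall n j, (j < n)%N -> t n j < t n j.+1)
  (xi_gt0 : forall n, 0 < xi n)
  (nbr_max_min : asymp (R := R) (fun n => (nbr_max n (t n) (xi n))%:R)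
                       (fun n => (nbr_min n (t n) (xi n))%:R))
  (nbr_min_nxi : asymp (R := R) (fun n => (nbr_min n (t n) (xi n))%:R)
                       (fun n => n%:R * xi n))
  (xi_small : Num.sqrt n%:R * xi n @[n --> \oo] --> (0 : R)).

Lemma grid_itv n j : (0 < n)%N -> (j <= n)%N -> 0 <= t n j <= T.
Proof.
move=> n0 jn; rewrite -{1}(t_first n0) -(t_last n0).
by rewrite !(grid_le (t_incr (n := n))).
Qed.

(** Off a small event the squared increments sum to at most [K kappa^2] up to terms of order [N xi],
    and [kappa^2 <= C1 C2 N xi] by the two bounds on the counts; the normalization leaves a multiple
    of [sqrt n xi]. The bound [b] on a single increment is chosen before [n], as the remainder of
    the Taylor expansion requires. *)
Lemma latent_increments (e : R) : 0 < e -> exists2 b : R, 0 <= b & \forall n \near \oo,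
  exists A, [/\ measurable A, (P A <= e%:E)%E & forall w, ~ A w ->
    Num.sqrt n%:R / (nbr_total n (t n) (xi n))%:R *
      \sum_(g | @close R n (t n) (xi n) g) (X (t n g.2) w - X (t n g.1) w) ^+ 2 <= e /\
    forall g, @close R n (t n) (xi n) g -> `|X (t n g.2) w - X (t n g.1) w| <= b].
Proof.
move=> e0; have e40 : 0 < e / 4 by rewrite divr_gt0.
have [_ [I [I_ito XE]]] := X_ito.
have [aI cI _] := I_ito.
have [K K0 HK] := ito_close_bound T0 F_filtration B_brownian sigma_adapted sigma_cadlag
  I_ito k_gt0 sigma_moment e40.
have [Km [A1 [mA1 PA1 HA1]]] := locally_bounded_tail T0 F_filtration mu_bounded e40.
have [Kp [A2 [mA2 PA2 HA2]]] := path_bounded_tail T0 F_filtration aI cI grid_itv e40.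
have [A0 [mA0 PA0 HA0]] := ae_exception XE.
have [C1 C10 HC1] := nbr_max_le_total nbr_max_min.
have [C2 C20 HC2] := nbr_max_le_bandwidth xi_gt0 nbr_max_min nbr_min_nxi.
(* The term with [Km] comes from the drift, whose increments over close pairs are at most [Km xi].
   The product [C1 C2] comes from [kappa^2], and the final 1 from the slack [delta := N xi] granted
   to [ito_close_bound]. The factors 2 separate the drift from the stochastic integral. *)
pose D := 2 * Km ^+ 2 + 2 * (K * (C1 * C2) + 1).
have CC : 0 <= K * (C1 * C2) by rewrite !mulr_ge0// ltW.
have D0 : 0 <= D by rewrite /D; have := sqr_ge0 Km; lra.
have eD : 0 < e / (D + 1) by rewrite divr_gt0// ltr_wpDl.
exists (`|Km| + 2 * `|Kp|); first by rewrite addr_ge0 ?mulr_ge0.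
near=> n.
have n0 : (0 < n)%N by near: n; exact: nbhs_infty_gt.
have x0 := xi_gt0 n.
have sx1 : Num.sqrt n%:R * xi n <= 1.
  have : `|0 - Num.sqrt n%:R * xi n| <= 1 by near: n; move/cvgrPdist_le: xi_small; apply.
  by rewrite sub0r normrN; apply: le_trans; exact: ler_norm.
have sx2 : Num.sqrt n%:R * xi n <= e / (D + 1).
  have : `|0 - Num.sqrt n%:R * xi n| <= e / (D + 1).
    by near: n; move/cvgrPdist_le: xi_small; apply.
  by rewrite sub0r normrN; apply: le_trans; exact: ler_norm.
have s1 : 1 <= Num.sqrt n%:R :> R by rewrite -{1}(sqrtr1 R) ler_wsqrtr// ler1n.
have s0 : 0 < Num.sqrt n%:R :> R by exact: lt_le_trans s1.
have xi1 : xi n <= 1 by apply: le_trans sx1; rewrite ler_peMl// ltW.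
pose N : R := (nbr_total n (t n) (xi n))%:R.
have N0 : 0 < N by rewrite ltr0n (nbr_total_gt0 nbr_max_min).
have Nx : 0 < N * xi n by rewrite mulr_gt0.
have [A3 [mA3 PA3 HA3]] := HK n (t n) (xi n) (t_incr (n := n))
  (fun j jn => grid_itv n0 jn) _ Nx.
pose kap : R := (nbr_max n (t n) (xi n))%:R.
have kap2 : kap ^+ 2 <= C1 * C2 * (N * xi n).
  have h1 := HC1 n n0; have h2 := HC2 n n0.
  apply: (@le_trans _ _ (kap * (C2 * (n%:R * xi n)))); first by rewrite expr2 ler_wpM2l.
  have -> : kap * (C2 * (n%:R * xi n)) = (C2 * xi n) * (kap * n%:R) by ring.
  apply: (@le_trans _ _ ((C2 * xi n) * (C1 * N))); first by rewrite ler_wpM2l// mulr_ge0// ltW.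
  by rewrite le_eqVlt; apply/orP; left; apply/eqP; ring.
exists ((A0 `|` A1) `|` (A2 `|` A3)); split.
- by apply: measurableU; exact: measurableU.
- have PA0' : (P A0 <= (e / 4)%:E)%E by rewrite PA0 lee_fin ltW.
  have := measure_setU_le (measurableU _ _ mA0 mA1) (measurableU _ _ mA2 mA3)
    (measure_setU_le mA0 mA1 PA0' PA1) (measure_setU_le mA2 mA3 PA2 PA3).
  by rewrite (_ : e / 4 + e / 4 + (e / 4 + e / 4) = e)//; field.
move=> w /not_orP[/not_orP[nA0 nA1] /not_orP[nA2 nA3]].
pose J u := \int[lebesgue_measure]_(s in `[0, u]) mu s w.
have Xw (g : 'I_n.+1 * 'I_n.+1) : X (t n g.2) w - X (t n g.1) w =
    (J (t n g.2) - J (t n g.1)) + (I (t n g.2) w - I (t n g.1) w).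
  have g1 : (g.1 <= n)%N by rewrite -ltnS.
  have g2 : (g.2 <= n)%N by rewrite -ltnS.
  by rewrite (HA0 w nA0 _ (grid_itv n0 g1)) (HA0 w nA0 _ (grid_itv n0 g2)) /J; ring.
have Km0 : 0 <= Km by apply: le_trans (HA1 w nA1 0 _) => //; rewrite lexx ltW.
have Jw (g : 'I_n.+1 * 'I_n.+1) : @close R n (t n) (xi n) g ->
    `|J (t n g.2) - J (t n g.1)| <= Km * xi n.
  move=> cg; have g1 : (g.1 <= n)%N by rewrite -ltnS.
  have g2 : (g.2 <= n)%N by rewrite -ltnS.
  have h : `|J (t n g.2) - J (t n g.1)| <= Km * `|t n g.2 - t n g.1|.
    exact: (drift_increment T0 (progressive_section T0 F_filtration w mu_progressive)
      (HA1 w nA1) (grid_itv n0 g1) (grid_itv n0 g2)).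
  by apply: (le_trans h); rewrite ler_wpM2l// close_dist.
split; last first.
  move=> g cg; rewrite Xw; apply: (le_trans (ler_normD _ _)); apply: lerD.
    apply: (le_trans (Jw g cg)); rewrite (ger0_norm Km0).
    by rewrite -[leRHS]mulr1 ler_wpM2l.
  have g1 : (g.1 <= n)%N by rewrite -ltnS.
  have g2 : (g.2 <= n)%N by rewrite -ltnS.
  have h1 := HA2 w nA2 n _ n0 g1; have h2 := HA2 w nA2 n _ n0 g2.
  apply: (le_trans (ler_normB _ _)); rewrite mulr_natl mulr2n.
  by apply: lerD; [apply: (le_trans h2)|apply: (le_trans h1)]; exact: ler_norm.
have sumX : \sum_(g | @close R n (t n) (xi n) g) (X (t n g.2) w - X (t n g.1) w) ^+ 2 <=
    D * (N * xi n).
  apply: (@le_trans _ _ (\sum_(g | @close R n (t n) (xi n) g)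
    (2 * (Km * xi n) ^+ 2 + 2 * (I (t n g.2) w - I (t n g.1) w) ^+ 2))).
    apply: ler_sum => g cg; rewrite Xw.
    have := Jw g cg; set x := J _ - _; set y := I _ _ - _ => hx.
    have : x ^+ 2 <= (Km * xi n) ^+ 2.
      by rewrite -(real_normK (num_real x)) lerXn2r ?nnegrE ?mulr_ge0// ltW.
    by have := sqr_ge0 (x - y); lra.
  rewrite big_split/= sumr_const card_close -mulr_sumr -[X in X + _]mulr_natl -/N.
  have h3 := HA3 w nA3; rewrite -/kap in h3.
  have h4 : K * kap ^+ 2 <= K * (C1 * C2 * (N * xi n)) by rewrite ler_wpM2l.
  have h5 : N * xi n ^+ 2 <= N * xi n.
    by rewrite ler_pM2l// expr2 ler_piMl// ltW.
  have h6 := ler_wpM2l (sqr_ge0 Km) h5.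
  rewrite /D exprMn; lra.
apply: (@le_trans _ _ (Num.sqrt n%:R / N * (D * (N * xi n)))).
  by rewrite ler_wpM2l// divr_ge0// ltW.
have -> : Num.sqrt n%:R / N * (D * (N * xi n)) = D * (Num.sqrt n%:R * xi n).
  by field; rewrite gt_eqF.
apply: (@le_trans _ _ ((D + 1) * (e / (D + 1)))).
  apply: ler_pM => //; first by rewrite mulr_ge0// ltW.
  by rewrite lerDl.
by rewrite mulrCA divff ?mulr1// gt_eqF// ltr_wpDl.
Unshelve. all: by end_near. Qed.

End LatentProcess.

(** * The contribution of the signal *)

Section Algebra.
Context {R : realType}.
Implicit Types a x : R.

(** The constant [m^2] is convenient rather than sharp: the induction closes because
    [m^2 + m <= (m + 1)^2]. *)
Lemma expr_taylor1 a x m :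
  `|(a + x) ^+ m - a ^+ m - m%:R * a ^+ m.-1 * x| <=
  m%:R ^+ 2 * x ^+ 2 * (1 + `|a| + `|x|) ^+ m.
Proof.
set y := 1 + `|a| + `|x|.
have y1 : 1 <= y by rewrite /y -addrA lerDl addr_ge0.
have y0 : 0 <= y by exact: le_trans y1.
have ay : `|a| <= y by rewrite /y; have := normr_ge0 x; lra.
have axy : `|a + x| <= y by apply: (le_trans (ler_normD _ _)); rewrite /y; lra.
elim: m => [|m IHm]; first by rewrite !expr0 subrr !mul0r subr0 normr0 expr0n !mul0r.
have -> : (a + x) ^+ m.+1 - a ^+ m.+1 - m.+1%:R * a ^+ m.+1.-1 * x =
    (a + x) * ((a + x) ^+ m - a ^+ m - m%:R * a ^+ m.-1 * x) + m%:R * a ^+ m.-1 * x ^+ 2.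
  by case: m {IHm} => [|m] /=; rewrite ?exprS -?[m.+2%:R]natr1; ring.
have x2 : 0 <= x ^+ 2 by exact: sqr_ge0.
have ym0 : 0 <= y ^+ m by exact: exprn_ge0.
have h1 : `|(a + x) * ((a + x) ^+ m - a ^+ m - m%:R * a ^+ m.-1 * x)| <=
    y * (m%:R ^+ 2 * x ^+ 2 * y ^+ m) by rewrite normrM ler_pM.
have h2 : `|m%:R * a ^+ m.-1 * x ^+ 2| <= m%:R * x ^+ 2 * y ^+ m.+1.
  rewrite normrM (ger0_norm x2) normrM normr_nat -mulrA -[leRHS]mulrA ler_wpM2l//.
  rewrite mulrC ler_wpM2l//.
  apply: (@le_trans _ _ (y ^+ m.-1)); first by rewrite normrX lerXn2r.
  by rewrite ler_weXn2l//; lia.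
apply: (le_trans (ler_normD _ _)); apply: (le_trans (lerD h1 h2)).
have -> : y * (m%:R ^+ 2 * x ^+ 2 * y ^+ m) + m%:R * x ^+ 2 * y ^+ m.+1 =
  (m%:R ^+ 2 + m%:R) * (x ^+ 2 * y ^+ m.+1) by rewrite [y ^+ m.+1]exprS; ring.
rewrite -[leRHS]mulrA; apply: ler_wpM2r; first by rewrite mulr_ge0 ?(exprn_ge0 _ y0).
rewrite -[m.+1%:R]natr1; by have : (0 : R) <= m%:R by []; lra.
Qed.

Lemma exprD_le (u v : R) m : 0 <= u -> 0 <= v -> (u + v) ^+ m <= 2 ^+ m * (u ^+ m + v ^+ m).
Proof.
move=> u0 v0; wlog uv : u v u0 v0 / u <= v.
  move=> hw; have [/hw|/ltW /hw] := leP u v; first exact.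
  by rewrite addrC [X in _ * X]addrC; apply.
apply: (@le_trans _ _ ((2 * v) ^+ m)).
  by rewrite lerXn2r ?nnegrE ?addr_ge0 ?mulr_ge0//; lra.
by rewrite exprMn ler_wpM2l ?exprn_ge0// lerDr exprn_ge0.
Qed.

(* The remainder is dominated by an even power of [a], whose expectation is an
   even moment. *)
Lemma expr_taylor1_even a x b l : `|x| <= b ->
  `|(a + x) ^+ (2 * l) - a ^+ (2 * l) - (2 * l)%:R * a ^+ (2 * l).-1 * x| <=
  (2 * l)%:R ^+ 2 * 2 ^+ (2 * l) * (x ^+ 2 * ((1 + b) ^+ (2 * l) + a ^+ (2 * l))).
Proof.
move=> xb; have b0 : 0 <= b by exact: le_trans xb.
apply: (le_trans (expr_taylor1 a x (2 * l))).
set q := (2 * l)%:R ^+ 2; have q0 : 0 <= q by exact: sqr_ge0.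
rewrite -[leLHS]mulrA -[leRHS]mulrA ler_wpM2l// [leRHS]mulrCA ler_wpM2l ?sqr_ge0//.
have -> : a ^+ (2 * l) = `|a| ^+ (2 * l) by rewrite !exprM real_normK// num_real.
have -> : 1 + `|a| + `|x| = 1 + `|x| + `|a| by ring.
apply: (@le_trans _ _ ((1 + b + `|a|) ^+ (2 * l))).
  by rewrite lerXn2r ?nnegrE ?addr_ge0// lerD2r lerD2l.
by apply: exprD_le => //; exact: addr_ge0.
Qed.

End Algebra.

Section IndependentWeights.
Context {R : realType} {d : measure_display} {T : measurableType d}.
Variables (P : probability T R) (n : nat) (U : 'I_n -> T -> R).
Hypotheses (mU : forall i, measurable_fun setT (U i))
  (indU : independent_variables P U).
Variables (K : pred ('I_n * 'I_n)) (kappa : nat).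
Hypotheses (Kr : forall i, (#|[pred l | K (i, l)]| <= kappa)%N)
  (Kl : forall i, (#|[pred l | K (l, i)]| <= kappa)%N).
Variables (H : set (set T)) (x : 'I_n * 'I_n -> T -> R) (b S : R).
Hypotheses (H_measurable : H `<=` measurable) (H_sigma : sigma_algebra setT H).
Hypothesis U_H : independent_sigma P (sigma_of setT U) H.
Hypotheses (Hx : forall e, measurable_wrt H (x e)) (xb : forall e w, `|x e w| <= b)
  (xS : forall w, \sum_(e | K e) x e w ^+ 2 <= S).
Variable phi : R * R -> R.
Hypothesis mphi : measurable_fun setT phi.
Local Notation z e w := (phi (U e.1 w, U e.2 w)).

Let mx e : measurable_fun setT (x e).
Proof. exact: measurable_wrt_fun H_measurable (Hx e). Qed.

Let L2x e : L2 P (x e).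
Proof. exact: L2_bounded (mx e) (xb e). Qed.

Let zU e : measurable_wrt (sigma_of setT U) (fun w => z e w).
Proof.
apply: (measurable_wrtS _ (@pair_measurable_wrt _ _ _ n U phi e mphi)).
exact: sigma_ofS.
Qed.

Lemma weighted_pair_sum (M : R) : (forall e, K e -> L1 P (fun w => z e w)) ->
  (forall e, K e -> \int[P]_w z e w = M) -> 0 <= M ->
  L1 P (fun w => \sum_(e | K e) x e w ^+ 2 * z e w) /\
  \int[P]_w (\sum_(e | K e) x e w ^+ 2 * z e w) <= S * M.
Proof.
move=> Lz Ez M0.
have Hx2 e : measurable_wrt H (fun w => x e w ^+ 2).
  by apply: (measurable_wrt_comp H_sigma (h := fun y => y ^+ 2)) => //; exact: measurable_funX.
have ind e : K e -> L1 P (fun w => x e w ^+ 2 * z e w) /\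
    \int[P]_w (x e w ^+ 2 * z e w) = M * \int[P]_w (x e w ^+ 2).
  move=> Ke; have [h1 h2] := Ex_indep U_H (zU e) (Hx2 e) (Lz e Ke) (L2x e).2.
  rewrite -(Ez e Ke) -h2; split; last by apply: eq_Rintegral => w _; rewrite mulrC.
  by move: h1; congr L1; apply/funext => w; rewrite mulrC.
split; first by apply: L1_sum => e Ke; have [] := ind e Ke.
rewrite Ex_sum; last by move=> e Ke; have [] := ind e Ke.
under eq_bigr => e Ke do rewrite (ind e Ke).2.
rewrite -mulr_sumr mulrC ler_wpM2r// -Ex_sum; last by move=> e _; have [] := L2x e.
rewrite -[leRHS](Ex_cst P); apply: Ex_le => //; last exact: L1_cst.
by apply: L1_sum => e _; have [] := L2x e.
Qed.

(* Only the pairs sharing an index are correlated, and each pair meets at most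
   [4 kappa] others. *)
Lemma weighted_pair_variance (M : R) : (forall e, K e -> L2 P (fun w => z e w)) ->
  (forall e, K e -> \int[P]_w z e w = 0) ->
  (forall e, K e -> \int[P]_w (z e w ^+ 2) = M) -> 0 <= M ->
  L2 P (fun w => \sum_(e | K e) z e w * x e w) /\
  \int[P]_w ((\sum_(e | K e) z e w * x e w) ^+ 2) <= (4 * kappa)%:R * S * M.
Proof.
move=> Lz Ez Ez2 M0.
have Lzx e : K e -> L2 P (fun w => z e w * x e w).
  move=> Ke; have := L2M_bounded (mx e) (xb e) (Lz e Ke).
  by congr L2; apply/funext => w; rewrite mulrC.
split; first exact: L2_sum.
pose h e w := x e w ^+ 2.
have Lh e : L1 P (h e) by have [] := L2x e.
have share_sym e g : adj K e g = adj K g e.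
  rewrite /adj /share andbCA; congr (_ && (_ && _)).
  by rewrite [g.1 == _]eq_sym [g.1 == e.2]eq_sym [g.2 == _]eq_sym [g.2 == e.2]eq_sym; do !case: eqP.
have term e g : K e -> K g -> \int[P]_w ((z e w * x e w) * (z g w * x g w)) <=
    if adj K e g then M * (2^-1 * (\int[P]_w h e w + \int[P]_w h g w)) else 0.
  move=> Ke Kg.
  have Lzz : L1 P (fun w => z e w * z g w) by apply: L2M; exact: Lz.
  have Lxx : L1 P (fun w => x e w * x g w) by exact: L2M.
  have Uzz : measurable_wrt (sigma_of setT U) (fun w => z e w * z g w).
    by apply: (measurable_wrtM (@sigma_of_sigma_algebra _ _ _ _ _ _)); exact: zU.
  have Hxx : measurable_wrt H (fun w => x e w * x g w) by exact: (measurable_wrtM H_sigma).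
  have [_ E] := Ex_indep U_H Uzz Hxx Lzz Lxx.
  under eq_Rintegral do rewrite mulrACA.
  rewrite E; case: ifPn => [_|]; last first.
    rewrite /adj Ke Kg /= => sh.
    rewrite (pair_cov0 mU indU (phi := fun=> phi) _ Lz Ez Ke Kg sh) ?mul0r//.
  apply: (le_trans (ler_norm _)); rewrite normrM ler_pM//.
    apply: (le_trans (Ex_normM_le (Lz e Ke) (Lz g Kg))).
    by rewrite !Ez2//; lra.
  exact: Ex_normM_le.
have -> : \int[P]_w ((\sum_(e | K e) z e w * x e w) ^+ 2) =
    \sum_(e | K e) \sum_(g | K g) \int[P]_w ((z e w * x e w) * (z g w * x g w)).
  rewrite (eq_bigr (fun e => \int[P]_w (\sum_(g | K g) (z e w * x e w) * (z g w * x g w)))).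
    rewrite -Ex_sum; last by move=> e Ke; apply: L1_sum => g Kg; apply: L2M; exact: Lzx.
    by apply: eq_Rintegral => w _; rewrite expr2 big_distrlr.
  by move=> e Ke; rewrite Ex_sum// => g Kg; apply: L2M; exact: Lzx.
have cadj e : \sum_(g | adj K e g) (1 : R) <= (4 * kappa)%:R.
  by rewrite sumr_const ler_nat; exact: card_adj.
have h0 e : 0 <= \int[P]_w h e w by apply: Ex_ge0 => w; exact: sqr_ge0.
have hS : \sum_(e | K e) \int[P]_w h e w <= S.
  rewrite -Ex_sum// -[leRHS](Ex_cst P); apply: Ex_le; [exact: L1_sum|exact: L1_cst|].
  by move=> w; exact: xS.
have half : \sum_(e | K e) \sum_(g | adj K e g) \int[P]_w h e w <= (4 * kappa)%:R * S.
  apply: (@le_trans _ _ (\sum_(e | K e) (4 * kappa)%:R * \int[P]_w h e w)).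
    apply: ler_sum => e Ke.
    have -> : \sum_(g | adj K e g) \int[P]_w h e w = (\sum_(g | adj K e g) 1) * \int[P]_w h e w.
      by rewrite mulr_suml; apply: eq_bigr => ? _; rewrite mul1r.
    by rewrite ler_wpM2r.
  by rewrite -mulr_sumr ler_wpM2l.
(* Adjacency is symmetric, so exchanging the two sums reduces this half to the other one. *)
have half' : \sum_(e | K e) \sum_(g | adj K e g) \int[P]_w h g w <= (4 * kappa)%:R * S.
  apply: le_trans half; rewrite (exchange_big_dep K)/=; last by move=> e g _ /and3P[].
  rewrite le_eqVlt; apply/orP; left; apply/eqP; apply: eq_bigr => g Kg.
  apply: eq_bigl => e; rewrite share_sym; case: (boolP (K e)) => //= nK.
  by rewrite /adj (negbTE nK) andbF.
apply: (@le_trans _ _ (\sum_(e | K e) \sum_(g | adj K e g)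
    M * (2^-1 * (\int[P]_w h e w + \int[P]_w h g w)))).
  apply: ler_sum => e Ke.
  apply: (@le_trans _ _ (\sum_(g | K g) (if adj K e g then
      M * (2^-1 * (\int[P]_w h e w + \int[P]_w h g w)) else 0))).
    by apply: ler_sum => g Kg; exact: term.
  rewrite -big_mkcondr le_eqVlt; apply/orP; left; apply/eqP; apply: eq_bigl => g.
  by rewrite /adj; case: (K g); rewrite ?andbF.
under eq_bigr => e Ke do rewrite -mulr_sumr -mulr_sumr big_split/=.
rewrite -mulr_sumr -mulr_sumr big_split/= mulrC ler_wpM2r//.
by lra.
Qed.

End IndependentWeights.

Section Errors.
Context {R : realType} {d : measure_display} {Omega : measurableType d}.
Variables (P : probability Omega R) (f : R -> R) (U : nat -> nat -> Omega -> R).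
Hypotheses (mf : measurable_fun setT f) (f0 : forall x : R, 0 <= f x)
  (f1 : (\int[lebesgue_measure]_x (f x)%:E = 1)%E).
Hypotheses (U_measurable : forall n j, (j <= n)%N -> measurable_fun setT (U n j))
  (U_density : forall n j, (j <= n)%N -> has_density P f (U n j))
  (U_independent : forall n, independent_variables P (fun j : 'I_n.+1 => U n j)).
Variables (r : R) (q0 : nat).
Hypotheses (q0r : q0%:R <= r)
  (fr : (\int[lebesgue_measure]_x (`|x| `^ r * f x)%:E < +oo)%E).

(** The errors of one sample indexed by a finite type, the format of [independent_variables]. *)
Definition err n (j : 'I_n.+1) : Omega -> R := U n j.

Lemma err_measurable n j : measurable_fun setT (@err n j).
Proof. by apply: U_measurable; rewrite -ltnS. Qed.

Lemma err_density n j : has_density P f (@err n j).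
Proof. by apply: U_density; rewrite -ltnS. Qed.

Lemma err_pair_moment n (i j : 'I_n.+1) q : i != j -> (q <= q0)%N ->
  L1 P (fun w => (U n i w - U n j w) ^+ q) /\
  \int[P]_w ((U n i w - U n j w) ^+ q) = diff_moment f q.
Proof.
move=> ij qq0; have ind : independent_sigma P (sigma_of [set i] (@err n)) (sigma_of [set j] (@err n)).
  by apply: independent_disjoint => // [|_ -> /= ji];
    [exact: err_measurable|move: ij; rewrite ji eqxx].
apply: (Ex_diff_pow mf f0 f1 q0r fr qq0 (err_measurable i) (err_measurable j)
  (err_density i) (err_density j) ind).
- exact: sigma_of_measurable.
- exact: sigma_of_measurable.
- exact: sigma_of_sigma_algebra.
- exact: sigma_of_sigma_algebra.
Qed.

Lemma diff_moment_even_ge0 q : 0 <= diff_moment f (2 * q).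
Proof.
apply: fine_ge0; apply: integral_ge0 => z _.
by rewrite lee_fin exprM mulr_ge0 ?mulr_ge0// exprn_ge0// sqr_ge0.
Qed.

Hypothesis moment_odd0 : forall q, odd q -> (q <= q0)%N -> moment f q = 0.

Section Remainder.
Variables (T : R) (X : R -> Omega -> R) (t : nat -> nat -> R) (xi : nat -> R).
Hypotheses (mX : forall s, 0 <= s <= T -> measurable_fun setT (X s))
  (U_X_independent : forall n, independent_sigma P
     (sigma_of [set j : nat | (j <= n)%N] (U n)) (sigma_of `[0, T] X))
  (t_itv : forall n j, (0 < n)%N -> (j <= n)%N -> 0 <= t n j <= T)
  (t_incr : forall n j, (j < n)%N -> t n j < t n j.+1)
  (nbr_max_min : asymp (R := R) (fun n => (nbr_max n (t n) (xi n))%:R)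
                       (fun n => (nbr_min n (t n) (xi n))%:R)).
Local Notation N n := ((nbr_total n (t n) (xi n))%:R : R).
Local Notation K n := (@close R n (t n) (xi n)).
Hypothesis latent : forall e : R, 0 < e -> exists2 b : R, 0 <= b & \forall n \near \oo,
  exists A, [/\ measurable A, (P A <= e%:E)%E & forall w, ~ A w ->
    Num.sqrt n%:R / N n * \sum_(g | K n g) (X (t n g.2) w - X (t n g.1) w) ^+ 2 <= e /\
    forall g, K n g -> `|X (t n g.2) w - X (t n g.1) w| <= b].

Let H := sigma_of `[0, T] X.
Let sH : sigma_algebra setT H. Proof. exact: sigma_of_sigma_algebra. Qed.
Let mH : H `<=` measurable.
Proof. by apply: sigma_of_subset => s; rewrite /= in_itv; exact: mX. Qed.

Let err_sigma n : sigma_of setT (@err n) `<=` sigma_of [set j : nat | (j <= n)%N] (U n).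
Proof.
apply: smallest_sub; first exact: smallest_sigma_algebra.
move=> _ [i [A [_ mA ->]]]; apply: (@sigma_of_measurable _ _ _ _ _ _ (i : nat)) => //=.
by rewrite -ltnS.
Qed.

Let HXw n (j : 'I_n.+1) : (0 < n)%N -> measurable_wrt H (X (t n j)).
Proof.
move=> n0; apply: sigma_of_measurable; rewrite /= in_itv; apply: t_itv => //.
by rewrite -ltnS.
Qed.

(** In the expansion around the error difference [a], the coefficient [a^(2l-1)] of the linear term
    has mean zero as an odd moment, so that Chebyshev's inequality and the variance over adjacent
    pairs suffice; the quadratic remainder is nonnegative up to its bound and needs only Markov's
    inequality. Squaring the linear coefficient takes moments of order [4 l - 2]. *)
Lemma signal_remainder_oP l : (0 < l)%N -> (4 * l <= q0)%N ->
  oP P (fun n w => Num.sqrt n%:R *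
    (diff_moment_hat n (t n) (xi n) (fun j => X (t n j) w + U n j w) l
     - diff_moment_hat n (t n) (xi n) (fun j => U n j w) l)).
Proof.
move=> l0 lq e e0.
have q1 : (2 * (2 * l).-1 <= q0)%N by lia.
have q2 : ((2 * l).-1 <= q0)%N by lia.
have q3 : (2 * l <= q0)%N by lia.
have q2_odd : odd (2 * l).-1 by lia.
have [C1 C10 HC1] := nbr_max_le_total nbr_max_min.
have e40 : 0 < e / 4 by rewrite divr_gt0.
have e20 : 0 < e / 2 by rewrite divr_gt0.
have [b b0 latent1] := latent e40.
pose M1 := diff_moment f (2 * (2 * l).-1).
have M10 : 0 <= M1 by exact: diff_moment_even_ge0.
pose M2 := (1 + b) ^+ (2 * l) + diff_moment f (2 * l).
have M20 : 0 <= M2 by rewrite addr_ge0 ?diff_moment_even_ge0// exprn_ge0// addr_ge0.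
pose D1 : R := (2 * l)%:R ^+ 2 * (4 * (C1 * M1)).
have D10 : 0 <= D1 by rewrite !mulr_ge0// ?exprn_ge0// ltW.
pose C2 : R := (2 * l)%:R ^+ 2 * 2 ^+ (2 * l).
have C20 : 0 <= C2 by rewrite mulr_ge0// exprn_ge0.
(* Three demands: the probability budget [e / 4], a second moment [D1 e2] of the linear part small
   enough for Chebyshev at level [e / 2], and a mean [C2 M2 e2] of the remainder small enough for
   Markov at the same level. The added 1 keeps the denominators positive. *)
pose e2 := Num.min (e / 4) (Num.min (e / 4 * (e / 2) ^+ 2 / (D1 + 1))
  (e / 4 * (e / 2) / (C2 * M2 + 1))).
have D1p : 0 < D1 + 1 by rewrite ltr_wpDl.
have CMp : 0 < C2 * M2 + 1 by rewrite ltr_wpDl// mulr_ge0.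
have e2p : 0 < e2.
  by rewrite !lt_min e40 !divr_gt0// ?mulr_gt0// exprn_gt0.
have e2a : e2 <= e / 4 by rewrite /e2 ge_min lexx.
have e2b : D1 * e2 <= e / 4 * (e / 2) ^+ 2.
  apply: (@le_trans _ _ ((D1 + 1) * (e / 4 * (e / 2) ^+ 2 / (D1 + 1)))).
    apply: ler_pM => //; [exact: ltW|by rewrite lerDl|by rewrite /e2 !ge_min lexx orbT].
  by rewrite mulrCA divff ?mulr1// gt_eqF.
have e2c : C2 * M2 * e2 <= e / 4 * (e / 2).
  apply: (@le_trans _ _ ((C2 * M2 + 1) * (e / 4 * (e / 2) / (C2 * M2 + 1)))).
    apply: ler_pM; [exact: mulr_ge0|exact: ltW|by rewrite lerDl|by rewrite /e2 !ge_min lexx !orbT].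
  by rewrite mulrCA divff ?mulr1// gt_eqF.
(* The smallness [e2] depends, through [M2], on the bound [b] of the increments, so [latent] is
   applied twice: once to obtain [b], then with [e2]. *)
have [b' _ latent2] := latent e2p.
near=> n.
have n0 : (0 < n)%N by near: n; exact: nbhs_infty_gt.
have n0R : 0 < n%:R :> R by rewrite ltr0n.
have N0 : 0 < N n by rewrite ltr0n (nbr_total_gt0 nbr_max_min).
set s := Num.sqrt n%:R.
have s1 : 1 <= s by rewrite -(sqrtr1 R) ler_wsqrtr// ler1n.
have s0 : 0 < s by exact: lt_le_trans s1.
have s2 : s ^+ 2 = n%:R by rewrite sqr_sqrtr// ltW.
have sN : 0 < s / N n by rewrite divr_gt0.
have [A1 [mA1 PA1 HA1]] : exists A, [/\ measurable A, (P A <= (e / 4)%:E)%E & forall w, ~ A w ->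
    Num.sqrt n%:R / N n * \sum_(g | K n g) (X (t n g.2) w - X (t n g.1) w) ^+ 2 <= e / 4 /\
    forall g, K n g -> `|X (t n g.2) w - X (t n g.1) w| <= b] by near: n.
have [A2 [mA2 PA2 HA2]] : exists A, [/\ measurable A, (P A <= e2%:E)%E & forall w, ~ A w ->
    Num.sqrt n%:R / N n * \sum_(g | K n g) (X (t n g.2) w - X (t n g.1) w) ^+ 2 <= e2 /\
    forall g, K n g -> `|X (t n g.2) w - X (t n g.1) w| <= b'] by near: n.
pose x (g : 'I_n.+1 * 'I_n.+1) w := X (t n g.2) w - X (t n g.1) w.
pose a (g : 'I_n.+1 * 'I_n.+1) w := U n g.2 w - U n g.1 w.
pose Q w := s / N n * \sum_(g | K n g) x g w ^+ 2.
have Hxg g : measurable_wrt H (x g) by apply: (measurable_wrtB sH); exact: HXw.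
have Hsq (Y : Omega -> R) : measurable_wrt H Y -> measurable_wrt H (fun w => Y w ^+ 2).
  by apply: (measurable_wrt_comp sH (h := fun y => y ^+ 2)); exact: measurable_funX.
have HQ : measurable_wrt H Q.
  apply: (measurable_wrtM sH); first exact: measurable_wrt_cst.
  by apply: (measurable_wrt_sum sH) => g _; exact: Hsq.
(* the increments, switched off on the exceptional event *)
pose x' g w := x g w * (\1_[set w | Q w <= e2] w * \1_[set w | `|x g w| <= b] w).
have Hx' g : measurable_wrt H (x' g).
  apply: (measurable_wrtM sH) => //; apply: (measurable_wrtM sH); apply: (measurable_wrt_indic sH).
    by apply: (measurable_wrt_ler sH) => //; exact: measurable_wrt_cst.
  apply: (measurable_wrt_ler sH); last exact: measurable_wrt_cst.
  by apply: (measurable_wrt_comp sH (h := fun y => `|y|)).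
have xb' g w : `|x' g w| <= b.
  rewrite /x' !indicE; case: (boolP (w \in [set w | `|x g w| <= b])) => [|_]; last first.
    by rewrite !mulr0 normr0.
  rewrite inE /= => h; case: (_ \in _); rewrite ?mulr1//.
  by rewrite mulr0 normr0.
pose S := e2 * N n / s.
have S0 : 0 <= S by rewrite divr_ge0 ?mulr_ge0// ltW.
have xS' w : \sum_(g | K n g) x' g w ^+ 2 <= S.
  case: (leP (Q w) e2) => [Qe|eQ]; last first.
    rewrite big1// => g _.
    by rewrite /x' indicE memNset /= ?mul0r ?mulr0 ?expr0n// => h; move: eQ; rewrite ltNge h.
  apply: (@le_trans _ _ (\sum_(g | K n g) x g w ^+ 2)).
    apply: ler_sum => g _; rewrite /x' exprMn ler_piMr ?sqr_ge0//.
  have -> : S = e2 / (s / N n) by rewrite /S; field; rewrite !gt_eqF.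
  by rewrite ler_pdivlMr// mulrC.
have xx' w g : ~ A1 w -> ~ A2 w -> K n g -> x' g w = x g w.
  move=> /HA1 [_ h1] /HA2 [h2 _] Kg.
  by rewrite /x' !indicE !mem_set ?mulr1//=; exact: h1.
have ind : independent_sigma P (sigma_of setT (@err n)) H.
  by apply: (independent_sigma_sub (@err_sigma n) _ (U_X_independent (n := n))).
have Kr i : (#|[pred l | K n (i, l)]| <= nbr_max n (t n) (xi n))%N.
  by rewrite card_closer; apply: card_nbr_le; exact: t_incr.
have Kl i : (#|[pred l | K n (l, i)]| <= nbr_max n (t n) (xi n))%N.
  by rewrite card_closel; apply: card_nbr_le; exact: t_incr.
have am q : (q <= q0)%N -> forall g, K n g ->
    L1 P (fun w => a g w ^+ q) /\ \int[P]_w (a g w ^+ q) = diff_moment f q.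
  move=> qq0 g /close_neq Kg; apply: err_pair_moment => //.
  by rewrite eq_sym.
have am2 g : K n g -> L1 P (fun w => (a g w ^+ (2 * l).-1) ^+ 2) /\
    \int[P]_w ((a g w ^+ (2 * l).-1) ^+ 2) = M1.
  move=> Kg; have := am _ q1 g Kg.
  have E : (fun w => a g w ^+ (2 * (2 * l).-1)) = (fun w => (a g w ^+ (2 * l).-1) ^+ 2).
    by apply/funext => w; rewrite mulnC exprM.
  by rewrite E.
have mphi q (c : R) : measurable_fun setT (fun z : R * R => c + (z.2 - z.1) ^+ q).
  apply: measurable_funD => //; apply: measurable_funX; exact: measurable_funB.
have [LL EL] : L2 P (fun w => \sum_(g | K n g) a g w ^+ (2 * l).-1 * x' g w) /\
    \int[P]_w ((\sum_(g | K n g) a g w ^+ (2 * l).-1 * x' g w) ^+ 2) <=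
    (4 * nbr_max n (t n) (xi n))%:R * S * M1.
  have mphi' : measurable_fun setT (fun z : R * R => (z.2 - z.1) ^+ (2 * l).-1).
    by apply: measurable_funX; exact: measurable_funB.
  refine (weighted_pair_variance (@err_measurable n) (@U_independent n) Kr Kl mH sH ind
    Hx' xb' xS' mphi' _ _ _ M10).
  - move=> g Kg; split; last exact: (am2 g Kg).1.
    by apply: measurable_funX; apply: measurable_funB; exact: err_measurable.
  - move=> g Kg; have [_ E] := am _ q2 g Kg; rewrite -[RHS](diff_moment_odd mf f0 f1 q0r fr moment_odd0 q2_odd q2).
    exact: E.
  - by move=> g Kg; exact: (am2 g Kg).2.
have [LQ EQ] : L1 P (fun w => \sum_(g | K n g) x' g w ^+ 2 * ((1 + b) ^+ (2 * l) + a g w ^+ (2 * l))) /\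
    \int[P]_w (\sum_(g | K n g) x' g w ^+ 2 * ((1 + b) ^+ (2 * l) + a g w ^+ (2 * l))) <= S * M2.
  refine (weighted_pair_sum mH sH ind Hx' xb' xS' (mphi (2 * l)%N ((1 + b) ^+ (2 * l))) _ _ M20).
  - move=> g Kg; apply: L1D; first exact: L1_cst.
    by have [+ _] := am _ q3 g Kg.
  - move=> g Kg; have [h1 h2] := am _ q3 g Kg.
    by rewrite ExD ?Ex_cst ?h2//; exact: L1_cst.
pose Lin w := s / N n * (2 * l)%:R * \sum_(g | K n g) a g w ^+ (2 * l).-1 * x' g w.
pose Rem w := s / N n * C2 *
  \sum_(g | K n g) x' g w ^+ 2 * ((1 + b) ^+ (2 * l) + a g w ^+ (2 * l)).
have LLin : L2 P Lin by exact: L2Zl.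
have ELin : \int[P]_w (Lin w ^+ 2) <= e / 4 * (e / 2) ^+ 2.
  apply: le_trans e2b.
  under eq_Rintegral do rewrite exprMn.
  rewrite ExZl; last by have [] := LL.
  apply: (le_trans (ler_wpM2l (sqr_ge0 _) EL)).
  rewrite [(4 * nbr_max _ _ _)%:R]natrM; set kap : R := (nbr_max n (t n) (xi n))%:R.
  have -> : (s / N n * (2 * l)%:R) ^+ 2 * (4 * kap * S * M1) =
      (2 * l)%:R ^+ 2 * (4 * (kap * n%:R / N n * M1)) * e2 / s.
    by rewrite -s2 /S; field; rewrite !gt_eqF.
  have kN : kap * n%:R / N n <= C1 by rewrite ler_pdivrMr// HC1.
  rewrite ler_pdivrMr//; apply: (@le_trans _ _ (D1 * e2)); last first.
    by rewrite -{1}[D1 * e2]mulr1 ler_wpM2l// mulr_ge0// ltW.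
  by rewrite /D1 ler_wpM2r ?(ltW e2p)// ler_wpM2l ?sqr_ge0// ler_wpM2l// ler_wpM2r.
have LRem : L1 P Rem by exact: L1Zl.
have ERem : \int[P]_w Rem w <= e / 4 * (e / 2).
  apply: le_trans e2c; rewrite ExZl//.
  have sNC : 0 <= s / N n * C2 by rewrite mulr_ge0// ltW.
  apply: (le_trans (ler_wpM2l sNC EQ)).
  have -> : s / N n * C2 * (S * M2) = C2 * M2 * e2 by rewrite /S; field; rewrite !gt_eqF.
  by [].
have Rem0 w : 0 <= Rem w.
  rewrite /Rem mulr_ge0//; first by rewrite mulr_ge0// ltW.
  apply: sumr_ge0 => g _; rewrite mulr_ge0 ?sqr_ge0// addr_ge0//; first by rewrite exprn_ge0// addr_ge0.
  by rewrite exprM exprn_ge0// sqr_ge0.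
have e22 : 0 < (e / 2) ^+ 2 by rewrite exprn_gt0.
pose A3 := [set w | ((e / 2) ^+ 2 <= Lin w ^+ 2)%R].
pose A4 := [set w | (e / 2 <= Rem w)%R].
have mA3 : measurable A3.
  rewrite -[X in measurable X]setTI; apply: measurable_fun_ler => //.
  exact: L1_measurable LLin.2.
have mA4 : measurable A4.
  rewrite -[X in measurable X]setTI; apply: measurable_fun_ler => //.
  exact: L1_measurable LRem.
have PA3 : (P A3 <= (e / 4)%:E)%E.
  apply: (le_trans (markov_ge e22 LLin.2 _)); first by move=> w; exact: sqr_ge0.
  by rewrite lee_fin ler_pdivrMr.
have PA4 : (P A4 <= (e / 4)%:E)%E.
  apply: (le_trans (markov_ge e20 LRem Rem0)).
  by rewrite lee_fin ler_pdivrMr.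
have PA2' : (P A2 <= (e / 4)%:E)%E by apply: (le_trans PA2); rewrite lee_fin.
exists ((A1 `|` A2) `|` (A3 `|` A4)); split.
- by apply: measurableU; exact: measurableU.
- have := measure_setU_le (measurableU _ _ mA1 mA2) (measurableU _ _ mA3 mA4)
    (measure_setU_le mA1 mA2 PA1 PA2') (measure_setU_le mA3 mA4 PA3 PA4).
  by rewrite (_ : e / 4 + e / 4 + (e / 4 + e / 4) = e)//; field.
move=> w /not_orP[/not_orP[nA1 nA2] /not_orP[nA3 nA4]].
have Lw : `|Lin w| <= e / 2.
  rewrite -sqrtr_sqr -[e / 2]ger0_norm ?(ltW e20)// -sqrtr_sqr ler_wsqrtr//.
  by rewrite leNgt; apply/negP => h; apply: nA3; exact: ltW.
have Rw : Rem w <= e / 2 by rewrite leNgt; apply/negP => h; apply: nA4; exact: ltW.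
(* Off the exceptional events [x'] is the true increment, so the normalized difference minus its
   linear part is a sum of Taylor remainders. *)
suff main : `|s * (diff_moment_hat n (t n) (xi n) (fun j => X (t n j) w + U n j w) l
     - diff_moment_hat n (t n) (xi n) (fun j => U n j w) l) - Lin w| <= Rem w.
  set D := s * _ in main *; rewrite (_ : D = (D - Lin w) + Lin w); last by ring.
  by apply: (le_trans (ler_normD _ _)); rewrite [leRHS]splitr; apply: lerD => //; exact: le_trans Rw.
have -> : s * (diff_moment_hat n (t n) (xi n) (fun j => X (t n j) w + U n j w) l
     - diff_moment_hat n (t n) (xi n) (fun j => U n j w) l) - Lin w =
    s / N n * \sum_(g | K n g) ((a g w + x' g w) ^+ (2 * l) - a g w ^+ (2 * l)
      - (2 * l)%:R * a g w ^+ (2 * l).-1 * x' g w).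
  rewrite /diff_moment_hat !nbr_sumE -mulrBr mulrA /Lin -[X in _ - X]mulrA -mulrBr.
  rewrite mulr_sumr -!sumrB.
  congr (_ * _); apply: eq_bigr => g Kg; rewrite xx'// mulrA; congr (_ ^+ _ - _ - _).
  by rewrite /a /x; ring.
rewrite /Rem normrM (gtr0_norm sN) -[leRHS]mulrA ler_wpM2l ?(ltW sN)// mulr_sumr.
apply: (le_trans (ler_norm_sum _ _ _)); apply: ler_sum => g _.
exact: expr_taylor1_even.
Unshelve. all: by end_near. Qed.

End Remainder.

End Errors.

(** * The limit covariance *)

Section CovarianceTools.
Context {R : realType} {d : measure_display} {T : measurableType d}.
Variable P : probability T R.

(** The second moment of [s X + Y] is affine in [s] when that of [X] is zero; with a nonzero slope
    it would take the value -1 at the chosen [s]. *)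
Lemma ExM_null (X Y : T -> R) : L2 P X -> L2 P Y -> \int[P]_w (X w ^+ 2) = 0 ->
  \int[P]_w (X w * Y w) = 0.
Proof.
move=> LX LY X0; apply/eqP; apply/negPn/negP => c0.
set c := \int[P]_w (X w * Y w) in c0.
set s := - (\int[P]_w (Y w ^+ 2) + 1) / (2 * c).
have : 0 <= \int[P]_w ((s * X w + Y w) ^+ 2) by apply: Ex_ge0 => w; exact: sqr_ge0.
have -> : \int[P]_w ((s * X w + Y w) ^+ 2) =
    \int[P]_w (s ^+ 2 * X w ^+ 2 + (2 * s * (X w * Y w) + Y w ^+ 2)).
  by apply: eq_Rintegral => w _; ring.
have [[_ X2] [_ Y2]] := (LX, LY); have XY := L2M LX LY.
rewrite ExD; [|exact: L1Zl|by apply: L1D => //; exact: L1Zl].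
rewrite ExD//; last exact: L1Zl.
rewrite !ExZl// X0 -/c /s.
have -> : 2 * (- (\int[P]_w Y w ^+ 2 + 1) / (2 * c)) * c = - (\int[P]_w Y w ^+ 2 + 1).
  by field.
by lra.
Qed.

Lemma expectationE (X : T -> R) : ('E_P[X] = \int[P]_w (X w)%:E)%E.
Proof. by rewrite unlock. Qed.

Lemma variance_centered (X : T -> R) : \int[P]_w X w = 0 ->
  ('V_P[X] = \int[P]_w (X w ^+ 2)%:E)%E.
Proof.
move=> X0; rewrite /variance unlock expectationE.
have -> : fine 'E_P[X] = 0 by rewrite expectationE.
apply: eq_integral => w _; congr (_%:E).
by change ((X w - 0) * (X w - 0) = X w ^+ 2); rewrite subr0 expr2.
Qed.

Lemma cvg_sum_seq (I : Type) (s : seq I) (Q : pred I) (u : I -> nat -> R) (l : I -> R) :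
  (forall i, Q i -> u i n @[n --> \oo] --> l i) ->
  \sum_(i <- s | Q i) u i n @[n --> \oo] --> \sum_(i <- s | Q i) l i.
Proof.
move=> ul; elim: s => [|i s IHs].
  by under eq_fun do rewrite big_nil; rewrite big_nil; exact: cvg_cst.
under eq_fun do rewrite big_cons; rewrite big_cons; case: ifP => // Qi.
by apply: cvgD IHs; exact: ul.
Qed.

End CovarianceTools.

Section ErrorSums.
Context {R : realType} {d : measure_display} {Omega : measurableType d}.
Variables (P : probability Omega R) (f : R -> R) (U : nat -> nat -> Omega -> R).
Hypotheses (mf : measurable_fun setT f) (f0 : forall x : R, 0 <= f x)
  (f1 : (\int[lebesgue_measure]_x (f x)%:E = 1)%E).
Hypotheses (U_measurable : forall n j, (j <= n)%N -> measurable_fun setT (U n j))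
  (U_density : forall n j, (j <= n)%N -> has_density P f (U n j))
  (U_independent : forall n, independent_variables P (fun j : 'I_n.+1 => U n j)).
Variables (r : R) (k : nat).
Hypotheses (q0r : (4 * k)%:R <= r)
  (fr : (\int[lebesgue_measure]_x (`|x| `^ r * f x)%:E < +oo)%E).
Variables (t : nat -> nat -> R) (xi : nat -> R).
Hypotheses (t_incr : forall n j, (j < n)%N -> t n j < t n j.+1)
  (nbr_max_min : asymp (R := R) (fun n => (nbr_max n (t n) (xi n))%:R)
                       (fun n => (nbr_min n (t n) (xi n))%:R)).
Local Notation N n := ((nbr_total n (t n) (xi n))%:R : R).
Local Notation K n := (@close R n (t n) (xi n)).
Local Notation C := (centered_sum f t xi U).

Definition pair_dev l (z : R * R) : R := (z.2 - z.1) ^+ (2 * l) - diff_moment f (2 * l).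

Lemma measurable_pair_dev l : measurable_fun setT (pair_dev l).
Proof.
by apply: measurable_funB => //; apply: measurable_funX; exact: measurable_funB.
Qed.

Lemma centered_sumE n l w : C n l w = \sum_(g | K n g) pair_dev l (U n g.1 w, U n g.2 w).
Proof. by rewrite /centered_sum nbr_sumE. Qed.

Lemma pair_dev_L2 n (i j : 'I_n.+1) l : i != j -> (l <= k)%N ->
  L2 P (fun w => pair_dev l (U n i w, U n j w)) /\
  \int[P]_w pair_dev l (U n i w, U n j w) = 0.
Proof.
move=> ij lk; have ji : j != i by rewrite eq_sym.
have q1 : (2 * l <= 4 * k)%N by lia.
have q2 : (2 * (2 * l) <= 4 * k)%N by lia.
have [L1a E1] := err_pair_moment mf f0 f1 U_measurable U_density U_independent q0r fr ji q1.
have [L1b _] := err_pair_moment mf f0 f1 U_measurable U_density U_independent q0r fr ji q2.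
have La : L2 P (fun w => (U n j w - U n i w) ^+ (2 * l)).
  split; first exact: L1_measurable L1a.
  have E : (fun w => (U n j w - U n i w) ^+ (2 * (2 * l))) =
      (fun w => ((U n j w - U n i w) ^+ (2 * l)) ^+ 2).
    by apply/funext => w; rewrite [(2 * (2 * l))%N]mulnC exprM.
  by rewrite -E.
split; first by apply: L2B => //; exact: L2_cst.
by rewrite ExB ?E1 ?Ex_cst ?subrr//; exact: L1_cst.
Qed.

Lemma centered_sum_L2 n l : (l <= k)%N -> L2 P (C n l) /\ \int[P]_w C n l w = 0.
Proof.
move=> lk; have E : C n l = fun w => \sum_(g | K n g) pair_dev l (U n g.1 w, U n g.2 w).
  by apply/funext => w; exact: centered_sumE.
rewrite E; split; first by apply: L2_sum => g /close_neq gn; exact: (pair_dev_L2 gn lk).1.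
rewrite Ex_sum; last by move=> g /close_neq gn; exact: L2_L1 (pair_dev_L2 gn lk).1.
by apply: big1 => g /close_neq gn; exact: (pair_dev_L2 gn lk).2.
Qed.

Lemma VnumE n l : (l <= k)%N -> Vnum P f t xi U n l = \int[P]_w (C n l w ^+ 2) / N n.
Proof.
move=> lk; have [LC EC] := centered_sum_L2 n lk.
rewrite /Vnum variance_centered; last by rewrite ExZl ?EC ?mulr0//; exact: L2_L1.
transitivity (\int[P]_w (((Num.sqrt (N n))^-1 * C n l w) ^+ 2)); first by [].
under eq_Rintegral do rewrite exprMn.
by rewrite ExZl ?exprVn ?sqr_sqrtr// 1?mulrC//; exact: LC.2.
Qed.

Lemma Vnum_ge0 n l : (l <= k)%N -> 0 <= Vnum P f t xi U n l.
Proof. by move=> lk; rewrite VnumE// divr_ge0// Ex_ge0// => w; exact: sqr_ge0. Qed.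

(* This holds also when a variance vanishes, in which case the standardized sum
   is a division by zero. *)
Lemma covariance_limit_seq n l1 l2 : (0 < n)%N -> (l1 <= k)%N -> (l2 <= k)%N ->
  a_seq P f t xi U l1 n * a_seq P f t xi U l2 n * e_seq P f t xi U l1 l2 n =
  n%:R / N n ^+ 2 * \int[P]_w (C n l1 w * C n l2 w).
Proof.
move=> n0 k1 k2; have [L1c E1] := centered_sum_L2 n k1; have [L2c E2] := centered_sum_L2 n k2.
have N0 : 0 < N n by rewrite ltr0n (nbr_total_gt0 nbr_max_min).
have n0R : 0 < n%:R :> R by rewrite ltr0n.
have V1 := Vnum_ge0 n k1; have V2 := Vnum_ge0 n k2.
have zero l : (l <= k)%N -> Vnum P f t xi U n l = 0 -> \int[P]_w (C n l w ^+ 2) = 0.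
  move=> lk; rewrite VnumE// => /eqP; rewrite mulf_eq0 invr_eq0 (gt_eqF N0) orbF.
  by move/eqP.
have [z1|p1] := eqVneq (Vnum P f t xi U n l1) 0.
  rewrite (ExM_null L1c L2c (zero _ k1 z1)) mulr0.
  by rewrite /a_seq z1 mulr0 mul0r sqrtr0 !mul0r.
have [z2|p2] := eqVneq (Vnum P f t xi U n l2) 0.
  under eq_Rintegral do rewrite mulrC.
  rewrite (ExM_null L2c L1c (zero _ k2 z2)) mulr0.
  by rewrite /a_seq z2 mulr0 mul0r sqrtr0 mulr0 mul0r.
have {p1}V1 : 0 < Vnum P f t xi U n l1 by rewrite lt_neqAle eq_sym p1.
have {p2}V2 : 0 < Vnum P f t xi U n l2 by rewrite lt_neqAle eq_sym p2.
rewrite /e_seq expectationE /standardized_sum.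
set s1 := Num.sqrt (N n * Vnum P f t xi U n l1).
set s2 := Num.sqrt (N n * Vnum P f t xi U n l2).
have s10 : 0 < s1 by rewrite sqrtr_gt0 mulr_gt0.
have s20 : 0 < s2 by rewrite sqrtr_gt0 mulr_gt0.
rewrite -/(Rintegral P setT (fun w => C n l1 w / s1 * (C n l2 w / s2))).
have -> : \int[P]_w (C n l1 w / s1 * (C n l2 w / s2)) =
    (s1 * s2)^-1 * \int[P]_w (C n l1 w * C n l2 w).
  rewrite -ExZl; last exact: L2M.
  by apply: eq_Rintegral => w _; rewrite mulrACA -invfM mulrC.
rewrite mulrA; congr (_ * _).
have aE l : 0 < Vnum P f t xi U n l ->
    a_seq P f t xi U l n = Num.sqrt n%:R / N n * Num.sqrt (N n * Vnum P f t xi U n l).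
  move=> V0; rewrite /a_seq.
  have -> : n%:R * Vnum P f t xi U n l / N n = (n%:R / N n ^+ 2) * (N n * Vnum P f t xi U n l).
    by field; rewrite gt_eqF.
  rewrite sqrtrM ?divr_ge0 ?exprn_ge0 ?ltW// sqrtrM ?ltW//.
  by rewrite sqrtrV ?exprn_ge0 ?ltW// sqrtr_sqr gtr0_norm.
rewrite !aE// -/s1 -/s2.
have -> : Num.sqrt n%:R / N n * s1 * (Num.sqrt n%:R / N n * s2) / (s1 * s2) =
    Num.sqrt n%:R ^+ 2 / N n ^+ 2 by field; rewrite !gt_eqF.
by rewrite sqr_sqrtr// ltW.
Qed.

Lemma a_seq_sqr n l : (0 < n)%N -> (l <= k)%N ->
  a_seq P f t xi U l n ^+ 2 = \int[P]_w ((Num.sqrt n%:R / N n * C n l w) ^+ 2).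
Proof.
move=> n0 lk; have [LC EC] := centered_sum_L2 n lk.
have N0 : 0 < N n by rewrite ltr0n (nbr_total_gt0 nbr_max_min).
under eq_Rintegral do rewrite exprMn.
rewrite ExZl; last exact: LC.2.
rewrite /a_seq sqr_sqrtr; last by rewrite divr_ge0// mulr_ge0// Vnum_ge0.
by rewrite VnumE// exprMn sqr_sqrtr//; field; rewrite gt_eqF.
Qed.

Hypotheses (a_exists : forall l, (1 <= l <= k)%N -> cvgn (a_seq P f t xi U l))
  (e_exists : forall l1 l2, (1 <= l1 <= k)%N -> (1 <= l2 <= k)%N ->
     cvgn (e_seq P f t xi U l1 l2)).

(** The factor 1/2 is that of the estimator recursion, and the same one appears in [a_lim]. *)
Definition half_deviation n l w : R := 2^-1 * (Num.sqrt n%:R / N n * C n l w).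

Lemma half_deviation_OP l : (1 <= l <= k)%N -> OP P (fun n w => half_deviation n l w).
Proof.
move=> lk; have /andP[l1 l_k] := lk.
pose a := lim (a_seq P f t xi U l n @[n --> \oo]).
have ca : a_seq P f t xi U l n @[n --> \oo] --> a by exact: a_exists.
apply: OPZl; apply: (@OP_L2 _ _ _ _ _ ((`|a| + 1) ^+ 2)).
  by apply: nearW => n; apply: L2Zl; exact: (centered_sum_L2 n l_k).1.
near=> n; have n0 : (0 < n)%N by near: n; exact: nbhs_infty_gt.
rewrite -a_seq_sqr// lerXn2r ?nnegrE ?addr_ge0 ?sqrtr_ge0//.
have : `|a - a_seq P f t xi U l n| <= 1 by near: n; move/cvgrPdist_le: ca; apply.
by rewrite ler_distl => /andP[h _]; have := ler_norm a; lra.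
Unshelve. all: by end_near. Qed.

Section Combination.
Variable c : nat -> R.

(** The variance of the sum of [c l * a_l * W_l] for a Gaussian vector with covariances [e_lim],
    written without such a vector. *)
Definition limit_variance : R := \sum_(1 <= i < k.+1) \sum_(1 <= j < k.+1)
  (c i * a_lim P f t xi U i) * (c j * a_lim P f t xi U j) * e_lim P f t xi U i j.

Let S n w := \sum_(1 <= l < k.+1) c l * half_deviation n l w.

(** By [covariance_limit_seq] every covariance is a product of terms of [a_seq] and [e_seq], which
    converge by hypothesis; nothing has to be computed from the grid. The 1/4 comes from the two
    factors 1/2. *)
Lemma combination_variance_cvg :
  \int[P]_w (S n w ^+ 2) @[n --> \oo] --> limit_variance.
Proof.
have lim_ : \sum_(1 <= i < k.+1) \sum_(1 <= j < k.+1)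
    4^-1 * (c i * c j) * (a_seq P f t xi U i n * a_seq P f t xi U j n * e_seq P f t xi U i j n)
    @[n --> \oo] --> limit_variance.
  rewrite /limit_variance big_nat; under eq_fun do rewrite big_nat.
  apply: cvg_sum_seq => i ik; rewrite big_nat; under eq_fun do rewrite big_nat.
  apply: cvg_sum_seq => j jk.
  rewrite (_ : _ * _ * _ = 4^-1 * (c i * c j) *
    (lim (a_seq P f t xi U i n @[n --> \oo]) * lim (a_seq P f t xi U j n @[n --> \oo])
      * lim (e_seq P f t xi U i j n @[n --> \oo]))); last first.
    by rewrite /a_lim /e_lim; move: (lim _) (lim _) (lim _) => x y z; field.
  apply: cvgMr; apply: cvgM; [apply: cvgM|]; [exact: a_exists|exact: a_exists|exact: e_exists].
apply: cvg_trans lim_; apply: near_eq_cvg; near=> n.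
have n0 : (0 < n)%N by near: n; exact: nbhs_infty_gt.
transitivity (\int[P]_w (\sum_(1 <= i < k.+1) \sum_(1 <= j < k.+1)
    (4^-1 * (c i * c j) * (n%:R / N n ^+ 2)) * (C n i w * C n j w))); last first.
  apply: eq_Rintegral => w _; rewrite /S [RHS]expr2 [RHS]big_distrlr.
  apply: eq_bigr => i _; apply: eq_bigr => j _; rewrite /half_deviation.
  rewrite -[n%:R in LHS](@sqr_sqrtr _ n%:R)//=.
  set s := Num.sqrt _; set v := (N n)^-1; rewrite -exprVn -/v; by field.
have LM i j : (1 <= i < k.+1)%N -> (1 <= j < k.+1)%N -> L1 P (fun w => C n i w * C n j w).
  move=> /andP[_ ik] /andP[_ jk].
  by apply: L2M; [exact: (centered_sum_L2 n ik).1|exact: (centered_sum_L2 n jk).1].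
under [RHS]eq_Rintegral do rewrite big_nat.
rewrite big_nat Ex_sum; last first.
  by move=> i ik; under eq_fun do rewrite big_nat; apply: L1_sum => j jk; apply: L1Zl; exact: LM.
apply: eq_bigr => i ik; under [RHS]eq_Rintegral do rewrite big_nat.
rewrite big_nat Ex_sum; last by move=> j jk; apply: L1Zl; exact: LM.
apply: eq_bigr => j jk; rewrite ExZl; last exact: LM.
have /andP[_ ik'] := ik; have /andP[_ jk'] := jk.
by rewrite covariance_limit_seq// mulrA.
Unshelve. all: by end_near. Qed.

Lemma limit_variance_ge0 : 0 <= limit_variance.
Proof.
apply: (cvgr_to_ge combination_variance_cvg); apply: nearW => n.
by apply: Ex_ge0 => w; exact: sqr_ge0.
Qed.

(** A linear combination of the centered sums is again a sum over close pairs, with the single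
    kernel [H], so a scalar limit theorem covers all directions. *)
Lemma combination_clt theta :
  \int[P]_w cos (S n w + theta) @[n --> \oo] --> expR (- (limit_variance / 2)) * cos theta.
Proof.
pose H (z : R * R) := \sum_(1 <= l < k.+1) c l / 2 * pair_dev l z.
have mH : measurable_fun setT H.
  by apply: measurable_sum_cond => l _; apply: measurable_funM => //; exact: measurable_pair_dev.
have SE n w : S n w = \sum_(g | K n g) Num.sqrt n%:R / N n * H (err U g.1 w, err U g.2 w).
  rewrite /H -mulr_sumr exchange_big/= mulr_sumr; apply: eq_bigr => l _.
  rewrite /half_deviation centered_sumE -mulr_sumr /err.
  by set v := (nbr_total _ _ _)%:R^-1; field.
have idU n i m j (A : set R) : measurable A ->
    P (@err _ _ _ U n i @^-1` A) = P (@err _ _ _ U m j @^-1` A).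
  by move=> mA; rewrite !(err_density U_density)//.
have [B HB] := scale_variance_bound nbr_max_min.
have ref : (ord0 : 'I_2) != lift ord0 ord0 by [].
have LHl l : (1 <= l < k.+1)%N -> L2 P (fun w => c l / 2 * pair_dev l (ref_pair (@err _ _ _ U) w)).
  by move=> /andP[_ lk]; apply: L2Zl; exact: (pair_dev_L2 ref lk).1.
have clt := @pair_clt _ _ _ P (@err _ _ _ U) (err_measurable U_measurable)
  U_independent idU H mH (fun n => K n) (fun n => nbr_max n (t n) (xi n))
  (fun n => Num.sqrt n%:R / N n).
have LHref : L2 P (fun w => H (ref_pair (@err _ _ _ U) w)).
  by rewrite /H; under eq_fun do rewrite big_nat; exact: L2_sum.
have EHref : \int[P]_w H (ref_pair (@err _ _ _ U) w) = 0.
  rewrite /H; under eq_Rintegral do rewrite big_nat.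
  rewrite Ex_sum; last by move=> l lk; exact/L2_L1/LHl.
  apply: big1 => l /andP[_ lk]; have [h1 h2] := pair_dev_L2 ref lk.
  by rewrite ExZl ?h2 ?mulr0//; exact: L2_L1.
have -> : (fun n => \int[P]_w cos (S n w + theta)) = (fun n => \int[P]_w cos
    ((\sum_(g | K n g) Num.sqrt n%:R / N n * H (err U g.1 w, err U g.2 w)) + theta)).
  by apply/funext => n; apply: eq_Rintegral => w _; rewrite SE.
apply: (clt _ _ _ B) => //.
- by move=> n g; exact: close_neq.
- by move=> n i; rewrite card_closer; apply: card_nbr_le; exact: t_incr.
- by move=> n i; rewrite card_closel; apply: card_nbr_le; exact: t_incr.
- by apply: filterS HB => n; rewrite card_close.
- apply: cvg_trans (scale_third_order nbr_max_min); apply: near_eq_cvg.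
  by apply: nearW => n; rewrite card_close.
- apply: cvg_trans combination_variance_cvg; apply: near_eq_cvg; apply: nearW => n.
  by apply: eq_Rintegral => w _; rewrite SE.
Qed.

End Combination.

End ErrorSums.

(** * The moment recursion *)

Section LimitVector.
Context {R : realType}.
Variable m : nat -> R.
Local Notation drive d := (limit_vector (fun=> 1) d m).

Lemma limit_vector_drive (a W : nat -> R) l :
  limit_vector a W m l = drive (fun i => a i * W i) l.
Proof.
elim/ltn_ind: l => l IHl; rewrite limit_vectorE [RHS]limit_vectorE mul1r; congr (_ - _).
by apply: eq_big_nat => j /andP[_ jl]; rewrite IHl.
Qed.

(** The response of component [l] of the triangular recursion to a unit input at [j], that is, an
    entry of the matrix that solves it. *)
Definition drive_coef (l j : nat) : R := drive (fun i => (i == j)%:R) l.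

Lemma drive_linear (d : nat -> R) (k l : nat) : (1 <= l <= k)%N ->
  drive d l = \sum_(1 <= j < k.+1) d j * drive_coef l j.
Proof.
elim/ltn_ind: l => l IHl /andP[l1 lk]; rewrite limit_vectorE mul1r.
under [in RHS]eq_bigr do rewrite /drive_coef limit_vectorE mul1r mulrBr.
rewrite sumrB; congr (_ - _).
  rewrite (bigD1_seq l)//= ?mem_index_iota ?iota_uniq//; last by rewrite l1 ltnS lk.
  rewrite eqxx mulr1 big1 ?addr0// => j /negbTE jl.
  by rewrite eq_sym jl mulr0.
under [RHS]eq_bigr do rewrite mulr_sumr.
rewrite exchange_big/=; apply: eq_big_nat => i /andP[i1 il].
rewrite IHl//; last by rewrite i1 (leq_trans (ltnW il)).
by rewrite mulr_sumr; apply: eq_bigr => j _; rewrite /drive_coef mulrCA.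
Qed.

End LimitVector.

Section Recursion.
Context {R : realType}.
Variables (m D : nat -> R).

(** Subtract the identity for the true moments and expand the products around them. The reflection
    [j -> l - j] makes the two cross sums equal, and the factor 1/2 cancels the doubling; the
    quadratic terms keep a factor [1 / s]. *)
Lemma moment_recursion_deviation (Mh Dh : nat -> R) (s : R) (l : nat) : 0 < s ->
  Mh l = 2^-1 * (Dh l - \sum_(1 <= j < l) 'C(2 * l, 2 * j)%:R * Mh j * Mh (l - j)%N) ->
  D l = 2 * m (2 * l) +
    \sum_(1 <= j < l) 'C(2 * l, 2 * j)%:R * m (2 * j) * m (2 * (l - j)) ->
  let E j := s * (Mh j - m (2 * j)) in
  E l = 2^-1 * (s * (Dh l - D l))
    - \sum_(1 <= j < l) 'C(2 * l, 2 * j)%:R * m (2 * l - 2 * j)%N * E j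
    - s^-1 * (2^-1 * \sum_(1 <= j < l) 'C(2 * l, 2 * j)%:R * (E j * E (l - j)%N)).
Proof.
move=> s0 MhE DE E; pose a j := Mh j - m (2 * j).
have sym : \sum_(1 <= j < l) 'C(2 * l, 2 * j)%:R * m (2 * j) * a (l - j)%N =
    \sum_(1 <= j < l) 'C(2 * l, 2 * j)%:R * m (2 * l - 2 * j)%N * a j.
  rewrite big_nat_rev/=; apply: eq_big_nat => j /andP[j1 jl].
  have -> : (1 + l - j.+1 = l - j)%N by lia.
  have -> : (l - (l - j) = j)%N by lia.
  rewrite mulnBr bin_sub//; lia.
have split : \sum_(1 <= j < l) 'C(2 * l, 2 * j)%:R * Mh j * Mh (l - j)%N =
    \sum_(1 <= j < l) 'C(2 * l, 2 * j)%:R * m (2 * j) * m (2 * (l - j)) +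
    (\sum_(1 <= j < l) 'C(2 * l, 2 * j)%:R * m (2 * l - 2 * j)%N * a j +
     \sum_(1 <= j < l) 'C(2 * l, 2 * j)%:R * m (2 * j) * a (l - j)%N) +
    \sum_(1 <= j < l) 'C(2 * l, 2 * j)%:R * (a j * a (l - j)%N).
  rewrite -!big_split/=; apply: eq_big_nat => j _; rewrite /a -mulnBr; ring.
have Esum : \sum_(1 <= j < l) 'C(2 * l, 2 * j)%:R * m (2 * l - 2 * j)%N * E j =
    s * \sum_(1 <= j < l) 'C(2 * l, 2 * j)%:R * m (2 * l - 2 * j)%N * a j.
  by rewrite mulr_sumr; apply: eq_bigr => j _; rewrite mulrCA.
have Esq : \sum_(1 <= j < l) 'C(2 * l, 2 * j)%:R * (E j * E (l - j)%N) =
    s ^+ 2 * \sum_(1 <= j < l) 'C(2 * l, 2 * j)%:R * (a j * a (l - j)%N).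
  by rewrite mulr_sumr; apply: eq_bigr => j _; rewrite /E -/(a j) -/(a (l - j)%N); ring.
rewrite Esum Esq /E MhE DE split sym.
set S1 := \sum_(1 <= j < l) _ * a j; set S2 := \sum_(1 <= j < l) _ * (a j * _).
by field; rewrite gt_eqF.
Qed.

End Recursion.

Section RecursionOrder.
Context {R : realType} {d : measure_display} {Omega : measurableType d}.
Variables (P : probability Omega R) (m D : nat -> R) (k : nat).
Variables (Mh Dh g : nat -> nat -> Omega -> R).
Hypothesis MhE : forall n l w, Mh n l w = 2^-1 * (Dh n l w
  - \sum_(1 <= j < l) 'C(2 * l, 2 * j)%:R * Mh n j w * Mh n (l - j)%N w).
Hypothesis DE : forall l, (1 <= l <= k)%N -> D l = 2 * m (2 * l) +
    \sum_(1 <= j < l) 'C(2 * l, 2 * j)%:R * m (2 * j) * m (2 * (l - j)).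
Hypothesis g_oP : forall l, (1 <= l <= k)%N ->
  oP P (fun n w => 2^-1 * (Num.sqrt n%:R * (Dh n l w - D l)) - g n l w).
Hypothesis g_OP : forall l, (1 <= l <= k)%N -> OP P (fun n w => g n l w).
Local Notation E n l w := (Num.sqrt n%:R * (Mh n l w - m (2 * l))).
Local Notation G n l w := (limit_vector (fun=> 1) (fun i => g n i w) m l).

Lemma inv_sqrt_cvg0 : (Num.sqrt n%:R)^-1 @[n --> \oo] --> (0 : R).
Proof.
apply/cvgrPdist_le => e e0; near=> n.
have n0 : (0 < n)%N by near: n; exact: nbhs_infty_gt.
have s0 : 0 < Num.sqrt n%:R :> R by rewrite sqrtr_gt0 ltr0n.
rewrite sub0r normrN gtr0_norm ?invr_gt0// -[e]invrK lef_pV2 ?posrE ?invr_gt0//.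
apply: (@le_trans _ _ (Num.sqrt ((e^-1) ^+ 2))); first by rewrite sqrtr_sqr ler_norm.
by rewrite ler_wsqrtr//; near: n; exact: nbhs_infty_ger.
Unshelve. all: by end_near. Qed.

(** The induction carries tightness along with the approximation: the products of two deviations are
    tight, and dividing them by [sqrt n] makes them negligible. *)
Lemma recursion_order l : (1 <= l <= k)%N ->
  oP P (fun n w => E n l w - G n l w) /\ OP P (fun n w => G n l w).
Proof.
elim/ltn_ind: l => l IHl lk; have /andP[l1 l_k] := lk.
have sub j : j \in index_iota 1 l -> (1 <= j <= k)%N /\ (j < l)%N /\
    (1 <= l - j <= k)%N /\ (l - j < l)%N.
  by rewrite mem_index_iota => /andP[j1 jl]; split; [|split; [|split]]; lia.
have OPE j : (1 <= j <= k)%N -> (j < l)%N -> OP P (fun n w => E n j w).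
  move=> jk jl; have [h1 h2] := IHl j jl jk.
  by apply: OP_eq (OPD (oP_OP h1) h2); apply: nearW => n w; rewrite subrK.
split; last first.
  apply: (@OP_eq _ _ _ P _ (fun n w => g n l w +
      - 1 * \sum_(1 <= j < l) 'C(2 * l, 2 * j)%:R * m (2 * l - 2 * j)%N * G n j w)).
    by apply: nearW => n w; rewrite limit_vectorE mul1r mulN1r.
  apply: OPD; first exact: g_OP.
  apply: OPZl; apply: OP_sum => j /sub[jk [jl _]] _; apply: OPZl.
  by have [] := IHl j jl jk.
apply: (@oP_eq _ _ _ P _ (fun n w =>
    (2^-1 * (Num.sqrt n%:R * (Dh n l w - D l)) - g n l w)
    - \sum_(1 <= j < l) 'C(2 * l, 2 * j)%:R * m (2 * l - 2 * j)%N * (E n j w - G n j w)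
    - (2^-1 * \sum_(1 <= j < l) 'C(2 * l, 2 * j)%:R * (E n j w * E n (l - j)%N w))
      * (Num.sqrt n%:R)^-1)).
  near=> n => w; have n0 : (0 < n)%N by near: n; exact: nbhs_infty_gt.
  have s0 : 0 < Num.sqrt n%:R :> R by rewrite sqrtr_gt0 ltr0n.
  have /= -> := @moment_recursion_deviation _ m D (fun i => Mh n i w) (fun i => Dh n i w)
    _ l s0 (MhE n l w) (DE lk).
  rewrite limit_vectorE mul1r.
  under [in RHS]eq_bigr do rewrite mulrBr.
  by rewrite sumrB; ring.
apply: oPB; last first.
  apply: OP_oPM; last by apply: oP_deterministic; exact: inv_sqrt_cvg0.
  apply: OPZl; apply: OP_sum => j /sub[jk [jl [jk' jl']]] _; apply: OPZl.
  by apply: OPM; exact: OPE.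
apply: oPB; first exact: g_oP.
apply: oP_sum => j /sub[jk [jl _]] _; apply: oPZl.
by have [] := IHl j jl jk.
Unshelve. all: by end_near. Qed.

End RecursionOrder.

Section MomentHatMeasurable.
Context {R : realType} {d : measure_display} {Omega : measurableType d}.

Lemma measurable_moment_hat n t xi (y : nat -> Omega -> R) l :
  (forall j, (j <= n)%N -> measurable_fun setT (y j)) ->
  measurable_fun setT (fun w => moment_hat n t xi (fun j => y j w) l).
Proof.
move=> my; elim/ltn_ind: l => l IHl; under eq_fun do rewrite moment_hatE.
apply: measurable_funM => //; apply: measurable_funB.
  rewrite /diff_moment_hat; apply: measurable_funM => //.
  under eq_fun do rewrite nbr_sumE.
  apply: measurable_sum_cond => g _; apply: measurable_funX.
  by apply: measurable_funB; apply: my; rewrite -ltnS.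
under eq_fun do rewrite big_nat; apply: measurable_sum_cond => j /andP[j1 jl].
apply: measurable_funM; last by apply: IHl; lia.
by apply: measurable_funM => //; exact: IHl.
Qed.

End MomentHatMeasurable.

Theorem theorem4 (R : realType) (d : measure_display)
  (Omega : measurableType d) (P : probability Omega R)
  (T : R) (T_gt0 : 0 < T)
  (* grids *)
  (t : nat -> nat -> R)
  (t_first : forall n, (0 < n)%N -> t n 0 = 0)
  (t_last : forall n, (0 < n)%N -> t n n = T)
  (t_incr : forall n j, (j < n)%N -> t n j < t n j.+1)
  (t_mesh : max_step n (t n) @[n --> \oo] --> (0 : R))
  (* latent process *)
  (F : R -> set (set Omega)) (F_filtration : filtration T F)
  (B : R -> Omega -> R) (B_brownian : brownian P T F B)
  (mu sigma X : R -> Omega -> R)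
  (mu_progressive : progressive T F mu)
  (mu_locally_bounded : locally_bounded P T F mu)
  (sigma_positive :
     {ae P, forall w, forall s, 0 <= s <= T -> 0 < sigma s w})
  (sigma_locally_bounded : locally_bounded P T F sigma)
  (sigma_ito : ito_semimartingale P T F sigma)
  (X_ito : ito_process P T F mu sigma B X)
  (* errors *)
  (f : R -> R) (f_measurable : measurable_fun setT f)
  (f_ge0 : forall x : R, 0 <= f x)
  (f_total : (\int[lebesgue_measure]_x (f x)%:E = 1)%E)
  (U : nat -> nat -> Omega -> R)
  (U_measurable : forall n j, (j <= n)%N -> measurable_fun setT (U n j))
  (U_density : forall n j, (j <= n)%N -> has_density P f (U n j))
  (U_independent : forall n,
     independent_variables P (fun j : 'I_n.+1 => U n j))
  (U_X_independent : forall n, independent_sigma P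
     (sigma_of [set j : nat | (j <= n)%N] (U n)) (sigma_of `[0, T] X))
  (* comparable step sizes *)
  (steps_comparable : asymp (fun n => min_step n (t n))
                            (fun n => max_step n (t n)))
  (* characteristic function of the errors *)
  (charfun_real : forall s : R, complex.Im (charfun f s) = 0)
  (charfun_neq0 : forall s : R, charfun f s != 0)
  (* moments *)
  (k : nat) (k_gt0 : (0 < k)%N)
  (mu_moment : (\int[P]_w \int[lebesgue_measure]_(s in `[0%R, T])
                  (mu s w ^+ (2 * k))%:E < +oo)%E)
  (sigma_moment : (\int[P]_w \int[lebesgue_measure]_(s in `[0%R, T])
                     (sigma s w ^+ (2 * k))%:E < +oo)%E)
  (p : R) (p_range : 2 < p <= 3)
  (U_moment : (\int[lebesgue_measure]_x
                 (`|x : R| `^ ((2 * k)%:R * p) * f x)%:E < +oo)%E)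
  (* bandwidth *)
  (xi : nat -> R) (xi_gt0 : forall n, 0 < xi n)
  (nbr_max_min : asymp (R := R) (fun n => (nbr_max n (t n) (xi n))%:R)
                       (fun n => (nbr_min n (t n) (xi n))%:R))
  (nbr_min_nxi : asymp (R := R) (fun n => (nbr_min n (t n) (xi n))%:R)
                       (fun n => n%:R * xi n))
  (xi_small : (xi : nat -> R^o)
     =o_\oo (fun n => n%:R `^ (- (p / (2 * (p - 1)))) : R^o))
  (* limit quantities *)
  (a_exists : forall l, (1 <= l <= k)%N -> cvgn (a_seq P f t xi U l))
  (e_exists : forall l1 l2, (1 <= l1 <= k)%N -> (1 <= l2 <= k)%N ->
     cvgn (e_seq P f t xi U l1 l2))
  (d' : measure_display) (Omega' : measurableType d')
  (P' : probability Omega' R) (W : nat -> Omega' -> R)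
  (W_gaussian : gaussian_vector P' (Sigma_mat P f t xi U k)
                  (fun w => \row_(i < k) W i.+1 w)) :
  cvg_in_distribution P P'
    (fun n w => \row_(i < k) (Num.sqrt n%:R *
       (moment_hat n (t n) (xi n) (fun j => X (t n j) w + U n j w) i.+1
        - moment f (2 * i.+1))))
    (fun w => \row_(i < k)
       limit_vector (a_lim P f t xi U) (fun l => W l w) (moment f) i.+1).
Proof.
(* This is where [p > 2] enters: moments of order [4 k] make the kernels up to degree [2 k] square
   integrable. *)
have q0r : (4 * k)%:R <= (2 * k)%:R * p.
  have /andP[p2 _] := p_range.
  rewrite (_ : (4 * k)%N = (2 * k * 2)%N); last by lia.
  by rewrite natrM ler_wpM2l// ltW.
have xi0 := sqrt_bandwidth_cvg0 xi_gt0 p_range xi_small.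
have [sigma_adapted sigma_cadlag _] := sigma_ito.
have t_itv := grid_itv t_first t_last t_incr.
have mX s : 0 <= s <= T -> measurable_fun setT (X s).
  exact: (adapted_measurable F_filtration X_ito.1).
have odd0 q : odd q -> (q <= 4 * k)%N -> moment f q = 0.
  exact: (moment_odd f_measurable f_ge0 f_total q0r U_moment
    (U_measurable 0 0 (leqnn 0)) (U_density 0 0 (leqnn 0)) charfun_real).
have latent := latent_increments T_gt0 F_filtration B_brownian mu_progressive
  mu_locally_bounded sigma_adapted sigma_cadlag X_ito k_gt0 sigma_moment
  t_first t_last t_incr xi_gt0 nbr_max_min nbr_min_nxi xi0.
have rem l : (1 <= l <= k)%N -> oP P (fun n w => Num.sqrt n%:R *
    (diff_moment_hat n (t n) (xi n) (fun j => X (t n j) w + U n j w) l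
     - diff_moment_hat n (t n) (xi n) (fun j => U n j w) l)).
  move=> /andP[l1 lk].
  by apply: (signal_remainder_oP f_measurable f_ge0 f_total U_measurable U_density
    U_independent q0r U_moment odd0 mX U_X_independent t_itv t_incr nbr_max_min latent l1); lia.
pose hd := half_deviation f U t xi.
have hd_OP l : (1 <= l <= k)%N -> OP P (fun n w => hd n l w).
  exact: (half_deviation_OP f_measurable f_ge0 f_total U_measurable U_density
    U_independent q0r U_moment nbr_max_min a_exists).
have hdE n l w : (0 < n)%N -> 2^-1 * (Num.sqrt n%:R *
    (diff_moment_hat n (t n) (xi n) (fun j => U n j w) l - diff_moment f (2 * l))) = hd n l w.
  move=> n0; have N0 : (nbr_total n (t n) (xi n))%:R != 0 :> R.
    by rewrite pnatr_eq0 -lt0n; exact: (nbr_total_gt0 nbr_max_min).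
  rewrite /hd /half_deviation /centered_sum !nbr_sumE sumrB sumr_const card_close.
  rewrite /diff_moment_hat nbr_sumE -[_ *+ nbr_total _ _ _]mulr_natl.
  by field.
pose Mh n l w := moment_hat n (t n) (xi n) (fun j => X (t n j) w + U n j w) l.
pose Dh n l w := diff_moment_hat n (t n) (xi n) (fun j => X (t n j) w + U n j w) l.
pose m := moment f.
have MhE n l w : Mh n l w = 2^-1 * (Dh n l w
    - \sum_(1 <= j < l) 'C(2 * l, 2 * j)%:R * Mh n j w * Mh n (l - j)%N w).
  exact: moment_hatE.
have DE l : (1 <= l <= k)%N -> diff_moment f (2 * l) = 2 * m (2 * l)%N +
    \sum_(1 <= j < l) 'C(2 * l, 2 * j)%:R * m (2 * j)%N * m (2 * (l - j))%N.
  move=> /andP[l1 lk].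
  by apply: (diff_moment_even f_measurable f_ge0 f_total q0r U_moment odd0 l1); lia.
have drive_oP l : (1 <= l <= k)%N -> oP P (fun n w =>
    2^-1 * (Num.sqrt n%:R * (Dh n l w - diff_moment f (2 * l))) - hd n l w).
  move=> lk; apply: oP_eq (oPZl 2^-1 (rem l lk)); near=> n => w.
  have n0 : (0 < n)%N by near: n; exact: nbhs_infty_gt.
  by rewrite -hdE// /Dh; ring.
have rec := recursion_order MhE DE drive_oP hd_OP.
pose G n l w := limit_vector (fun=> 1) (fun i => hd n i w) m l.
have ord_k (i : 'I_k) : (1 <= i.+1 <= k)%N by rewrite ltn_ord.
set Z := (fun n w => \row_i _); set Q := (fun w => \row_i _).
have ZE n w i : Z n w 0 i = Num.sqrt n%:R * (Mh n i.+1 w - m (2 * i.+1)%N).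
  by rewrite mxE.
have mZ : \forall n \near \oo, forall i, measurable_fun setT (fun w => Z n w 0 i).
  near=> n => i; have n0 : (0 < n)%N by near: n; exact: nbhs_infty_gt.
  under eq_fun do rewrite ZE.
  apply: measurable_funM => //; apply: measurable_funB => //.
  apply: (@measurable_moment_hat _ _ _ n (t n) (xi n) (fun j w => X (t n j) w + U n j w) i.+1) => j jn.
  by apply: measurable_funD; [apply: mX; exact: t_itv|exact: U_measurable].
pose a := a_lim P f t xi U.
have mW (i : 'I_k) : measurable_fun setT (W i.+1).
  by have [/(_ i) + _] := W_gaussian; under eq_fun do rewrite mxE.
have QE w i : Q w 0 i = \sum_(j < k) a j.+1 * W j.+1 w * drive_coef m i.+1 j.+1.
  rewrite mxE limit_vector_drive (drive_linear m _ (ord_k i)).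
  by rewrite big_add1 big_mkord.
have mQ i : measurable_fun setT (fun w => Q w 0 i).
  under eq_fun do rewrite QE; apply: measurable_sum_cond => j _.
  by apply: measurable_funM => //; apply: measurable_funM.
have sum_nat (g : nat -> R) : \sum_(1 <= j < k.+1) g j = \sum_(j < k) g j.+1.
  by rewrite big_add1 big_mkord.
apply: (trig_cvg_in_distribution mZ mQ); last first.
  move=> e e0.
  have OPZ : OP P (fun n w => \sum_(j < k) `|Z n w 0 j|).
    apply: OP_sum => j _ _; have [h1 h2] := rec j.+1 (ord_k j).
    have OPj : OP P (fun n w => Num.sqrt n%:R * (Mh n j.+1 w - m (2 * j.+1)%N)).
      by apply: OP_eq (OPD (oP_OP h1) h2); apply: nearW => n w; rewrite subrK.
    move=> e' e'0; have [L HL] := OPj e' e'0; exists L; apply: filterS HL => n [A [mA PA HA]].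
    by exists A; split => // w /HA; rewrite normr_id ZE.
  have [L HL] := OPZ e e0; exists L; apply: filterS HL => n [A [mA PA HA]].
  exists A; split => // w /HA h j; apply: le_trans h.
  apply: le_trans (ler_norm _).
  by rewrite (bigD1 j)//= lerDl sumr_ge0.
move=> u theta.
(* The direction [u] pulled back through the recursion: in this way [u] applied to the linearized
   deviations becomes a combination of the inputs [hd], and [u] applied to [Q] the same combination
   of the variables [a_l W_l]. *)
pose c j := \sum_(i < k) u 0 i * drive_coef m i.+1 j.
pose V := limit_variance P f U k t xi c.
have V0 : 0 <= V.
  exact: (limit_variance_ge0 f_measurable f_ge0 f_total U_measurable U_density
    U_independent q0r U_moment nbr_max_min a_exists e_exists c).
have clt := combination_clt f_measurable f_ge0 f_total U_measurable U_density
    U_independent q0r U_moment t_incr nbr_max_min a_exists e_exists (c := c) (theta := theta).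
pose S n w := \sum_(1 <= l < k.+1) c l * hd n l w.
have SE n w : S n w = \sum_(i < k) u 0 i * G n i.+1 w.
  rewrite /S /c; under eq_bigr do rewrite mulr_suml.
  rewrite exchange_big/=; apply: eq_bigr => i _.
  rewrite /G (drive_linear m _ (ord_k i)) mulr_sumr; apply: eq_bigr => j _.
  by ring.
have ZS : oP P (fun n w => rdot u (Z n w) - S n w).
  apply: (@oP_eq _ _ _ P _ (fun n w => \sum_(i < k) u 0 i *
      (Num.sqrt n%:R * (Mh n i.+1 w - m (2 * i.+1)%N) - G n i.+1 w))).
    apply: nearW => n w; rewrite rdotE SE -sumrB; apply: eq_bigr => i _.
    by rewrite -mulrBr ZE.
  by apply: oP_sum => i _ _; apply: oPZl; have [] := rec i.+1 (ord_k i).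
have mS n : measurable_fun setT (S n).
  rewrite /S; under eq_fun do rewrite big_nat; apply: measurable_sum_cond => l /andP[_ lk].
  apply: measurable_funM => //; apply: measurable_funM => //; apply: measurable_funM => //.
  exact: (centered_sum_L2 f_measurable f_ge0 f_total U_measurable U_density
    U_independent q0r U_moment t xi n lk).1.1.
(* By linearity [u . Q] is a linear form [v . W], hence centered normal, and its variance, read from
   [Sigma_mat], is the limit variance [V] of the error sums. *)
have limQ : \int[P']_w cos (rdot u (Q w) + theta) = expR (- (V / 2)) * cos theta.
  pose v : 'rV[R]_k := \row_j (c j.+1 * a j.+1).
  have rQ w : rdot u (Q w) = (v *m (\row_i W i.+1 w)^T) 0 0.
    rewrite -/(rdot v _) !rdotE; under eq_bigr do rewrite QE mulr_sumr.
    rewrite exchange_big/=; apply: eq_bigr => j _; rewrite !mxE /c mulr_suml mulr_suml.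
    by apply: eq_bigr => i _; ring.
  have vV : (v *m Sigma_mat P f t xi U k *m v^T) 0 0 = V.
    rewrite /V /limit_variance sum_nat mxE; under eq_bigr do rewrite mxE mulr_suml.
    rewrite exchange_big/=; apply: eq_bigr => i _; rewrite sum_nat; apply: eq_bigr => j _.
    by rewrite !mxE; exact: mulrAC.
  apply: (centered_normal_cos _ V0).
    by apply: measurable_rdot.
  move=> A mA; rewrite -vV; have [_ /(_ v A mA) <-] := W_gaussian.
  by congr (P' _); apply/funext => w /=; rewrite rQ.
rewrite limQ; apply: Ex_cos_oP ZS clt.
  by apply: filterS mZ => n mZn; exact: measurable_rdot.
exact: nearW.
Unshelve. all: by end_near. Qed.
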